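(* Let $l=(l_1,l_2,l_3)$ and $\theta=(\theta_1,\theta_2,\theta_3)$ be the edge lengths and angles of a triangle in $\mathbb E^2$, $\mathbb H^2$ or $\mathbb S^2$ (or the lengths of three pairwise non-adjacent edges and of their opposite edges in a hyperbolic right-angled hexagon). The following is the complete list, up to scaling, of all closed real-valued 1-forms of the form $\sum_{i=1}^3 f(\theta_i)\,dg(l_i)$ for some non-constant smooth functions $f,g$. Let $\lambda\in\mathbb R$ and $u=(u_1,u_2,u_3)$. (a) For a Euclidean triangle, $$w_\lambda=\sum_{i=1}^3\frac{\int^{\theta_i}\sin^\lambda(t)\,dt}{l_i^{\lambda+1}}\,dl_i.$$ Furthermore, its integration $\int^u w_\lambda$ is locally convex in the variable $u$, where $u_i=\int_1^{l_i}t^{-\lambda-1}\,dt$. (b) For a spherical triangle, $$w_\lambda=\sum_{i=1}^3\frac{\int^{\theta_i}\sin^\lambda(t)\,dt}{\sin^{\lambda+1}(l_i)}\,dl_i.$$ The integral $\int^u w_\lambda$ is locally strictly convex in $u$, where $u_i=\int_{\pi/2}^{l_i}\sin^{-\lambda-1}(t)\,dt$. (c) For a hyperbolic triangle, $$w_\lambda=\sum_{i=1}^3\frac{\int^{\theta_i}\sin^\lambda(t)\,dt}{\sinh^{\lambda+1}(l_i)}\,dl_i.$$ (d) For a hyperbolic right-angled hexagon, $$w_\lambda=\sum_{i=1}^3\frac{\int^{\theta_i}\sinh^\lambda(t)\,dt}{\sinh^{\lambda+1}(l_i)}\,dl_i.$$ In the cases (b), (c), (d), by taking the Legendre transformation (i.e.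 exchanging the roles of the two factors: replacing $\sum_i F(\theta_i)\,dG(l_i)$ by $\sum_i G(l_i)\,dF(\theta_i)$), one also obtains the complete list, up to scaling, of all closed 1-forms of the form $\sum_{i=1}^3 g(l_i)\,df(\theta_i)$ with $f,g$ non-constant smooth functions.
   Context: The angle $\theta_i$ is opposite to the edge of length $l_i$. The 1-forms live on the open set of all $(l_1,l_2,l_3)$ that are edge lengths of such triangles (for the hexagon: all of $\mathbb R_{>0}^3$), with $\theta_i$ regarded as a function of $l$ given by the cosine law of the respective geometry; for the hexagon $\cosh\theta_i=\frac{\cosh l_i+\cosh l_j\cosh l_k}{\sinh l_j\sinh l_k}$, $\{i,j,k\}=\{1,2,3\}$. $\int^{z}h(t)\,dt$ denotes an antiderivative of $h$ (an arbitrary additive constant is allowed, the same for $i=1,2,3$). The map $l\mapsto u$ is a diffeomorphism onto its image, and $\int^u w_\lambda$ denotes a primitive of $w_\lambda$ expressed in the variable $u$. ''Locally convex'' means that the Hessian matrix is positive semi-definite at every point; ''locally strictly convex'' means that the Hessian matrix is positive definite at every point. *)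

(* Defs.v *)
From Stdlib Require Import Reals.
From Coquelicot Require Import Coquelicot.
Open Scope R_scope.

(** * Coordinates on R^3 *)

Inductive ix : Set := i1 | i2 | i3.

Definition nxt (i : ix) : ix :=
  match i with i1 => i2 | i2 => i3 | i3 => i1 end.
Definition prv (i : ix) : ix :=
  match i with i1 => i3 | i2 => i1 | i3 => i2 end.

Definition R3 : Type := (R * R * R)%type.

Definition co (i : ix) (l : R3) : R :=
  match i with i1 => fst (fst l) | i2 => snd (fst l) | i3 => snd l end.

Definition upd (l : R3) (i : ix) (t : R) : R3 :=
  match i with
  | i1 => (t, co i2 l, co i3 l)
  | i2 => (co i1 l, t, co i3 l)
  | i3 => (co i1 l, co i2 l, t)
  end.

Definition map3 (h : R -> R) (l : R3) : R3 :=
  (h (co i1 l), h (co i2 l), h (co i3 l)).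

Definition sum3 (a : ix -> R) : R := a i1 + a i2 + a i3.

Definition partial (i : ix) (F : R3 -> R) (l : R3) : R :=
  Derive (fun t => F (upd l i t)) (co i l).
Definition ex_partial (i : ix) (F : R3 -> R) (l : R3) : Prop :=
  ex_derive (fun t => F (upd l i t)) (co i l).

(** * Functions of one variable on an open interval *)

(* Functions are total; only their values on the open interval [I] matter. *)
Definition smooth_on (I : R -> Prop) (f : R -> R) : Prop :=
  forall (n : nat) (x : R), I x -> ex_derive_n f n x.

Definition non_constant_on (I : R -> Prop) (f : R -> R) : Prop :=
  ~ exists c : R, forall x : R, I x -> f x = c.

Definition antiderivative_on (I : R -> Prop) (h F : R -> R) : Prop :=
  forall x : R, I x -> is_derive F x (h x).

Definition pos_real (x : R) : Prop := 0 < x.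
Definition zero_pi (x : R) : Prop := 0 < x < PI.

(** * 1-forms on subsets of R^3 *)

(* [w l i] is the coefficient of dl_i at the point l. *)
Definition form : Type := R3 -> ix -> R.

Definition form_eq (T : R3 -> Prop) (w w' : form) : Prop :=
  forall l, T l -> forall i, w l i = w' l i.

Definition scale_form (c : R) (w : form) : form := fun l i => c * w l i.

(* sum_i p_i dq_i *)
Definition sum_form (p q : ix -> R3 -> R) : form :=
  fun l j => sum3 (fun i => p i l * partial j (q i) l).

Definition closed_form (T : R3 -> Prop) (w : form) : Prop :=
  forall l, T l -> forall i j,
    ex_partial i (fun x => w x j) l /\
    partial i (fun x => w x j) l = partial j (fun x => w x i) l.

Definition is_primitive (T : R3 -> Prop) (w : form) (V : R3 -> R) : Prop :=
  forall l, T l ->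
    filterdiff V (locally l) (fun h : R3 => sum3 (fun i => w l i * co i h)).

(** * Local convexity through the Hessian *)

Definition hessian (W : R3 -> R) (u : R3) (i j : ix) : R :=
  partial i (partial j W) u.

Definition hessian_exists (W : R3 -> R) (u : R3) : Prop :=
  (forall j, ex_partial j W u) /\ (forall i j, ex_partial i (partial j W) u).

Definition quad (A : ix -> ix -> R) (v : ix -> R) : R :=
  sum3 (fun i => sum3 (fun j => A i j * v i * v j)).

Definition pos_semidef (A : ix -> ix -> R) : Prop :=
  forall v : ix -> R, 0 <= quad A v.
Definition pos_def (A : ix -> ix -> R) : Prop :=
  forall v : ix -> R, (exists i, v i <> 0) -> 0 < quad A v.

Definition locally_convex (U : R3 -> Prop) (W : R3 -> R) : Prop :=
  forall u, U u -> hessian_exists W u /\ pos_semidef (hessian W u).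
Definition locally_strictly_convex (U : R3 -> Prop) (W : R3 -> R) : Prop :=
  forall u, U u -> hessian_exists W u /\ pos_def (hessian W u).

Definition image (phi : R3 -> R3) (T : R3 -> Prop) : R3 -> Prop :=
  fun u => exists l, T l /\ u = phi l.

(* [W] is the integral of [w] expressed in the variable u = phi(l): a function
   on the image of [phi] whose pull-back by [phi] is a primitive of [w]. *)
Definition integral_in (phi : R3 -> R3) (T : R3 -> Prop) (w : form)
    (W : R3 -> R) : Prop :=
  is_primitive T w (fun l => W (phi l)).

(** * Triangles and hexagons *)

Definition E2_lengths (l : R3) : Prop :=
  forall i, 0 < co i l /\ co i l < co (nxt i) l + co (prv i) l.

Definition H2_lengths (l : R3) : Prop :=
  forall i, 0 < co i l /\ co i l < co (nxt i) l + co (prv i) l.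

Definition S2_lengths (l : R3) : Prop :=
  (forall i, 0 < co i l /\ co i l < co (nxt i) l + co (prv i) l) /\
  co i1 l + co i2 l + co i3 l < 2 * PI.

Definition hexagon_lengths (l : R3) : Prop := forall i, 0 < co i l.

(* Inverse of cosh : [0, +oo) -> [1, +oo). *)
Definition arcosh (x : R) : R := ln (x + sqrt (x ^ 2 - 1)).

Definition E2_angle (i : ix) (l : R3) : R :=
  let a := co i l in let b := co (nxt i) l in let c := co (prv i) l in
  acos ((b ^ 2 + c ^ 2 - a ^ 2) / (2 * b * c)).

Definition S2_angle (i : ix) (l : R3) : R :=
  let a := co i l in let b := co (nxt i) l in let c := co (prv i) l in
  acos ((cos a - cos b * cos c) / (sin b * sin c)).

Definition H2_angle (i : ix) (l : R3) : R :=
  let a := co i l in let b := co (nxt i) l in let c := co (prv i) l in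
  acos ((cosh b * cosh c - cosh a) / (sinh b * sinh c)).

Definition hexagon_angle (i : ix) (l : R3) : R :=
  let a := co i l in let b := co (nxt i) l in let c := co (prv i) l in
  arcosh ((cosh a + cosh b * cosh c) / (sinh b * sinh c)).

(** * The families of 1-forms *)

(* sum_i f(theta_i) dg(l_i) *)
Definition edge_form (theta : ix -> R3 -> R) (f g : R -> R) : form :=
  sum_form (fun i l => f (theta i l)) (fun i l => g (co i l)).

(* sum_i g(l_i) df(theta_i) *)
Definition angle_form (theta : ix -> R3 -> R) (f g : R -> R) : form :=
  sum_form (fun i l => g (co i l)) (fun i l => f (theta i l)).

(* sum_i F(theta_i) / s(l_i)^(lambda+1) dl_i *)
Definition w_form (theta : ix -> R3 -> R) (s : R -> R) (lambda : R)
    (F : R -> R) : form :=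
  fun l i => F (theta i l) / Rpower (s (co i l)) (lambda + 1).

(* The forms [w_form] with F an antiderivative of r^lambda, for all lambda.
   The same F, hence the same integration constant, is used for i = 1, 2, 3. *)
Definition w_list (theta : ix -> R3 -> R) (Itheta : R -> Prop)
    (r s : R -> R) (w : form) : Prop :=
  exists (lambda : R) (F : R -> R),
    antiderivative_on Itheta (fun t => Rpower (r t) lambda) F /\
    w = w_form theta s lambda F.

(* Legendre transforms sum_i G(l_i) dF(theta_i) of the forms
   sum_i F(theta_i) dG(l_i) = w_lambda, i.e. dG = s^(-lambda-1) dl. *)
Definition legendre_list (theta : ix -> R3 -> R) (Itheta Il : R -> Prop)
    (r s : R -> R) (w : form) : Prop :=
  exists (lambda : R) (F G : R -> R),
    antiderivative_on Itheta (fun t => Rpower (r t) lambda) F /\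
    antiderivative_on Il (fun t => Rpower (s t) (- lambda - 1)) G /\
    w = angle_form theta F G.

(* Among the 1-forms [A f g] on T with f, g smooth and non-constant, the closed
   ones are exactly the nonzero multiples of the members of [lst]. *)
Definition complete_list (T : R3 -> Prop) (A : (R -> R) -> (R -> R) -> form)
    (Itheta Il : R -> Prop) (lst : form -> Prop) : Prop :=
  forall w : form,
    (closed_form T w /\
     exists f g : R -> R,
       smooth_on Itheta f /\ non_constant_on Itheta f /\
       smooth_on Il g /\ non_constant_on Il g /\
       form_eq T w (A f g))
    <->
    (exists (c : R) (w0 : form),
       c <> 0 /\ lst w0 /\ form_eq T w (scale_form c w0)).

Definition E2_u (lambda : R) : R3 -> R3 :=
  map3 (fun x => RInt (fun t => Rpower t (- lambda - 1)) 1 x).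

Definition S2_u (lambda : R) : R3 -> R3 :=
  map3 (fun x => RInt (fun t => Rpower (sin t) (- lambda - 1)) (PI / 2) x).

(* Main.v *)
Require Import Defs.
From Stdlib Require Import Reals.
From Coquelicot Require Import Coquelicot.
From Stdlib Require Import Lra Lia ClassicalEpsilon.
Open Scope R_scope.

(** Write r, c for (sin, cos) or (sinh, cosh) of angles, s, C for the analogous
    functions of lengths (s(x) = x and C = 1 in the Euclidean case).  In all four
    geometries r(theta_i) s(l_j) s(l_k) = A does not depend on i, the derivative
    of the cosine law is
      d theta_i = (s(l_i) / A) (dl_i - c(theta_k) dl_j - c(theta_j) dl_k),
    and the dual cosine law c_i + c_j c_k = r_j r_k C_i holds.  So
    sum_i f(theta_i) dg(l_i) is closed iff p(theta_1) q(l_1) = p(theta_2) q(l_2)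
    etc., where p = f' and q = g' s.  Differentiating this relation shows that
    p solves a linear differential equation along the curves on which only l_1
    varies, whence p and q have no zeros; then that s q' / q is a multiple of C,
    so q = const s^(- lambda), and then that p r^(- lambda) is locally constant.
    Since d(g df) = - d(f dg), the transformed forms sum_i g(l_i) df(theta_i)
    obey the same relation.  Finally the Hessian of the integral is, up to a
    positive factor, the quadratic form with matrix 1 on the diagonal and
    - c(theta_k) in place (i, j), which the dual cosine law writes as a square
    plus a binary form of discriminant C_1^2 - 1. *)

(** The obstacle is that p and q are merely smooth, so nothing may be divided by them until they are
    known to be free of zeros, and at the start p is nonzero only at some angle alpha and q only at
    some length a. A triangle in which a lies opposite to alpha transfers the nonvanishing of q to
    its second length. The field [linked] provides, for every angle, a triangle with that angle
    whose first two lengths are both reached in this way. There the linear equation for p is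
    regular: its coefficient has only q(l_1), q(l_2) and 1 - c(theta_3)^2 in denominators.
    Uniqueness then makes the zero set of p open, and connectedness of the interval of angles leaves
    it empty.

    For the integrals, existence rests on the convexity of the length domains. In the variable u the
    gradient of the integral is F(theta_i). Euclidean angles do not change under dilations, so there
    the Hessian has a kernel and strict convexity cannot be expected; this is the case C = 1, where
    the discriminant C_1^2 - 1 is zero. *)

(** * Differential calculus on triples of reals *)

Lemma is_derive_eq (f : R -> R) (x d d' : R) :
  is_derive f x d -> d = d' -> is_derive f x d'.
Proof. intros H <-. exact H. Qed.

(** Total differentiability, with the gradient indexed by [ix]. It composes with curves and gives
    continuity, which partial derivatives alone do not; the partial derivatives that [closed_form]
    and [hessian] ask for are read off by [diff3_partial]. *)
Definition diff3 (f : R3 -> R) (l : R3) (d : ix -> R) : Prop :=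
  filterdiff f (locally l) (fun h : R3 => sum3 (fun i => d i * co i h)).

Definition kron (i j : ix) : R :=
  match i, j with i1, i1 | i2, i2 | i3, i3 => 1 | _, _ => 0 end.

Lemma sum3_kron (i : ix) (a : ix -> R) : sum3 (fun j => kron i j * a j) = a i.
Proof. destruct i; unfold sum3, kron; ring. Qed.

Lemma R3_eta (l : R3) : l = (co i1 l, co i2 l, co i3 l).
Proof. now destruct l as [[a b] c]. Qed.

Lemma R3_ext (l m : R3) : (forall i, co i l = co i m) -> l = m.
Proof.
  intros H. rewrite (R3_eta l), (R3_eta m).
  now rewrite (H i1), (H i2), (H i3).
Qed.

Lemma co_upd (l : R3) (i j : ix) (t : R) :
  co j (upd l i t) = kron i j * t + (1 - kron i j) * co j l.
Proof. destruct i, j; simpl; ring. Qed.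

Lemma upd_co (l : R3) (i : ix) : upd l i (co i l) = l.
Proof. destruct l as [[a b] c], i; reflexivity. Qed.

Lemma is_linear_co (i : ix) : is_linear (co i : R3 -> R).
Proof.
  destruct i; simpl.
  - apply (is_linear_comp (fst : R3 -> R * R) fst); apply is_linear_fst.
  - apply (is_linear_comp (fst : R3 -> R * R) snd);
      [apply is_linear_fst | apply is_linear_snd].
  - apply is_linear_snd.
Qed.

Lemma diff3_ext_d (f : R3 -> R) (l : R3) (d d' : ix -> R) :
  (forall i, d i = d' i) -> diff3 f l d -> diff3 f l d'.
Proof.
  intros E H. apply (filterdiff_ext_lin _ _ _ H).
  intros y. unfold sum3. now rewrite !E.
Qed.

Lemma diff3_ext_loc (f g : R3 -> R) (l : R3) (d : ix -> R) :
  locally l (fun x => f x = g x) -> diff3 f l d -> diff3 g l d.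
Proof. intros E H. exact (filterdiff_ext_locally f g l _ E H). Qed.

Lemma diff3_ext (f g : R3 -> R) (l : R3) (d : ix -> R) :
  (forall x, f x = g x) -> diff3 f l d -> diff3 g l d.
Proof. intros E. apply diff3_ext_loc. now apply filter_forall. Qed.

Lemma diff3_const (a : R) (l : R3) : diff3 (fun _ => a) l (fun _ => 0).
Proof.
  apply (filterdiff_ext_lin _ (fun _ => zero)).
  - apply filterdiff_const.
  - intros y. unfold sum3, zero; simpl. ring.
Qed.

Lemma diff3_co (i : ix) (l : R3) : diff3 (co i) l (kron i).
Proof.
  apply (filterdiff_ext_lin _ (co i)).
  - apply filterdiff_linear, is_linear_co.
  - intros y. symmetry. apply (sum3_kron i (fun j => co j y)).
Qed.

Lemma diff3_plus (f g : R3 -> R) (l : R3) (d e : ix -> R) :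
  diff3 f l d -> diff3 g l e ->
  diff3 (fun x => f x + g x) l (fun i => d i + e i).
Proof.
  intros Hf Hg. eapply filterdiff_ext_lin.
  - exact (filterdiff_plus_fct _ _ _ _ Hf Hg).
  - intros y. unfold plus, sum3; simpl. ring.
Qed.

Lemma diff3_mult (f g : R3 -> R) (l : R3) (d e : ix -> R) :
  diff3 f l d -> diff3 g l e ->
  diff3 (fun x => f x * g x) l (fun i => d i * g l + f l * e i).
Proof.
  intros Hf Hg. eapply filterdiff_ext_lin.
  - exact (filterdiff_mult_fct _ _ _ _ _ Rmult_comm Hf Hg).
  - intros y. unfold plus, mult, sum3; simpl. ring.
Qed.

Lemma diff3_comp (g : R -> R) (f : R3 -> R) (l : R3) (d : ix -> R) (g' : R) :
  diff3 f l d -> is_derive g (f l) g' ->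
  diff3 (fun x => g (f x)) l (fun i => g' * d i).
Proof.
  intros Hf Hg. eapply filterdiff_ext_lin.
  - exact (filterdiff_comp' _ _ _ _ _ Hf Hg).
  - intros y. unfold scal, sum3; simpl. unfold mult; simpl. ring.
Qed.

Lemma diff3_minus (f g : R3 -> R) (l : R3) (d e : ix -> R) :
  diff3 f l d -> diff3 g l e ->
  diff3 (fun x => f x - g x) l (fun i => d i - e i).
Proof.
  intros Hf Hg.
  apply (diff3_ext (fun x => f x + (- 1) * g x)); [intros x; ring|].
  eapply diff3_ext_d;
    [|apply (diff3_plus _ _ _ _ _ Hf (diff3_mult _ _ _ _ _ (diff3_const (-1) l) Hg))].
  intros i; cbv beta; ring.
Qed.

Lemma diff3_div (f g : R3 -> R) (l : R3) (d e : ix -> R) :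
  diff3 f l d -> diff3 g l e -> g l <> 0 ->
  diff3 (fun x => f x / g x) l (fun i => (d i * g l - f l * e i) / g l ^ 2).
Proof.
  intros Hf Hg H0.
  eapply diff3_ext_d.
  2: { apply (diff3_mult f (fun x => / g x)); [exact Hf|].
       apply (diff3_comp Rinv g l e (- / g l ^ 2)); [exact Hg|].
       auto_derive; [exact H0|]. field. exact H0. }
  intros i; cbv beta. field. exact H0.
Qed.

Lemma diff3_comp_co (g : R -> R) (i : ix) (l : R3) (g' : R) :
  is_derive g (co i l) g' -> diff3 (fun x => g (co i x)) l (fun j => g' * kron i j).
Proof. intros H. exact (diff3_comp g (co i) l _ g' (diff3_co i l) H). Qed.

Lemma diff3_continuous (f : R3 -> R) (l : R3) (d : ix -> R) :
  diff3 f l d -> continuous f l.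
Proof. intros H. apply (filterdiff_continuous f l). eexists; exact H. Qed.

Lemma diff3_curve (f : R3 -> R) (x : R -> R3) (t : R) (d v : ix -> R) :
  diff3 f (x t) d -> (forall i, is_derive (fun s => co i (x s)) t (v i)) ->
  is_derive (fun s => f (x s)) t (sum3 (fun i => d i * v i)).
Proof.
  intros Hf Hx.
  (* The curve is assembled pair by pair: the pairing map is the identity up to eta, hence its own
     differential. *)
  assert (H2 : filterdiff (fun s => (co i1 (x s), co i2 (x s))) (locally t)
                 (fun s => (scal s (v i1), scal s (v i2)))).
  { apply (filterdiff_comp'_2 (fun s => co i1 (x s)) (fun s => co i2 (x s))
             (fun a b => (a, b)) t _ _ (fun a b => (a, b)) (Hx i1) (Hx i2)).
    apply (filterdiff_ext_lin _ (fun u => u)); [|now intros []].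
    apply (filterdiff_ext (fun u => u)); [now intros []|]. apply filterdiff_id. }
  assert (H3 : filterdiff x (locally t)
                 (fun s => ((scal s (v i1), scal s (v i2)), scal s (v i3)))).
  { apply (filterdiff_ext (fun s => ((co i1 (x s), co i2 (x s)), co i3 (x s)))).
    { intros s. symmetry. apply R3_eta. }
    apply (filterdiff_comp'_2 (fun s => (co i1 (x s), co i2 (x s))) (fun s => co i3 (x s))
             (fun a b => (a, b)) t _ _ (fun a b => (a, b)) H2 (Hx i3)).
    apply (filterdiff_ext_lin _ (fun u => u)); [|now intros []].
    apply (filterdiff_ext (fun u => u)); [now intros []|]. apply filterdiff_id. }
  eapply filterdiff_ext_lin.
  - exact (filterdiff_comp' x f t _ _ H3 Hf).
  - intros y. unfold scal, sum3; simpl. unfold mult; simpl. ring.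
Qed.

Lemma diff3_upd (f : R3 -> R) (l : R3) (d : ix -> R) (i : ix) :
  diff3 f l d -> is_derive (fun t => f (upd l i t)) (co i l) (d i).
Proof.
  intros H. eapply is_derive_eq.
  - apply (diff3_curve f (upd l i) (co i l) d (kron i)).
    + now rewrite upd_co.
    + intros j.
      apply (is_derive_ext (fun t => kron i j * t + (1 - kron i j) * co j l)).
      { intros t. symmetry. apply co_upd. }
      auto_derive; [easy|]. ring.
  - rewrite <- (sum3_kron i d). unfold sum3. ring.
Qed.

Lemma diff3_partial (f : R3 -> R) (l : R3) (d : ix -> R) (i : ix) :
  diff3 f l d -> ex_partial i f l /\ partial i f l = d i.
Proof.
  intros H%(fun H => diff3_upd f l d i H). split.
  - eexists; exact H.
  - now apply is_derive_unique.
Qed.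

Lemma continuous_gt (f : R3 -> R) (l : R3) :
  continuous f l -> 0 < f l -> locally l (fun x => 0 < f x).
Proof. intros Hf H0. exact (Hf _ (open_gt 0 _ H0)). Qed.

Lemma locally_upd (T : R3 -> Prop) (l : R3) (i : ix) :
  locally l T -> locally (co i l) (fun t => T (upd l i t)).
Proof.
  intros H.
  assert (Hc : filterlim (upd l i) (locally (co i l)) (locally l)).
  { intros P [e He]. exists e. intros t Ht. apply He.
    destruct l as [[a b] c], i; simpl in *;
      repeat split; simpl; try exact Ht; apply ball_center. }
  exact (Hc _ H).
Qed.

Lemma ex_partial_ext_loc (i : ix) (f g : R3 -> R) (l : R3) :
  locally l (fun x => f x = g x) -> ex_partial i f l -> ex_partial i g l.
Proof. intros H. apply ex_derive_ext_loc. exact (locally_upd _ l i H). Qed.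

Lemma partial_ext_loc (i : ix) (f g : R3 -> R) (l : R3) :
  locally l (fun x => f x = g x) -> partial i f l = partial i g l.
Proof. intros H. apply Derive_ext_loc. exact (locally_upd _ l i H). Qed.

(** Partial derivatives look at points near l, so equality of the forms on T suffices only because T
    is open. *)
Lemma closed_form_ext (T : R3 -> Prop) (w w' : form) :
  (forall l, T l -> locally l T) -> form_eq T w w' ->
  closed_form T w -> closed_form T w'.
Proof.
  intros HT E H l Hl i j.
  assert (EE : forall k, locally l (fun x => w x k = w' x k)).
  { intros k. apply (filter_imp T); [|now apply HT]. intros x Hx. now apply E. }
  destruct (H l Hl i j) as [H1 H2]. split.
  - exact (ex_partial_ext_loc i _ _ l (EE j) H1).
  - refine (eq_trans (eq_sym (partial_ext_loc i _ _ l (EE j))) _).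
    exact (eq_trans H2 (partial_ext_loc j _ _ l (EE i))).
Qed.

(** * Functions of one real variable *)

Definition is_open_interval (I : R -> Prop) : Prop :=
  (forall x, I x -> locally x I) /\
  (forall x y z, I x -> I z -> x <= y <= z -> I y).

Lemma is_open_interval_zero_pi : is_open_interval zero_pi.
Proof.
  split.
  - intros x [H1 H2].
    apply filter_and; [exact (open_gt 0 x H1) | exact (open_lt PI x H2)].
  - unfold zero_pi; intros; lra.
Qed.

Lemma is_open_interval_pos_real : is_open_interval pos_real.
Proof.
  split.
  - intros x H. exact (open_gt 0 x H).
  - unfold pos_real; intros; lra.
Qed.

Lemma interval_between (I : R -> Prop) (x y z : R) :
  is_open_interval I -> I x -> I y -> Rmin x y <= z <= Rmax x y -> I z.
Proof.
  intros [_ H] Hx Hy Hz. destruct (Rle_dec x y).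
  - rewrite Rmin_left, Rmax_right in Hz by lra. exact (H x z y Hx Hy Hz).
  - rewrite Rmin_right, Rmax_left in Hz by lra. exact (H y z x Hy Hx Hz).
Qed.

Lemma derive_zero_constant (I : R -> Prop) (f : R -> R) :
  is_open_interval I -> (forall x, I x -> is_derive f x 0) ->
  forall x y, I x -> I y -> f x = f y.
Proof.
  intros HI Hf x y Hx Hy.
  destruct (MVT_gen f x y (fun _ => 0)) as [c [_ Hc]].
  - intros z Hz. apply Hf, (interval_between I x y); auto; lra.
  - intros z Hz. apply derivable_continuous_pt. exists 0. apply is_derive_Reals.
    now apply Hf, (interval_between I x y).
  - lra.
Qed.

Lemma non_constant_derive (I : R -> Prop) (f f' : R -> R) :
  is_open_interval I -> (forall x, I x -> is_derive f x (f' x)) ->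
  non_constant_on I f -> exists x, I x /\ f' x <> 0.
Proof.
  intros HI Hf Hn.
  destruct (Classical_Prop.classic (exists x, I x /\ f' x <> 0)) as [|H]; [easy|].
  exfalso. apply Hn.
  destruct (Classical_Prop.classic (exists x, I x)) as [[x0 H0]|H0].
  - exists (f x0). intros x Hx.
    apply (derive_zero_constant I f HI); auto.
    intros y Hy. replace 0 with (f' y); [now apply Hf|].
    apply Classical_Prop.NNPP. intros Hc. apply H. now exists y.
  - exists 0. intros x Hx. exfalso. apply H0. now exists x.
Qed.

Lemma derive_neq0_non_constant (I : R -> Prop) (f : R -> R) (x d : R) :
  is_open_interval I -> I x -> is_derive f x d -> d <> 0 -> non_constant_on I f.
Proof.
  intros HI Hx Hf Hd [c Hc]. apply Hd.
  assert (E : is_derive f x 0).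
  { apply (is_derive_ext_loc (fun _ => c)).
    - apply (filter_imp I); [|now apply HI]. intros y Hy. symmetry. now apply Hc.
    - exact (is_derive_const (K := R_AbsRing) (V := R_NormedModule) c x). }
  rewrite <- (is_derive_unique _ _ _ Hf). now apply is_derive_unique.
Qed.

(* Real induction: the supremum of the initial segments on which P holds. *)
Lemma interval_connected (I P : R -> Prop) :
  is_open_interval I ->
  (forall x, I x -> P x -> locally x P) ->
  (forall x, I x -> ~ P x -> locally x (fun y => ~ P y)) ->
  forall a b, I a -> I b -> P a -> P b.
Proof.
  intros HI Ho Hc.
  assert (up : forall Q : R -> Prop, (forall x, I x -> Q x -> locally x Q) ->
    (forall x, I x -> ~ Q x -> locally x (fun y => ~ Q y)) ->
    forall a b, I a -> I b -> a <= b -> Q a -> Q b).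
  { intros Q HQo HQc a b Ia Ib Hab Qa.
    set (E := fun x => a <= x <= b /\ forall y, a <= y <= x -> Q y).
    destruct (completeness E) as [m [Hm1 Hm2]].
    { exists b. intros x Hx. apply Hx. }
    { exists a. split; [lra|]. intros y Hy. now replace y with a by lra. }
    assert (Ham : a <= m).
    { apply Hm1. split; [lra|]. intros y Hy. now replace y with a by lra. }
    assert (Hmb : m <= b) by (apply Hm2; intros x Hx; apply Hx).
    assert (Im : I m) by (apply (proj2 HI a m b); auto).
    assert (Hlow : forall y, a <= y < m -> Q y).
    { intros y Hy. apply Classical_Prop.NNPP. intros Hn.
      assert (m <= y); [|lra].
      apply Hm2. intros x Hx. destruct (Rle_dec x y) as [|Hxy]; [easy|].
      exfalso. apply Hn. apply Hx. lra. }
    assert (Qm : Q m).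
    { apply Classical_Prop.NNPP. intros Hn.
      destruct (HQc m Im Hn) as [e He].
      destruct (Req_dec a m) as [->|Hne]; [easy|].
      apply (He (Rmax a (m - e / 2))).
      - unfold ball; simpl; unfold AbsRing_ball, abs, minus, plus, opp; simpl.
        destruct e as [e He0]; simpl in *.
        unfold Rmax; destruct Rle_dec; rewrite Rabs_left1; lra.
      - apply Hlow. destruct e as [e He0]; simpl in *.
        unfold Rmax; destruct Rle_dec; lra. }
    destruct (Rle_lt_or_eq_dec m b Hmb) as [Hlt|<-]; [|easy].
    exfalso. destruct (HQo m Im Qm) as [e He].
    assert (Rmin b (m + e / 2) <= m).
    { destruct e as [e He0]; simpl in *. apply Hm1. split.
      - unfold Rmin; destruct Rle_dec; lra.
      - intros y Hy. destruct (Rlt_dec y m) as [|Hy']; [now apply Hlow|].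
        apply He. unfold ball; simpl; unfold AbsRing_ball, abs, minus, plus, opp; simpl.
        rewrite Rabs_right by lra.
        revert Hy; unfold Rmin; destruct Rle_dec; lra. }
    destruct e as [e He0]; simpl in *.
    revert H; unfold Rmin; destruct Rle_dec; lra. }
  intros a b Ia Ib Pa. destruct (Rle_dec a b) as [Hab|Hab].
  - exact (up P Ho Hc a b Ia Ib Hab Pa).
  (* For b < a the upward argument runs from b to a on the complement of P, which satisfies the same
     two openness conditions. *)
  - apply Classical_Prop.NNPP. intros Hb.
    refine (up (fun x => ~ P x) Hc _ b a Ib Ia _ Hb Pa); [|lra].
    intros x Ix Hx. apply Classical_Prop.NNPP in Hx.
    apply (filter_imp P); [tauto|]. now apply Ho.
Qed.

Lemma ex_derive_n_S (f h : R -> R) (n : nat) (x : R) :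
  locally x (fun y => is_derive f y (h y)) -> ex_derive_n h n x ->
  ex_derive_n f (S n) x.
Proof.
  intros Hf Hh. destruct n as [|n].
  - exists (h x). now apply locally_singleton in Hf.
  - apply (ex_derive_ext_loc (Derive_n h n)); [|exact Hh].
    assert (Hd : locally x (fun y => locally y (fun z => h z = Derive f z))).
    { apply locally_locally. apply (filter_imp _ _ (fun y Hy => eq_sym (is_derive_unique _ _ _ Hy)) Hf). }
    apply (filter_imp _ _ (fun y Hy => Derive_n_ext_loc _ _ n y Hy)) in Hd.
    revert Hd. apply filter_imp. intros y ->.
    change (Derive_n (Derive_n f 1) n y = Derive_n f (S n) y).
    rewrite Derive_n_comp. now rewrite Nat.add_comm.
Qed.

Lemma smooth_on_of_derive (I : R -> Prop) (f h : R -> R) :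
  is_open_interval I -> (forall x, I x -> is_derive f x (h x)) ->
  smooth_on I h -> smooth_on I f.
Proof.
  intros HI Hf Hh [|n] x Hx; [exact Logic.I|].
  apply (ex_derive_n_S f h); [|now apply Hh].
  apply (filter_imp I); [exact Hf|]. now apply HI.
Qed.

Lemma smooth_on_Derive (I : R -> Prop) (f : R -> R) :
  smooth_on I f -> smooth_on I (Derive f).
Proof.
  intros Hf [|n] x Hx; [exact Logic.I|].
  apply (ex_derive_ext (Derive_n f (S n))).
  - intros t. change (Derive_n f (S n) t = Derive_n (Derive_n f 1) n t).
    rewrite Derive_n_comp. now rewrite Nat.add_comm.
  - exact (Hf (S (S n)) x Hx).
Qed.

Lemma smooth_on_derive (I : R -> Prop) (f : R -> R) (x : R) :
  smooth_on I f -> I x -> is_derive f x (Derive f x).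
Proof. intros Hf Hx. apply Derive_correct. exact (Hf 1%nat x Hx). Qed.

Lemma smooth_on_continuous (I : R -> Prop) (f : R -> R) (x : R) :
  smooth_on I f -> I x -> continuous f x.
Proof. intros Hf Hx. apply (ex_derive_continuous f). exact (Hf 1%nat x Hx). Qed.

Lemma smooth_on_scal (I : R -> Prop) (a : R) (f : R -> R) :
  smooth_on I f -> smooth_on I (fun x => a * f x).
Proof. intros Hf n x Hx. apply ex_derive_n_scal_l. now apply Hf. Qed.

Lemma Rpower_minus_1 (x a : R) : 0 < x -> Rpower x (a - 1) = Rpower x a / x.
Proof.
  intros Hx. unfold Rminus. rewrite Rpower_plus, Rpower_Ropp, Rpower_1; easy.
Qed.

Lemma is_derive_Rpower_comp (s : R -> R) (a x s' : R) :
  0 < s x -> is_derive s x s' ->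
  is_derive (fun y => Rpower (s y) a) x (a * Rpower (s x) (a - 1) * s').
Proof.
  intros H Hs. eapply is_derive_eq.
  - apply (is_derive_comp (fun y => Rpower y a) s); [|exact Hs].
    apply is_derive_Reals. now apply derivable_pt_lim_power.
  - unfold scal; simpl; unfold mult; simpl. ring.
Qed.

Lemma smooth_on_Rpower (I : R -> Prop) (s C : R -> R) (k a : R) :
  is_open_interval I -> (forall x, I x -> 0 < s x) ->
  (forall x, I x -> is_derive s x (C x)) ->
  (forall x, I x -> is_derive C x (- k * s x)) ->
  smooth_on I (fun x => Rpower (s x) a).
Proof.
  intros HI Hpos Hs HC.
  (* The span of the functions s^a C^m is stable under differentiation. *)
  assert (H : forall n j, (j <= n)%nat -> forall b m x, I x ->
            ex_derive_n (fun y => Rpower (s y) b * C y ^ m) j x).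
  { induction n as [|n IH]; intros j Hj b m x Hx.
    - replace j with 0%nat by lia. exact Logic.I.
    - destruct j as [|j]; [exact Logic.I|].
      (* For m = 0 the second term carries the factor [INR 0] = 0, so the value of [pred 0] does no
         harm. *)
      apply (ex_derive_n_S _ (fun y => b * (Rpower (s y) (b - 1) * C y ^ S m)
               + (- k * INR m) * (Rpower (s y) (b + 1) * C y ^ pred m))).
      + apply (filter_imp I); [|now apply HI]. intros y Hy.
        eapply is_derive_eq.
        * apply (is_derive_mult (fun z => Rpower (s z) b) (fun z => C z ^ m)).
          -- apply is_derive_Rpower_comp; [now apply Hpos|]. now apply Hs.
          -- apply is_derive_pow. now apply HC.
          -- intros n0 m0; apply Rmult_comm.
        * unfold plus, mult; simpl.
          rewrite Rpower_plus, Rpower_1 by now apply Hpos. ring.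
      + apply ex_derive_n_plus.
        * apply (filter_imp I); [|now apply HI]. intros y Hy i Hi.
          apply ex_derive_n_scal_l. apply IH; [lia|exact Hy].
        * apply (filter_imp I); [|now apply HI]. intros y Hy i Hi.
          apply ex_derive_n_scal_l. apply IH; [lia|exact Hy]. }
  intros n x Hx.
  apply (ex_derive_n_ext (fun y => Rpower (s y) a * C y ^ 0)).
  - intros t; simpl; ring.
  - now apply (H n n).
Qed.

(** Gronwall's argument: phi^2 exp(-2M(t - t0)) does not increase to the right of t0, and phi^2
    exp(2M(t - t0)) does not decrease to the left. Both are nonnegative and vanish at t0. *)
Lemma linear_ode_zero (phi K : R -> R) (t0 d M : R) :
  (forall t, Rabs (t - t0) < d -> is_derive phi t (K t * phi t)) ->
  (forall t, Rabs (t - t0) < d -> Rabs (K t) <= M) ->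
  phi t0 = 0 -> forall t, Rabs (t - t0) < d -> phi t = 0.
Proof.
  intros Hphi HM H0 t Ht.
  assert (Hder : forall sg u, Rabs (u - t0) < d ->
    is_derive (fun v => phi v ^ 2 * exp (sg * 2 * M * (v - t0))) u
       (2 * phi u ^ 2 * exp (sg * 2 * M * (u - t0)) * (K u + sg * M))).
  { intros sg u Hu. pose proof (Hphi u Hu) as Hp.
    eapply is_derive_eq.
    - apply (is_derive_mult (fun v => phi v ^ 2) (fun v => exp (sg * 2 * M * (v - t0)))).
      + apply is_derive_pow. exact Hp.
      + apply (is_derive_comp exp (fun v => sg * 2 * M * (v - t0)));
          [apply is_derive_exp|]. auto_derive; [easy|]. reflexivity.
      + intros n0 m0; apply Rmult_comm.
    - unfold plus, mult, scal; simpl. unfold mult; simpl. ring. }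
  assert (Hin : forall u, Rmin t0 t <= u <= Rmax t0 t -> Rabs (u - t0) < d).
  { intros u Hu. revert Ht. unfold Rmin, Rmax in Hu. destruct Rle_dec.
    - rewrite !Rabs_right by lra. lra.
    - rewrite !Rabs_left1 by lra. lra. }
  (* The sign of the exponent for the side of t0 on which t lies; it gives K + sg M the sign
     opposite to t - t0. *)
  set (sg := if Rle_dec t0 t then -1 else 1).
  destruct (MVT_gen (fun v => phi v ^ 2 * exp (sg * 2 * M * (v - t0))) t0 t
      (fun u => 2 * phi u ^ 2 * exp (sg * 2 * M * (u - t0)) * (K u + sg * M)))
    as [u [Hu E]].
  - intros u Hu. apply Hder, Hin. lra.
  - intros u Hu. apply derivable_continuous_pt. eexists. apply is_derive_Reals.
    apply Hder, Hin. lra.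
  - cbv beta in E. rewrite H0 in E.
    pose proof (HM u (Hin u Hu)) as HK. apply Rabs_le_between in HK.
    pose proof (exp_pos (sg * 2 * M * (u - t0))) as Hu'.
    pose proof (exp_pos (sg * 2 * M * (t - t0))) as Ht'.
    pose proof (pow2_ge_0 (phi u)) as Hp.
    assert (Hpp : 0 <= 2 * phi u ^ 2 * exp (sg * 2 * M * (u - t0)))
      by (apply Rmult_le_pos; lra).
    assert (Hle : phi t ^ 2 * exp (sg * 2 * M * (t - t0)) <= 0).
    { assert (Hs : (K u + sg * M) * (t - t0) <= 0).
      { unfold sg. destruct Rle_dec; nra. }
      nra. }
    assert (phi t ^ 2 <= 0) by nra. nra.
Qed.

(** A positive derivative at the single point t forces f(t - h) < f(t) < f(t + h) for small h.
    Continuity and the intermediate value theorem then fill the interval between these values,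
    without continuity of the derivative. *)
Lemma locally_image (f : R -> R) (t d e : R) :
  0 < e -> (forall u, Rabs (u - t) < e -> continuous f u) ->
  is_derive f t d -> 0 < d ->
  locally (f t) (fun y => exists u, Rabs (u - t) < e /\ f u = y).
Proof.
  intros He Hc Hd Hd0.
  assert (Hlim : locally t (fun u => Rabs (f u - f t - d * (u - t)) <= d / 2 * Rabs (u - t))).
  { destruct Hd as [_ Hd]. specialize (Hd t (fun P H => H)).
    assert (Hd2 : 0 < d / 2) by lra.
    specialize (Hd (mkposreal _ Hd2)). revert Hd. apply filter_imp.
    intros u. unfold norm, minus, plus, opp, scal; simpl.
    unfold abs, mult; simpl. intros H.
    replace (f u - f t - d * (u - t)) with (f u + - f t + - ((u + - t) * d)) by ring.
    exact H. }
  destruct Hlim as [e' He'].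
  set (h := Rmin (e / 2) (e' / 2)).
  assert (Hh : 0 < h) by (destruct e' as [e' H']; apply Rmin_pos; simpl; lra).
  assert (Hh1 : h <= e / 2) by apply Rmin_l.
  assert (Hh2 : h < e') by (pose proof (Rmin_r (e / 2) (e' / 2)); destruct e'; simpl in *; unfold h; lra).
  assert (Hl : f (t - h) < f t).
  { specialize (He' (t - h)). unfold ball in He'; simpl in He'.
    unfold AbsRing_ball, abs, minus, plus, opp in He'; simpl in He'.
    replace (t - h + - t) with (- h) in He' by ring.
    replace (t - h - t) with (- h) in He' by ring.
    rewrite Rabs_Ropp, (Rabs_right h) in He' by lra.
    apply He', Rabs_le_between in Hh2. nra. }
  assert (Hr : f t < f (t + h)).
  { specialize (He' (t + h)). unfold ball in He'; simpl in He'.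
    unfold AbsRing_ball, abs, minus, plus, opp in He'; simpl in He'.
    replace (t + h + - t) with h in He' by ring.
    replace (t + h - t) with h in He' by ring.
    rewrite (Rabs_right h) in He' by lra.
    apply He', Rabs_le_between in Hh2. nra. }
  apply (filter_imp (fun y => f (t - h) < y /\ y < f (t + h))).
  - intros y [Hy1 Hy2].
    destruct (Ranalysis5.IVT_interv (fun u => f u - y) (t - h) (t + h)) as [z [Hz1 Hz2]].
    + intros a Ha. apply continuity_pt_filterlim.
      apply (continuous_minus f (fun _ => y)); [|apply continuous_const].
      apply Hc. apply Rabs_lt_between. lra.
    + lra.
    + lra.
    + lra.
    + exists z. split; [apply Rabs_lt_between; lra|lra].
  - apply filter_and; [exact (open_gt _ _ Hl)|exact (open_lt _ _ Hr)].
Qed.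

(** * Geometries with a sine law and a dual cosine law *)

Definition area (ang : ix -> R3 -> R) (ra sl : R -> R) (l : R3) : R :=
  ra (ang i1 l) * sl (co i2 l) * sl (co i3 l).

(** The coefficient of dl_j in d theta_i. Apart from the factor s(l_i) / A the matrix is symmetric
    in i and j, and closedness is a statement about this symmetry. *)
Definition dang (ang : ix -> R3 -> R) (ra ca sl : R -> R) (i : ix) (l : R3) (j : ix) : R :=
  sl (co i l) / area ang ra sl l *
    (kron i j - ca (ang (prv i) l) * kron (nxt i) j - ca (ang (nxt i) l) * kron (prv i) j).

(** The interface through which the four cases share one proof. [eps] is 1 when the angle functions
    are circular and -1 when they are hyperbolic; [kap] is the analogous sign for lengths, with 0 in
    the Euclidean case. *)
Record geometry : Type := {
  dom : R3 -> Prop;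
  ang : ix -> R3 -> R;
  Ia : R -> Prop;
  Il : R -> Prop;
  ra : R -> R;
  ca : R -> R;
  sl : R -> R;
  cl : R -> R;
  eps : R;
  kap : R;
  eps_neq0 : eps <> 0;
  dom_open : forall l, dom l -> locally l dom;
  Ia_interval : is_open_interval Ia;
  Il_interval : is_open_interval Il;
  dom_len : forall l i, dom l -> Il (co i l);
  dom_ang : forall l i, dom l -> Ia (ang i l);
  ra_pos : forall x, Ia x -> 0 < ra x;
  sl_pos : forall x, Il x -> 0 < sl x;
  ra_derive : forall x, is_derive ra x (ca x);
  ca_derive : forall x, is_derive ca x (- eps * ra x);
  sl_derive : forall x, is_derive sl x (cl x);
  cl_derive : forall x, is_derive cl x (- kap * sl x);
  ca_ra_1 : forall x, ca x ^ 2 + eps * ra x ^ 2 = 1;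
  sine_law : forall l i, dom l ->
    ra (ang i l) * sl (co (nxt i) l) * sl (co (prv i) l) = area ang ra sl l;
  dual_cosine_law : forall l i, dom l ->
    ca (ang i l) + ca (ang (nxt i) l) * ca (ang (prv i) l)
    = ra (ang (nxt i) l) * ra (ang (prv i) l) * cl (co i l);
  ang_diff3 : forall l i, dom l -> diff3 (ang i) l (dang ang ra ca sl i l);
  cl_neq0 : exists y, Il y /\ cl y <> 0;
  two_lengths : forall x y, Il x -> Il y ->
    exists l, dom l /\ co i1 l = x /\ co i2 l = y;
  (* Any pair (opposite length, angle) is joined to any angle through two
     triangles that share a length. *)
  linked : forall a alpha beta, Il a -> Ia alpha -> Ia beta ->
    exists l, dom l /\ ang i1 l = beta /\
      forall j, j = i1 \/ j = i2 ->
        exists m, dom m /\ co i1 m = a /\ ang i1 m = alpha /\ co i2 m = co j l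
}.

(** * Solutions of the relation p(theta_1) q(l_1) = p(theta_2) q(l_2) *)

Section Geometry.

Variable G : geometry.

Notation A := (area (ang G) (ra G) (sl G)).
Notation dth := (dang (ang G) (ra G) (ca G) (sl G)).
Notation th := (ang G).

Lemma area_pos (l : R3) : dom G l -> 0 < A l.
Proof.
  intros H. unfold area.
  apply Rmult_lt_0_compat; [apply Rmult_lt_0_compat|].
  - now apply ra_pos, dom_ang.
  - now apply sl_pos, dom_len.
  - now apply sl_pos, dom_len.
Qed.

Lemma ra_ang_pos (l : R3) (i : ix) : dom G l -> 0 < ra G (th i l).
Proof. intros H. now apply ra_pos, dom_ang. Qed.

Lemma sl_co_pos (l : R3) (i : ix) : dom G l -> 0 < sl G (co i l).
Proof. intros H. now apply sl_pos, dom_len. Qed.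

(** The common ratio r(theta_i) / s(l_i) in a form symmetric in the indices, so that powers of
    r(theta_i) can be traded for powers of s(l_i). *)
Lemma sine_rule (l : R3) (i : ix) : dom G l ->
  ra G (th i l) = A l / (sl G (co i1 l) * sl G (co i2 l) * sl G (co i3 l)) * sl G (co i l).
Proof.
  intros H. rewrite <- (sine_law G l i H).
  pose proof (sl_co_pos l i1 H). pose proof (sl_co_pos l i2 H). pose proof (sl_co_pos l i3 H).
  destruct i; simpl nxt; simpl prv; field; lra.
Qed.

(* The three partial derivatives of p(theta_1) q(l_1) = p(theta_2) q(l_2), where
   X = p'(theta_1) q(l_1) s(l_1) / A and Y = p'(theta_2) q(l_2) s(l_2) / A. *)
Lemma product_relation_derivatives (p q p' q' : R -> R) :
  (forall x, Ia G x -> is_derive p x (p' x)) ->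
  (forall x, Il G x -> is_derive q x (q' x)) ->
  (forall l, dom G l -> p (th i1 l) * q (co i1 l) = p (th i2 l) * q (co i2 l)) ->
  forall l, dom G l ->
    let X := p' (th i1 l) * q (co i1 l) * sl G (co i1 l) / A l in
    let Y := p' (th i2 l) * q (co i2 l) * sl G (co i2 l) / A l in
    X + p (th i1 l) * q' (co i1 l) = - ca G (th i3 l) * Y /\
    - ca G (th i3 l) * X = Y + p (th i2 l) * q' (co i2 l) /\
    ca G (th i2 l) * X = ca G (th i1 l) * Y.
Proof.
  intros Hp Hq H l Hl X Y.
  assert (D : forall i, diff3 (fun x => p (th i x) * q (co i x)) l
            (fun j => p' (th i l) * dth i l j * q (co i l) + p (th i l) * (q' (co i l) * kron i j))).
  { intros i. apply diff3_mult.
    - apply diff3_comp; [now apply ang_diff3|]. now apply Hp, dom_ang.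
    - apply diff3_comp_co. now apply Hq, dom_len. }
  assert (D1 : diff3 (fun x => p (th i2 x) * q (co i2 x)) l
            (fun j => p' (th i1 l) * dth i1 l j * q (co i1 l) + p (th i1 l) * (q' (co i1 l) * kron i1 j))).
  { apply (diff3_ext_loc (fun x => p (th i1 x) * q (co i1 x))); [|apply D].
    apply (filter_imp (dom G)); [exact H|]. now apply dom_open. }
  assert (E : forall j,
     p' (th i1 l) * dth i1 l j * q (co i1 l) + p (th i1 l) * (q' (co i1 l) * kron i1 j) =
     p' (th i2 l) * dth i2 l j * q (co i2 l) + p (th i2 l) * (q' (co i2 l) * kron i2 j)).
  { intros j. rewrite <- (proj2 (diff3_partial _ _ _ j D1)).
    exact (proj2 (diff3_partial _ _ _ j (D i2))). }
  pose proof (area_pos l Hl) as HA.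
  pose proof (E i1) as E1; pose proof (E i2) as E2; pose proof (E i3) as E3.
  unfold dang, kron in E1, E2, E3; simpl nxt in *; simpl prv in *.
  unfold X, Y. repeat split.
  - ring_simplify in E1. ring_simplify. unfold Rdiv in *. lra.
  - ring_simplify in E2. ring_simplify. unfold Rdiv in *. lra.
  - ring_simplify in E3. ring_simplify. unfold Rdiv in *. lra.
Qed.

(** Stated on a neighbourhood of the parameter, since both the differential equation and
    [locally_image] need more than the single point. *)
Lemma slice_diff (l : R3) (i j : ix) : dom G l ->
  locally (co j l) (fun t => is_derive (fun u => th i (upd l j u)) t (dth i (upd l j t) j)).
Proof.
  intros Hl.
  apply (filter_imp (fun t => dom G (upd l j t))).
  - intros t Ht. pose proof (diff3_upd _ _ _ j (ang_diff3 G _ i Ht)) as D.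
    replace t with (co j (upd l j t)) at 1 by (destruct j; reflexivity).
    apply (is_derive_ext (fun u => th i (upd (upd l j t) j u))); [|exact D].
    intros u. f_equal. destruct j; reflexivity.
  - apply locally_upd. now apply dom_open.
Qed.

(* Along the slice where only l_1 varies, p(theta_1) solves a linear equation. *)
Lemma zero_of_factor_open (p q p' q' : R -> R) :
  (forall x, Ia G x -> is_derive p x (p' x)) ->
  (forall x, Il G x -> is_derive q x (q' x)) ->
  (forall x, Il G x -> continuous q' x) ->
  (forall l, dom G l -> p (th i1 l) * q (co i1 l) = p (th i2 l) * q (co i2 l)) ->
  forall l, dom G l -> q (co i1 l) <> 0 -> q (co i2 l) <> 0 -> p (th i1 l) = 0 ->
  locally (th i1 l) (fun x => p x = 0).
Proof.
  intros Hp Hq Hq'c H l Hl Hq1 Hq2 H0.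
  set (b := co i2 l). set (a := co i1 l).
  set (x := fun t => upd l i1 t).
  (* Eliminating Y from the first two relations of [product_relation_derivatives], and writing
     p(theta_2) as p(theta_1) q(t) / q(b), expresses X (1 - c(theta_3)^2) as a multiple of
     p(theta_1). Here 1 - c(theta_3)^2 = eps r(theta_3)^2 is nonzero, and the derivative of
     p(theta_1) along the slice is X / q(t). *)
  set (K := fun t => (ca G (th i3 (x t)) * q t * (q' b / q b) - q' t)
              / (q t * (eps G * ra G (th i3 (x t)) ^ 2))).
  assert (Xa : x a = l) by apply upd_co.
  assert (Hder : locally a (fun t => is_derive (fun u => p (th i1 (x u))) t (K t * p (th i1 (x t))))).
  { assert (Hqa : locally a (fun t => q t <> 0)).
    { assert (Hc : continuous q a) by
        (apply (ex_derive_continuous q); eexists; now apply Hq, dom_len).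
      apply (Hc (fun y => y <> 0)). exact (open_neq 0 _ Hq1). }
    pose proof (locally_upd _ l i1 (dom_open G l Hl)) as Hd.
    pose proof (slice_diff l i1 i1 Hl) as Hs.
    generalize (filter_and _ _ Hqa (filter_and _ _ Hd Hs)).
    apply filter_imp. intros t [Hqt [Hdt Hst]].
    change (upd l i1 t) with (x t) in *.
    assert (E1 : co i1 (x t) = t) by reflexivity.
    assert (E2 : co i2 (x t) = b) by reflexivity.
    destruct (product_relation_derivatives p q p' q' Hp Hq H (x t) Hdt) as [R1 [R2 _]].
    pose proof (H _ Hdt) as R0.
    rewrite E1, E2 in R0, R1, R2.
    pose proof (area_pos _ Hdt) as HA.
    pose proof (ra_ang_pos _ i3 Hdt) as Hr3.
    pose proof (ca_ra_1 G (th i3 (x t))) as P3.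
    pose proof (eps_neq0 G) as He.
    eapply is_derive_eq.
    - apply (is_derive_comp p (fun u => th i1 (x u))); [|exact Hst].
      now apply Hp, dom_ang.
    - unfold scal; simpl; unfold mult; simpl.
      unfold dang. rewrite E1. simpl nxt. simpl prv. unfold kron.
      set (X := p' (th i1 (x t)) * q t * sl G t / A (x t)) in *.
      set (Y := p' (th i2 (x t)) * q b * sl G b / A (x t)) in *.
      assert (RX : X * (eps G * ra G (th i3 (x t)) ^ 2) =
         p (th i1 (x t)) * (ca G (th i3 (x t)) * q t * (q' b / q b) - q' t)).
      { replace (eps G * ra G (th i3 (x t)) ^ 2) with (1 - ca G (th i3 (x t)) ^ 2) by lra.
        assert (Y = - ca G (th i3 (x t)) * X - p (th i2 (x t)) * q' b) by lra.
        assert (Hp2 : p (th i2 (x t)) * q' b = p (th i1 (x t)) * q t * (q' b / q b)).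
        { rewrite R0. field. exact Hq2. }
        transitivity (ca G (th i3 (x t)) * (p (th i2 (x t)) * q' b) - p (th i1 (x t)) * q' t);
          [rewrite H1 in R1; lra|]. rewrite Hp2. ring. }
      transitivity (X / q t).
      + unfold X. field. split; lra.
      + unfold K. apply (Rmult_eq_reg_r (q t * (eps G * ra G (th i3 (x t)) ^ 2))).
        * replace (X / q t * (q t * (eps G * ra G (th i3 (x t)) ^ 2)))
            with (X * (eps G * ra G (th i3 (x t)) ^ 2)) by (field; exact Hqt).
          rewrite RX. field. repeat split; try exact Hq2; try exact Hqt; try exact He; lra.
        * apply Rmult_integral_contrapositive_currified; [exact Hqt|].
          apply Rmult_integral_contrapositive_currified; [exact He|].
          apply pow_nonzero. lra. }
  assert (Hc3 : continuous (fun t => th i3 (x t)) a).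
  { apply (ex_derive_continuous (fun t => th i3 (x t))).
    eexists. exact (locally_singleton _ _ (slice_diff l i3 i1 Hl)). }
  assert (HK : continuous K a).
  { assert (Cq : continuous q a).
    { apply (ex_derive_continuous q). eexists. now apply Hq, dom_len. }
    assert (Cq' : continuous q' a) by now apply Hq'c, dom_len.
    assert (Cc : continuous (fun t => ca G (th i3 (x t))) a).
    { apply (continuous_comp (fun t => th i3 (x t)) (ca G)); [exact Hc3|].
      apply (ex_derive_continuous (ca G)). eexists. apply ca_derive. }
    assert (Cr : continuous (fun t => ra G (th i3 (x t))) a).
    { apply (continuous_comp (fun t => th i3 (x t)) (ra G)); [exact Hc3|].
      apply (ex_derive_continuous (ra G)). eexists. apply ra_derive. }
    unfold K, Rdiv.
    apply (continuous_mult (K := R_AbsRing)).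
    - apply (continuous_minus (V := R_NormedModule)); [|exact Cq'].
      apply (continuous_mult (K := R_AbsRing)); [|apply continuous_const].
      apply (continuous_mult (K := R_AbsRing)); [exact Cc|exact Cq].
    - apply (continuous_comp _ Rinv).
      + apply (continuous_mult (K := R_AbsRing)); [exact Cq|].
        apply (continuous_mult (K := R_AbsRing)); [apply continuous_const|].
        simpl. apply (continuous_mult (K := R_AbsRing)); [exact Cr|].
        apply (continuous_mult (K := R_AbsRing)); [exact Cr|apply continuous_const].
      + apply continuity_pt_filterlim. apply continuity_pt_inv; [apply continuity_pt_id|].
        rewrite Xa. apply Rmult_integral_contrapositive_currified; [exact Hq1|].
        apply Rmult_integral_contrapositive_currified; [apply eps_neq0|].
        apply pow_nonzero. pose proof (ra_ang_pos l i3 Hl). lra. }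
  assert (HKb : locally a (fun t => Rabs (K t) <= Rabs (K a) + 1)).
  { apply (filter_imp (fun t => ball (K a) 1 (K t))).
    - intros t Ht. unfold ball in Ht; simpl in Ht.
      unfold AbsRing_ball, abs, minus, plus, opp in Ht; simpl in Ht.
      pose proof (Rabs_triang (K t + - K a) (K a)).
      replace (K t + - K a + K a) with (K t) in H1 by ring. lra.
    - apply (HK (fun y => ball (K a) 1 y)). exists (mkposreal 1 Rlt_0_1). easy. }
  destruct (filter_and _ _ Hder (filter_and _ _ HKb (slice_diff l i1 i1 Hl))) as [e He].
  assert (He' : forall t, Rabs (t - a) < e ->
     is_derive (fun u => p (th i1 (x u))) t (K t * p (th i1 (x t))) /\
     Rabs (K t) <= Rabs (K a) + 1 /\
     is_derive (fun u => th i1 (x u)) t (dth i1 (x t) i1)).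
  { intros t Ht. apply (He t). exact Ht. }
  assert (Hz : forall t, Rabs (t - a) < e -> p (th i1 (x t)) = 0).
  { apply (linear_ode_zero (fun t => p (th i1 (x t))) K a e (Rabs (K a) + 1)).
    - intros t Ht. now apply He'.
    - intros t Ht. now apply He'.
    - cbv beta. now rewrite Xa. }
  (* theta_1 has the positive derivative s(l_1) / A in l_1, so the angles met along the slice fill a
     neighbourhood of theta_1. Vanishing along the slice thus becomes vanishing near that angle. *)
  assert (Hloc : locally (th i1 (x a)) (fun y => exists u, Rabs (u - a) < e /\ th i1 (x u) = y)).
  { apply (locally_image (fun u => th i1 (x u)) a (dth i1 (x a) i1) e).
    - apply cond_pos.
    - intros u Hu. apply (ex_derive_continuous (fun u => th i1 (x u))).
      eexists. now apply He'.
    - apply He'. rewrite Rminus_diag_eq, Rabs_R0 by easy. apply cond_pos.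
    - rewrite Xa. unfold dang, kron; simpl.
      replace (_ - _ - _) with 1 by ring. rewrite Rmult_1_r.
      apply Rdiv_lt_0_compat; [exact (sl_co_pos l i1 Hl)|now apply area_pos]. }
  rewrite Xa in Hloc. revert Hloc. apply filter_imp.
  intros y [u [Hu <-]]. now apply Hz.
Qed.

(** The set where p is nonzero is open by continuity, and its complement is open by
    [zero_of_factor_open] applied to a triangle from [linked]. Once p has no zeros, q has none
    either: any length shares a triangle with a length where q is nonzero. *)
Lemma factor_neq0 (p q p' q' : R -> R) :
  (forall x, Ia G x -> is_derive p x (p' x)) ->
  (forall x, Il G x -> is_derive q x (q' x)) ->
  (forall x, Il G x -> continuous q' x) ->
  (forall l, dom G l -> p (th i1 l) * q (co i1 l) = p (th i2 l) * q (co i2 l)) ->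
  (exists x, Ia G x /\ p x <> 0) -> (exists x, Il G x /\ q x <> 0) ->
  (forall x, Ia G x -> p x <> 0) /\ (forall x, Il G x -> q x <> 0).
Proof.
  intros Hp Hq Hq'c H [alpha [Ha Hpa]] [a [Ia' Hqa]].
  assert (P : forall x, Ia G x -> p x <> 0).
  { intros x Hx.
    apply (interval_connected (Ia G) (fun y => p y <> 0) (Ia_interval G)) with (a := alpha); auto.
    - intros y Hy Hpy.
      assert (Hc : continuous p y) by
        (apply (ex_derive_continuous p); eexists; now apply Hp).
      apply (Hc (fun z => z <> 0)). exact (open_neq 0 _ Hpy).
    - intros y Hy Hpy.
      destruct (linked G a alpha y Ia' Ha Hy) as [l [Hl [Hly Hlink]]].
      (* In the linking triangle the first product is p(alpha) q(a), which is nonzero; so the second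
         product, hence q at the second length, is nonzero too. *)
      assert (Hql : forall j, j = i1 \/ j = i2 -> q (co j l) <> 0).
      { intros j Hj. destruct (Hlink j Hj) as [m [Hm [Hm1 [Hm2 Hm3]]]].
        intros Hq0. pose proof (H m Hm) as E. rewrite Hm1, Hm2, Hm3, Hq0, Rmult_0_r in E.
        apply Rmult_integral in E as [E|E]; easy. }
      apply (filter_imp (fun z => p z = 0)); [tauto|].
      rewrite <- Hly.
      apply (zero_of_factor_open p q p' q'); auto.
      rewrite Hly. now apply Classical_Prop.NNPP. }
  split; [exact P|].
  intros x Hx Hq0. destruct (two_lengths G a x Ia' Hx) as [l [Hl [<- <-]]].
  pose proof (H l Hl) as E. rewrite Hq0, Rmult_0_r in E.
  apply Rmult_integral in E as [E|E]; [|easy].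
  revert E. now apply P, dom_ang.
Qed.

Lemma ang_surjective (x : R) : Ia G x -> exists l, dom G l /\ th i1 l = x.
Proof.
  intros Hx. destruct (cl_neq0 G) as [y [Hy _]].
  destruct (linked G y x x Hy Hx Hx) as [l [Hl [E _]]]. now exists l.
Qed.

Theorem product_relation_powers (p q p' q' : R -> R) :
  (forall x, Ia G x -> is_derive p x (p' x)) ->
  (forall x, Il G x -> is_derive q x (q' x)) ->
  (forall x, Il G x -> continuous q' x) ->
  (forall l, dom G l -> p (th i1 l) * q (co i1 l) = p (th i2 l) * q (co i2 l)) ->
  (exists x, Ia G x /\ p x <> 0) -> (exists x, Il G x /\ q x <> 0) ->
  exists lambda c1 c2 : R, c1 <> 0 /\ c2 <> 0 /\
    (forall x, Ia G x -> p x = c1 * Rpower (ra G x) lambda) /\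
    (forall x, Il G x -> q x = c2 * Rpower (sl G x) (- lambda)).
Proof.
  intros Hp Hq Hq'c H Hp0 Hq0.
  destruct (factor_neq0 p q p' q' Hp Hq Hq'c H Hp0 Hq0) as [P0 Q0].
  pose proof (product_relation_derivatives p q p' q' Hp Hq H) as D.
  (* After multiplication by 1 - c_3^2 the first two relations express X and Y through U and V. The
     third becomes V (c_1 + c_2 c_3) = U (c_2 + c_1 c_3), where the dual cosine law identifies the
     brackets as r_2 r_3 C_1 and r_1 r_3 C_2. The sine rule then replaces r_i by s_i. *)
  assert (L : forall x y, Il G x -> Il G y ->
            q' y * sl G y / q y * cl G x = q' x * sl G x / q x * cl G y).
  { intros x y Hx Hy. destruct (two_lengths G x y Hx Hy) as [l [Hl [<- <-]]].
    destruct (D l Hl) as [R1 [R2 R3']]. pose proof (H l Hl) as R0.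
    pose proof (dual_cosine_law G l i1 Hl) as C1. pose proof (dual_cosine_law G l i2 Hl) as C2.
    simpl nxt in *; simpl prv in *.
    pose proof (ra_ang_pos l i1 Hl) as r1. pose proof (ra_ang_pos l i2 Hl) as r2.
    pose proof (ra_ang_pos l i3 Hl) as r3. pose proof (ca_ra_1 G (th i3 l)) as P3.
    pose proof (sine_rule l i1 Hl) as S1. pose proof (sine_rule l i2 Hl) as S2.
    pose proof (area_pos l Hl) as HA.
    pose proof (sl_co_pos l i1 Hl) as s1. pose proof (sl_co_pos l i2 Hl) as s2.
    pose proof (sl_co_pos l i3 Hl) as s3.
    pose proof (Q0 _ (dom_len G l i1 Hl)) as q1. pose proof (Q0 _ (dom_len G l i2 Hl)) as q2.
    pose proof (P0 _ (dom_ang G l i1 Hl)) as p1.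
    set (X := p' (th i1 l) * q (co i1 l) * sl G (co i1 l) / A l) in *.
    set (Y := p' (th i2 l) * q (co i2 l) * sl G (co i2 l) / A l) in *.
    set (U := p (th i1 l) * q' (co i1 l)) in *.
    set (V := p (th i2 l) * q' (co i2 l)) in *.
    set (k := A l / (sl G (co i1 l) * sl G (co i2 l) * sl G (co i3 l))) in *.
    assert (Hk : 0 < k) by (apply Rdiv_lt_0_compat; [easy|]; repeat apply Rmult_lt_0_compat; easy).
    assert (EX : X * (1 - ca G (th i3 l) ^ 2) = ca G (th i3 l) * V - U) by nra.
    assert (EY : Y * (1 - ca G (th i3 l) ^ 2) = ca G (th i3 l) * U - V) by nra.
    assert (E : (ca G (th i3 l) * V - U) * ca G (th i2 l) = (ca G (th i3 l) * U - V) * ca G (th i1 l)).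
    { rewrite <- EX, <- EY. nra. }
    assert (E' : V * (ra G (th i2 l) * ra G (th i3 l) * cl G (co i1 l))
               = U * (ra G (th i3 l) * ra G (th i1 l) * cl G (co i2 l))) by (rewrite <- C1, <- C2; lra).
    assert (E2 : V * sl G (co i2 l) * cl G (co i1 l) = U * sl G (co i1 l) * cl G (co i2 l)).
    { apply (Rmult_eq_reg_r (k * ra G (th i3 l))); [|apply Rgt_not_eq; nra].
      rewrite S1, S2 in E'. lra. }
    apply (Rmult_eq_reg_l (p (th i1 l) * q (co i1 l))); [|now apply Rmult_integral_contrapositive_currified].
    transitivity (U * sl G (co i1 l) * cl G (co i2 l)); [|unfold U; field; exact q1].
    rewrite <- E2, R0. unfold V. field. exact q2. }
  destruct (cl_neq0 G) as [y0 [Hy0 Hc0]].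
  (* The relation [L] makes s q' / q proportional to C; the factor is read off at a length where C
     does not vanish, as the cosine does at PI / 2 on the sphere. *)
  set (lambda := - (q' y0 * sl G y0 / q y0 / cl G y0)).
  assert (Q1 : forall x, Il G x -> q' x * sl G x = - lambda * cl G x * q x).
  { intros x Hx. pose proof (L x y0 Hx Hy0) as E. pose proof (Q0 x Hx).
    pose proof (Q0 y0 Hy0).
    apply (Rmult_eq_reg_r (cl G y0 / q x)).
    - transitivity (q' x * sl G x / q x * cl G y0); [field; easy|].
      rewrite <- E. unfold lambda. field. easy.
    - unfold Rdiv. apply Rmult_integral_contrapositive_currified; [easy|].
      now apply Rinv_neq_0_compat. }
  assert (Qc : forall x, Il G x -> is_derive (fun x => q x * Rpower (sl G x) lambda) x 0).
  { intros x Hx. pose proof (sl_pos G x Hx) as Hs. eapply is_derive_eq.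
    - apply (is_derive_mult q (fun x => Rpower (sl G x) lambda)).
      + now apply Hq.
      + apply is_derive_Rpower_comp; [easy|]. apply sl_derive.
      + intros; apply Rmult_comm.
    - unfold plus, mult; simpl. rewrite Rpower_minus_1 by easy.
      apply (Rmult_eq_reg_r (sl G x)); [|lra]. 
      transitivity ((q' x * sl G x + lambda * cl G x * q x) * Rpower (sl G x) lambda);
        [field; lra|]. rewrite Q1 by easy. ring. }
  assert (Qv : forall x, Il G x -> q x = q y0 * Rpower (sl G y0) lambda * Rpower (sl G x) (- lambda)).
  { intros x Hx. rewrite (derive_zero_constant (Il G) _ (Il_interval G) Qc y0 x Hy0 Hx).
    rewrite Rmult_assoc, <- Rpower_plus, Rplus_opp_r, Rpower_O by now apply sl_pos. ring. }
  set (c2 := q y0 * Rpower (sl G y0) lambda) in *.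
  assert (Hc2 : c2 <> 0).
  { apply Rmult_integral_contrapositive_currified; [now apply Q0|].
    apply Rgt_not_eq, exp_pos. }
  (* By the sine rule, [rho] and the constant 1 satisfy the product relation again. With q' = 0 its
     derivatives read X = - c_3 Y and Y = - c_3 X, so X (1 - c_3^2) = 0 and rho' vanishes at every
     angle. *)
  set (rho := fun x => p x * Rpower (ra G x) (- lambda)).
  set (rho' := fun x => p' x * Rpower (ra G x) (- lambda)
      + p x * (- lambda * Rpower (ra G x) (- lambda - 1) * ca G x)).
  assert (Rd : forall x, Ia G x -> is_derive rho x (rho' x)).
  { intros x Hx. apply (is_derive_mult p (fun x => Rpower (ra G x) (- lambda))).
    - now apply Hp.
    - apply is_derive_Rpower_comp; [now apply ra_pos|]. apply ra_derive.
    - intros; apply Rmult_comm. }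
  assert (Rr : forall l, dom G l -> rho (th i1 l) * 1 = rho (th i2 l) * 1).
  { intros l Hl. unfold rho. pose proof (H l Hl) as E.
    rewrite !Qv in E by now apply dom_len.
    pose proof (ra_ang_pos l i1 Hl) as r1. pose proof (ra_ang_pos l i2 Hl) as r2.
    pose proof (sl_co_pos l i1 Hl) as s1. pose proof (sl_co_pos l i2 Hl) as s2.
    assert (Es : Rpower (ra G (th i1 l)) (- lambda) * Rpower (sl G (co i2 l)) (- lambda)
       = Rpower (ra G (th i2 l)) (- lambda) * Rpower (sl G (co i1 l)) (- lambda)).
    { rewrite !Rpower_mult_distr by easy. f_equal.
      rewrite (sine_rule l i1 Hl), (sine_rule l i2 Hl). ring. }
    set (u1 := Rpower (ra G (th i1 l)) (- lambda)) in *.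
    set (u2 := Rpower (ra G (th i2 l)) (- lambda)) in *.
    set (v1 := Rpower (sl G (co i1 l)) (- lambda)) in *.
    set (v2 := Rpower (sl G (co i2 l)) (- lambda)) in *.
    assert (Hv2 : 0 < v2) by apply exp_pos.
    assert (E' : p (th i1 l) * v1 = p (th i2 l) * v2)
      by (apply (Rmult_eq_reg_l c2); [lra|easy]).
    apply (Rmult_eq_reg_r v2); [|lra].
    transitivity (p (th i1 l) * (u1 * v2)); [ring|]. rewrite Es.
    transitivity (p (th i1 l) * v1 * u2); [ring|]. rewrite E'. ring. }
  assert (R0 : forall x, Ia G x -> is_derive rho x 0).
  { intros x Hx. destruct (ang_surjective x Hx) as [l [Hl <-]].
    eapply is_derive_eq; [apply Rd; now apply dom_ang|].
    destruct (product_relation_derivatives rho (fun _ => 1) rho' (fun _ => 0) Rd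
        (fun x _ => is_derive_const (K := R_AbsRing) (V := R_NormedModule) 1 x) Rr l Hl)
      as [R1 [R2 _]].
    pose proof (area_pos l Hl) as HA. pose proof (sl_co_pos l i1 Hl) as s1.
    pose proof (ra_ang_pos l i3 Hl) as r3. pose proof (ca_ra_1 G (th i3 l)) as P3.
    pose proof (eps_neq0 G) as He.
    set (X := rho' (th i1 l) * 1 * sl G (co i1 l) / A l) in *.
    set (Y := rho' (th i2 l) * 1 * sl G (co i2 l) / A l) in *.
    assert (EX : X * (1 - ca G (th i3 l) ^ 2) = 0).
    { assert (HY : Y = - ca G (th i3 l) * X) by lra. rewrite HY in R1. lra. }
    replace (1 - ca G (th i3 l) ^ 2) with (eps G * ra G (th i3 l) ^ 2) in EX by lra.
    apply Rmult_integral in EX as [EX|EX].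
    - apply (Rmult_eq_reg_r (sl G (co i1 l) / A l)).
      + rewrite Rmult_0_l, <- EX. unfold X. field. lra.
      + apply Rgt_not_eq, Rdiv_lt_0_compat; easy.
    - exfalso. revert EX. apply Rmult_integral_contrapositive_currified; [easy|].
      apply pow_nonzero. lra. }
  destruct Hp0 as [x0 [Hx0 Hpx0]].
  exists lambda, (rho x0), c2. repeat split; auto.
  - unfold rho. apply Rmult_integral_contrapositive_currified; [easy|].
    apply Rgt_not_eq, exp_pos.
  - intros x Hx. rewrite (derive_zero_constant (Ia G) rho (Ia_interval G) R0 x0 x Hx0 Hx).
    unfold rho.
    rewrite Rmult_assoc, <- Rpower_plus, Rplus_opp_l, Rpower_O by now apply ra_pos. ring.
Qed.

End Geometry.

(** * Closed 1-forms *)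

Lemma antiderivative_RInt (I : R -> Prop) (h : R -> R) (x0 : R) :
  is_open_interval I -> I x0 -> (forall x, I x -> continuous h x) ->
  antiderivative_on I h (fun x => RInt h x0 x).
Proof.
  intros HI H0 Hc x Hx.
  apply (is_derive_RInt h (fun y => RInt h x0 y) x0 x); [|now apply Hc].
  apply (filter_imp I); [|now apply HI].
  intros y Hy. apply (RInt_correct (V := R_CompleteNormedModule)).
  apply (ex_RInt_continuous (V := R_CompleteNormedModule)).
  intros z Hz. apply Hc. now apply (interval_between I x0 y).
Qed.

Lemma closed_form_iff (T : R3 -> Prop) (w : form) (W : R3 -> ix -> ix -> R) :
  (forall l j, T l -> diff3 (fun x => w x j) l (W l j)) ->
  closed_form T w <-> (forall l i j, T l -> W l j i = W l i j).
Proof.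
  intros HW. split.
  - intros H l i j Hl. destruct (H l Hl i j) as [_ E].
    rewrite <- (proj2 (diff3_partial _ _ _ i (HW l j Hl))).
    rewrite <- (proj2 (diff3_partial _ _ _ j (HW l i Hl))). exact E.
  - intros H l Hl i j. split.
    + exact (proj1 (diff3_partial _ _ _ i (HW l j Hl))).
    + transitivity (W l j i); [exact (proj2 (diff3_partial _ _ _ i (HW l j Hl)))|].
      rewrite H by easy. symmetry. exact (proj2 (diff3_partial _ _ _ j (HW l i Hl))).
Qed.

Lemma diff3_ext_dom (T : R3 -> Prop) (f g : R3 -> R) (l : R3) (d : ix -> R) :
  (forall x, T x -> locally x T) -> T l -> (forall x, T x -> f x = g x) ->
  diff3 f l d -> diff3 g l d.
Proof.
  intros HT Hl E. apply diff3_ext_loc. apply (filter_imp T); [exact E|]. now apply HT.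
Qed.

Lemma diff3_sum3 (F : ix -> R3 -> R) (l : R3) (d : ix -> ix -> R) :
  (forall i, diff3 (F i) l (d i)) ->
  diff3 (fun x => sum3 (fun i => F i x)) l (fun k => sum3 (fun i => d i k)).
Proof. intros H. apply diff3_plus; [apply diff3_plus|]; apply H. Qed.

Section ClosedForms.

Variable G : geometry.

Notation A := (area (ang G) (ra G) (sl G)).
Notation dth := (dang (ang G) (ra G) (ca G) (sl G)).
Notation th := (ang G).

(** The closedness condition shared by both kinds of forms: d of sum f(theta_i) dg(l_i) is the sum
    of f' g' d theta_i wedge dl_i, and d of sum g(l_i) df(theta_i) is its negative. *)
Definition reciprocal (f' g' : R -> R) : Prop :=
  forall l i j, dom G l ->
    f' (th j l) * g' (co j l) * dth j l i = f' (th i l) * g' (co i l) * dth i l j.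

Lemma edge_form_eq (f g : R -> R) (l : R3) (j : ix) :
  smooth_on (Il G) g -> dom G l ->
  edge_form th f g l j = f (th j l) * Derive g (co j l).
Proof.
  intros Hg Hl. unfold edge_form, sum_form.
  rewrite <- (sum3_kron j (fun i => f (th i l) * Derive g (co i l))).
  assert (E : forall i, partial j (fun x => g (co i x)) l = Derive g (co i l) * kron i j).
  { intros i. apply (diff3_partial (fun x => g (co i x)) l (fun k => Derive g (co i l) * kron i k)).
    apply diff3_comp_co. apply (smooth_on_derive (Il G)); [easy|]. now apply dom_len. }
  unfold sum3. rewrite !E. destruct j; unfold kron; ring.
Qed.

Lemma angle_form_eq (f g : R -> R) (l : R3) (j : ix) :
  smooth_on (Ia G) f -> dom G l ->
  angle_form th f g l j = sum3 (fun i => g (co i l) * (Derive f (th i l) * dth i l j)).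
Proof.
  intros Hf Hl. unfold angle_form, sum_form.
  assert (E : forall i, partial j (fun x => f (th i x)) l = Derive f (th i l) * dth i l j).
  { intros i. apply (diff3_partial (fun x => f (th i x)) l (fun k => Derive f (th i l) * dth i l k)).
    apply diff3_comp; [now apply ang_diff3|].
    apply (smooth_on_derive (Ia G)); [easy|]. now apply dom_ang. }
  unfold sum3. now rewrite !E.
Qed.

(** The terms containing the second derivative of g lie on the diagonal and do not affect
    symmetry. *)
Lemma closed_edge_form (f g : R -> R) :
  smooth_on (Ia G) f -> smooth_on (Il G) g ->
  closed_form (dom G) (edge_form th f g) <-> reciprocal (Derive f) (Derive g).
Proof.
  intros Hf Hg.
  rewrite (closed_form_iff (dom G) (edge_form th f g)
    (fun l j k => Derive f (th j l) * dth j l k * Derive g (co j l)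
       + f (th j l) * (Derive (Derive g) (co j l) * kron j k))).
  - split; intros H l i j Hl; specialize (H l i j Hl); destruct i, j; try reflexivity;
      unfold kron in *; lra.
  - intros l j Hl.
    apply (diff3_ext_dom (dom G) (fun x => f (th j x) * Derive g (co j x)) _ _ _ (dom_open G) Hl).
    { intros x Hx. symmetry. now apply edge_form_eq. }
    apply diff3_mult.
    + apply diff3_comp; [now apply ang_diff3|].
      apply (smooth_on_derive (Ia G)); [easy|]. now apply dom_ang.
    + apply diff3_comp_co.
      apply (smooth_on_derive (Il G)); [now apply smooth_on_Derive|]. now apply dom_len.
Qed.

(** The index i selects which of the three equal expressions r(theta_i) s(l_j) s(l_k) for A is
    differentiated. [ddang i] uses the one with its own angle theta_i. *)
Definition darea (i : ix) (l : R3) (k : ix) : R :=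
  (ca G (th i l) * dth i l k * sl G (co (nxt i) l)
   + ra G (th i l) * (cl G (co (nxt i) l) * kron (nxt i) k)) * sl G (co (prv i) l)
  + ra G (th i l) * sl G (co (nxt i) l) * (cl G (co (prv i) l) * kron (prv i) k).

Lemma area_diff3 (i : ix) (l : R3) : dom G l -> diff3 A l (darea i l).
Proof.
  intros Hl.
  apply (diff3_ext_dom (dom G)
    (fun x => ra G (th i x) * sl G (co (nxt i) x) * sl G (co (prv i) x)) _ _ _ (dom_open G) Hl).
  { intros x Hx. now apply sine_law. }
  apply (diff3_mult (fun x => ra G (th i x) * sl G (co (nxt i) x)) (fun x => sl G (co (prv i) x))).
  - apply diff3_mult.
    + apply diff3_comp; [now apply ang_diff3|]. apply ra_derive.
    + apply diff3_comp_co, sl_derive.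
  - apply diff3_comp_co, sl_derive.
Qed.

Definition ddang (i : ix) (l : R3) (j k : ix) : R :=
  (cl G (co i l) * kron i k * A l - sl G (co i l) * darea i l k) / A l ^ 2 *
    (kron i j - ca G (th (prv i) l) * kron (nxt i) j - ca G (th (nxt i) l) * kron (prv i) j)
  + sl G (co i l) / A l *
    (eps G * ra G (th (prv i) l) * dth (prv i) l k * kron (nxt i) j
     + eps G * ra G (th (nxt i) l) * dth (nxt i) l k * kron (prv i) j).

Lemma dang_diff3 (i j : ix) (l : R3) :
  dom G l -> diff3 (fun x => dth i x j) l (ddang i l j).
Proof.
  intros Hl. pose proof (area_pos G l Hl) as HA.
  assert (Hc : forall m, diff3 (fun x => ca G (th m x)) l
            (fun k => - eps G * ra G (th m l) * dth m l k)).
  { intros m. apply diff3_comp; [now apply ang_diff3|]. apply ca_derive. }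
  eapply diff3_ext_d; [|unfold dang; apply diff3_mult].
  3: { apply diff3_minus; [apply diff3_minus|].
       - apply diff3_const.
       - apply diff3_mult; [apply Hc|apply diff3_const].
       - apply diff3_mult; [apply Hc|apply diff3_const]. }
  2: { apply diff3_div; [apply diff3_comp_co, sl_derive|now apply (area_diff3 i)|lra]. }
  intros k. unfold ddang. cbv beta. ring.
Qed.

(* Equality of the mixed second derivatives of the angles comes down to the dual
   cosine law. *)
Lemma ddang_sym (i j k : ix) (l : R3) : dom G l -> ddang i l j k = ddang i l k j.
Proof.
  intros Hl. pose proof (area_pos G l Hl) as HA.
  pose proof (dual_cosine_law G l i Hl) as D1.
  pose proof (dual_cosine_law G l (nxt i) Hl) as D2.
  pose proof (dual_cosine_law G l (prv i) Hl) as D3.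
  pose proof (sine_law G l i Hl) as S1.
  pose proof (sine_law G l (nxt i) Hl) as S2.
  pose proof (sine_law G l (prv i) Hl) as S3.
  pose proof (ca_ra_1 G (th (nxt i) l)) as P2.
  pose proof (ca_ra_1 G (th (prv i) l)) as P3.
  pose proof (ra_ang_pos G l (nxt i) Hl) as R2.
  pose proof (ra_ang_pos G l (prv i) Hl) as R3'.
  pose proof (sine_rule G l i Hl) as K1.
  pose proof (sine_rule G l (nxt i) Hl) as K2.
  pose proof (sine_rule G l (prv i) Hl) as K3.
  pose proof (sl_co_pos G l i1 Hl) as L1.
  pose proof (sl_co_pos G l i2 Hl) as L2.
  pose proof (sl_co_pos G l i3 Hl) as L3.
  assert (HK : 0 < A l / (sl G (co i1 l) * sl G (co i2 l) * sl G (co i3 l))).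
  { apply Rdiv_lt_0_compat; [easy|]. repeat apply Rmult_lt_0_compat; easy. }
  set (K := A l / (sl G (co i1 l) * sl G (co i2 l) * sl G (co i3 l))) in *.
  assert (N1 : nxt (nxt i) = prv i) by now destruct i.
  assert (N2 : prv (nxt i) = i) by now destruct i.
  assert (N3 : nxt (prv i) = i) by now destruct i.
  assert (N4 : prv (prv i) = nxt i) by now destruct i.
  rewrite N1, N2 in *. rewrite N3, N4 in *.
  assert (E12 : ddang i l i (nxt i) = ddang i l (nxt i) i).
  (* The two sides of [Key] differ by the numerator of the difference of the mixed derivatives. The
     factor r(theta) supplied below completes the products to which the dual cosine laws at [nxt i]
     and at i apply. *)
  { assert (Key : ra G (th i l) * sl G (co i l) * sl G (co (prv i) l) * cl G (co (nxt i) l)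
       = ca G (th (prv i) l) * cl G (co i l) * A l
         + eps G * sl G (co i l) * ra G (th (prv i) l) * sl G (co (prv i) l) * ca G (th (nxt i) l)).
    { apply (Rmult_eq_reg_r (ra G (th (prv i) l))); [|lra].
      transitivity (sl G (co i l) * sl G (co (prv i) l)
        * (ra G (th (prv i) l) * ra G (th i l) * cl G (co (nxt i) l))); [ring|].
      rewrite <- D2.
      transitivity (sl G (co i l) * sl G (co (prv i) l) *
         (ca G (th (prv i) l) * (ra G (th (nxt i) l) * ra G (th (prv i) l) * cl G (co i l))
          + eps G * ra G (th (prv i) l) ^ 2 * ca G (th (nxt i) l))); [|rewrite <- S2; ring].
      rewrite <- D1. replace (eps G * ra G (th (prv i) l) ^ 2) with (1 - ca G (th (prv i) l) ^ 2) by lra.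
      ring. }
    unfold ddang, darea, dang. rewrite N3, N4, N1, N2.
    apply Rminus_diag_uniq.
    transitivity ((ca G (th (prv i) l) * cl G (co i l) * A l
         + eps G * sl G (co i l) * ra G (th (prv i) l) * sl G (co (prv i) l) * ca G (th (nxt i) l)
         - ra G (th i l) * sl G (co i l) * sl G (co (prv i) l) * cl G (co (nxt i) l)) / A l ^ 2).
    - destruct i; simpl nxt; simpl prv; unfold kron; cbv iota; field; lra.
    - rewrite Key. field. lra. }
  assert (E13 : ddang i l i (prv i) = ddang i l (prv i) i).
  { assert (Key : ra G (th i l) * sl G (co i l) * sl G (co (nxt i) l) * cl G (co (prv i) l)
       = ca G (th (nxt i) l) * cl G (co i l) * A l
         + eps G * sl G (co i l) * ra G (th (nxt i) l) * sl G (co (nxt i) l) * ca G (th (prv i) l)).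
    { apply (Rmult_eq_reg_r (ra G (th (nxt i) l))); [|lra].
      transitivity (sl G (co i l) * sl G (co (nxt i) l)
        * (ra G (th i l) * ra G (th (nxt i) l) * cl G (co (prv i) l))); [ring|].
      rewrite <- D3.
      transitivity (sl G (co i l) * sl G (co (nxt i) l) *
         (ca G (th (nxt i) l) * (ra G (th (nxt i) l) * ra G (th (prv i) l) * cl G (co i l))
          + eps G * ra G (th (nxt i) l) ^ 2 * ca G (th (prv i) l))); [|rewrite <- S3; ring].
      rewrite <- D1. replace (eps G * ra G (th (nxt i) l) ^ 2) with (1 - ca G (th (nxt i) l) ^ 2) by lra.
      ring. }
    unfold ddang, darea, dang. rewrite N3, N4, N1, N2.
    apply Rminus_diag_uniq.
    transitivity ((ca G (th (nxt i) l) * cl G (co i l) * A l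
         + eps G * sl G (co i l) * ra G (th (nxt i) l) * sl G (co (nxt i) l) * ca G (th (prv i) l)
         - ra G (th i l) * sl G (co i l) * sl G (co (nxt i) l) * cl G (co (prv i) l)) / A l ^ 2).
    - destruct i; simpl nxt; simpl prv; unfold kron; cbv iota; field; lra.
    - rewrite Key. field. lra. }
  assert (E23 : ddang i l (nxt i) (prv i) = ddang i l (prv i) (nxt i)).
  (* Multiplying by the sine rule ratio K turns the lone s(l) into r(theta). By the dual cosine laws
     both sides then equal 1 plus the product of the three c(theta). *)
  { assert (Key : ca G (th (prv i) l) * ra G (th i l) * cl G (co (prv i) l) * sl G (co (nxt i) l)
         + eps G * ra G (th (prv i) l) * sl G (co (prv i) l)
       = ca G (th (nxt i) l) * ra G (th i l) * cl G (co (nxt i) l) * sl G (co (prv i) l)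
         + eps G * ra G (th (nxt i) l) * sl G (co (nxt i) l)).
    { apply (Rmult_eq_reg_r K); [|lra].
      transitivity (ca G (th (prv i) l) * (ra G (th i l) * (K * sl G (co (nxt i) l)) * cl G (co (prv i) l))
         + eps G * ra G (th (prv i) l) * (K * sl G (co (prv i) l))); [ring|].
      rewrite <- K2, <- K3, <- D3.
      transitivity (ca G (th (nxt i) l) * ((K * sl G (co (prv i) l)) * ra G (th i l) * cl G (co (nxt i) l))
         + eps G * ra G (th (nxt i) l) * (K * sl G (co (nxt i) l))); [|ring].
      rewrite <- K2, <- K3, <- D2. nra. }
    unfold ddang, darea, dang. rewrite N3, N4, N1, N2.
    apply Rminus_diag_uniq.
    transitivity (sl G (co i l) / A l ^ 2 * (
         ca G (th (prv i) l) * ra G (th i l) * cl G (co (prv i) l) * sl G (co (nxt i) l)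
         + eps G * ra G (th (prv i) l) * sl G (co (prv i) l)
         - (ca G (th (nxt i) l) * ra G (th i l) * cl G (co (nxt i) l) * sl G (co (prv i) l)
         + eps G * ra G (th (nxt i) l) * sl G (co (nxt i) l)))).
    - destruct i; simpl nxt; simpl prv; unfold kron; cbv iota; field; lra.
    - rewrite Key. ring. }
  destruct i, j, k; auto.
Qed.

(** The coefficients of this form already contain first derivatives of the angles, so testing
    closedness brings in their second derivatives; these cancel by [ddang_sym], leaving the products
    f' g' of [reciprocal]. *)
Lemma closed_angle_form (f g : R -> R) :
  smooth_on (Ia G) f -> smooth_on (Il G) g ->
  closed_form (dom G) (angle_form th f g) <-> reciprocal (Derive f) (Derive g).
Proof.
  intros Hf Hg.
  rewrite (closed_form_iff (dom G) (angle_form th f g)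
    (fun l j k => sum3 (fun i => Derive g (co i l) * kron i k * (Derive f (th i l) * dth i l j)
       + g (co i l) * (Derive (Derive f) (th i l) * dth i l k * dth i l j
                       + Derive f (th i l) * ddang i l j k)))).
  - assert (E : forall l j k, dom G l ->
       sum3 (fun i => Derive g (co i l) * kron i k * (Derive f (th i l) * dth i l j)
       + g (co i l) * (Derive (Derive f) (th i l) * dth i l k * dth i l j
                       + Derive f (th i l) * ddang i l j k)) =
       Derive f (th k l) * Derive g (co k l) * dth k l j +
       sum3 (fun i => g (co i l) * (Derive (Derive f) (th i l) * dth i l k * dth i l j
                       + Derive f (th i l) * ddang i l j k))).
    { intros l j k _. destruct k; unfold sum3, kron; ring. }
    assert (S : forall l j k, dom G l ->
       sum3 (fun i => g (co i l) * (Derive (Derive f) (th i l) * dth i l k * dth i l j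
                       + Derive f (th i l) * ddang i l j k)) =
       sum3 (fun i => g (co i l) * (Derive (Derive f) (th i l) * dth i l j * dth i l k
                       + Derive f (th i l) * ddang i l k j))).
    { intros l j k Hl. unfold sum3.
      rewrite !(ddang_sym _ j k) by easy. ring. }
    split; intros H l i j Hl; specialize (H l i j Hl); rewrite ?E in * by easy;
      pose proof (S l i j Hl); lra.
  - intros l j Hl.
    apply (diff3_ext_dom (dom G)
      (fun x => sum3 (fun i => g (co i x) * (Derive f (th i x) * dth i x j))) _ _ _ (dom_open G) Hl).
    { intros x Hx. symmetry. now apply angle_form_eq. }
    apply (diff3_sum3 (fun i x => g (co i x) * (Derive f (th i x) * dth i x j)) l
       (fun i k => _)).
    intros i. apply diff3_mult.
    + apply diff3_comp_co. apply (smooth_on_derive (Il G)); [easy|]. now apply dom_len.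
    + apply diff3_mult; [|now apply dang_diff3].
      apply diff3_comp; [now apply ang_diff3|].
      apply (smooth_on_derive (Ia G)); [now apply smooth_on_Derive|]. now apply dom_ang.
Qed.

(** By the sine rule f'(theta_i) g'(l_i) s(l_i) is the same for all i, and what remains of [dang]
    after removing s(l_i) is a symmetric matrix. *)
Lemma reciprocal_powers (f' g' : R -> R) (lambda c1 c2 : R) :
  (forall x, Ia G x -> f' x = c1 * Rpower (ra G x) lambda) ->
  (forall x, Il G x -> g' x = c2 * Rpower (sl G x) (- lambda - 1)) ->
  reciprocal f' g'.
Proof.
  intros Hf Hg l i j Hl.
  assert (E : forall i, f' (th i l) * g' (co i l) * sl G (co i l) =
     c1 * c2 * Rpower (A l / (sl G (co i1 l) * sl G (co i2 l) * sl G (co i3 l))) lambda).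
  { intros m. rewrite Hf, Hg by now (apply dom_ang || apply dom_len).
    pose proof (sl_co_pos G l m Hl) as Hs.
    rewrite (sine_rule G l m Hl), <- Rpower_mult_distr; [|apply Rdiv_lt_0_compat|easy].
    - rewrite Rpower_minus_1, Rpower_Ropp by easy. field. split; [|lra].
      apply Rgt_not_eq, exp_pos.
    - now apply area_pos.
    - repeat apply Rmult_lt_0_compat; now apply sl_co_pos. }
  assert (F : forall i j, f' (th i l) * g' (co i l) * dth i l j =
    c1 * c2 * Rpower (A l / (sl G (co i1 l) * sl G (co i2 l) * sl G (co i3 l))) lambda / A l *
     (kron i j - ca G (th (prv i) l) * kron (nxt i) j - ca G (th (nxt i) l) * kron (prv i) j)).
  { intros m n. rewrite <- (E m). unfold dang. field. apply Rgt_not_eq. now apply area_pos. }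
  rewrite !F. f_equal. destruct i, j; simpl nxt; simpl prv; unfold kron; ring.
Qed.

(* Reciprocity only yields c(theta_3) (p_1 q_1 - p_2 q_2) = 0; where c(theta_3)
   vanishes its derivative in l_3 does not. *)
Lemma reciprocal_product (f g : R -> R) :
  smooth_on (Ia G) f -> smooth_on (Il G) g -> reciprocal (Derive f) (Derive g) ->
  forall l, dom G l ->
    Derive f (th i1 l) * (Derive g (co i1 l) * sl G (co i1 l))
    = Derive f (th i2 l) * (Derive g (co i2 l) * sl G (co i2 l)).
Proof.
  intros Hf Hg H l Hl.
  set (P := fun i x => Derive f (th i x) * (Derive g (co i x) * sl G (co i x))).
  assert (Z : forall x, dom G x -> 0 = ca G (th i3 x) * (P i1 x - P i2 x)).
  { intros x Hx. pose proof (H x i1 i2 Hx) as E. pose proof (area_pos G x Hx) as HA.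
    unfold dang, kron in E; simpl nxt in E; simpl prv in E.
    apply (Rmult_eq_reg_r (/ A x)); [|apply Rinv_neq_0_compat; lra].
    unfold P. unfold Rdiv in E. lra. }
  assert (DP : exists d, diff3 (fun x => P i1 x - P i2 x) l d).
  { assert (DP1 : forall i, exists d, diff3 (P i) l d).
    { intros i. eexists. apply diff3_mult.
      - apply diff3_comp; [now apply ang_diff3|].
        apply (smooth_on_derive (Ia G)); [now apply smooth_on_Derive|]. now apply dom_ang.
      - apply diff3_mult; apply diff3_comp_co.
        + apply (smooth_on_derive (Il G)); [now apply smooth_on_Derive|]. now apply dom_len.
        + apply sl_derive. }
    destruct (DP1 i1) as [d1 H1], (DP1 i2) as [d2 H2].
    eexists. exact (diff3_minus _ _ _ _ _ H1 H2). }
  destruct DP as [d Hd].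
  assert (DZ : diff3 (fun x => ca G (th i3 x) * (P i1 x - P i2 x)) l (fun _ => 0)).
  { apply (diff3_ext_dom (dom G) (fun _ => 0) _ _ _ (dom_open G) Hl Z). apply diff3_const. }
  assert (DZ' := diff3_mult _ _ _ _ _
     (diff3_comp _ _ _ _ _ (ang_diff3 G l i3 Hl) (ca_derive G (th i3 l))) Hd).
  pose proof (proj2 (diff3_partial _ _ _ i3 DZ)) as E1.
  pose proof (proj2 (diff3_partial _ _ _ i3 DZ')) as E2.
  assert (E3 := eq_trans (eq_sym E1) E2). clear E1 E2. rename E3 into E2. cbv beta in E2.
  change (P i1 l = P i2 l). apply Rminus_diag_uniq.
  pose proof (Z l Hl) as E0. symmetry in E0. apply Rmult_integral in E0 as [E0|E0]; [|exact E0].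
  rewrite E0, Rmult_0_l, Rplus_0_r in E2. symmetry in E2.
  apply Rmult_integral in E2 as [E2|E2]; [|exact E2]. exfalso.
  revert E2. unfold dang, kron; simpl nxt; simpl prv.
  pose proof (area_pos G l Hl). pose proof (sl_co_pos G l i3 Hl).
  pose proof (ra_ang_pos G l i3 Hl). pose proof (eps_neq0 G).
  apply Rmult_integral_contrapositive_currified.
  - apply Rmult_integral_contrapositive_currified; lra.
  - apply Rmult_integral_contrapositive_currified; [|lra].
    apply Rgt_not_eq. now apply Rdiv_lt_0_compat.
Qed.

Lemma reciprocal_solution (f g : R -> R) :
  smooth_on (Ia G) f -> smooth_on (Il G) g ->
  non_constant_on (Ia G) f -> non_constant_on (Il G) g ->
  reciprocal (Derive f) (Derive g) ->
  exists lambda c1 c2 : R, c1 <> 0 /\ c2 <> 0 /\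
    (forall x, Ia G x -> Derive f x = c1 * Rpower (ra G x) lambda) /\
    (forall x, Il G x -> Derive g x = c2 * Rpower (sl G x) (- lambda - 1)).
Proof.
  intros Hf Hg Nf Ng H.
  destruct (product_relation_powers G (Derive f) (fun x => Derive g x * sl G x)
     (Derive (Derive f)) (fun x => Derive (Derive g) x * sl G x + Derive g x * cl G x))
    as (lambda & c1 & c2 & H1 & H2 & Hp & Hq).
  - intros x Hx. apply (smooth_on_derive (Ia G)); [now apply smooth_on_Derive|easy].
  - intros x Hx. apply (is_derive_mult (Derive g) (sl G)).
    + apply (smooth_on_derive (Il G)); [now apply smooth_on_Derive|easy].
    + apply sl_derive.
    + intros; apply Rmult_comm.
  - intros x Hx.
    assert (Cs : continuous (sl G) x) by
      (apply (ex_derive_continuous (sl G)); eexists; apply sl_derive).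
    assert (Cc : continuous (cl G) x) by
      (apply (ex_derive_continuous (cl G)); eexists; apply cl_derive).
    apply (continuous_plus (V := R_NormedModule)); apply (continuous_mult (K := R_AbsRing)); try easy.
    + apply (smooth_on_continuous (Il G)); [|easy]. now do 2 apply smooth_on_Derive.
    + apply (smooth_on_continuous (Il G)); [|easy]. now apply smooth_on_Derive.
  - now apply reciprocal_product.
  - apply (non_constant_derive (Ia G) f); [apply Ia_interval| |easy].
    intros x Hx. now apply (smooth_on_derive (Ia G)).
  - destruct (non_constant_derive (Il G) g (Derive g)) as [x [Hx Hx0]];
      [apply Il_interval| |easy|].
    + intros x Hx. now apply (smooth_on_derive (Il G)).
    + exists x. split; [easy|]. apply Rmult_integral_contrapositive_currified; [easy|].
      pose proof (sl_pos G x Hx). lra.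
  - exists lambda, c1, c2. repeat split; auto.
    intros x Hx. pose proof (sl_pos G x Hx) as Hs.
    rewrite Rpower_minus_1 by easy. apply (Rmult_eq_reg_r (sl G x)); [|lra].
    transitivity (c2 * Rpower (sl G x) (- lambda)); [now rewrite <- Hq|]. field. lra.
Qed.

Lemma smooth_on_powers_ra (lambda : R) : smooth_on (Ia G) (fun x => Rpower (ra G x) lambda).
Proof.
  apply (smooth_on_Rpower (Ia G) (ra G) (ca G) (eps G)).
  - apply Ia_interval.
  - apply ra_pos.
  - intros x _. apply ra_derive.
  - intros x _. apply ca_derive.
Qed.

Lemma smooth_on_powers_sl (a : R) : smooth_on (Il G) (fun x => Rpower (sl G x) a).
Proof.
  apply (smooth_on_Rpower (Il G) (sl G) (cl G) (kap G)).
  - apply Il_interval.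
  - apply sl_pos.
  - intros x _. apply sl_derive.
  - intros x _. apply cl_derive.
Qed.

Lemma antiderivative_smooth (I : R -> Prop) (s F : R -> R) (a c : R) :
  is_open_interval I -> (exists x, I x) -> smooth_on I (fun x => Rpower (s x) a) ->
  antiderivative_on I (fun x => Rpower (s x) a) F -> c <> 0 ->
  smooth_on I (fun x => c * F x) /\ non_constant_on I (fun x => c * F x) /\
  forall x, I x -> Derive (fun x => c * F x) x = c * Rpower (s x) a.
Proof.
  intros HI [x0 H0] Hs HF Hc.
  assert (D : forall x, I x -> is_derive (fun x => c * F x) x (c * Rpower (s x) a)).
  { intros x Hx. now apply is_derive_scal, HF. }
  repeat split.
  - apply (smooth_on_of_derive I _ (fun x => c * Rpower (s x) a) HI D). now apply smooth_on_scal.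
  - apply (derive_neq0_non_constant I _ x0 _ HI H0 (D x0 H0)).
    apply Rmult_integral_contrapositive_currified; [easy|]. apply Rgt_not_eq, exp_pos.
  - intros x Hx. apply is_derive_unique. now apply D.
Qed.

Lemma Il_inhabited : exists x, Il G x.
Proof. destruct (cl_neq0 G) as [y [Hy _]]. now exists y. Qed.

Lemma antiderivative_powers_sl (a : R) :
  exists F, antiderivative_on (Il G) (fun x => Rpower (sl G x) a) F.
Proof.
  destruct Il_inhabited as [y Hy]. eexists.
  apply (antiderivative_RInt _ _ y (Il_interval G) Hy).
  intros x Hx. apply (smooth_on_continuous (Il G)); [|easy]. apply smooth_on_powers_sl.
Qed.

Lemma antiderivative_of_Derive (I : R -> Prop) (f h : R -> R) (c : R) :
  smooth_on I f -> c <> 0 -> (forall x, I x -> Derive f x = c * h x) ->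
  antiderivative_on I h (fun x => / c * f x).
Proof.
  intros Hf Hc Hd x Hx. eapply is_derive_eq.
  - apply is_derive_scal. now apply (smooth_on_derive I).
  - rewrite Hd by easy. field. exact Hc.
Qed.

Theorem complete_edge_forms (Ne : exists x, Ia G x) :
  complete_list (dom G) (edge_form th) (Ia G) (Il G) (w_list th (Ia G) (ra G) (sl G)).
Proof.
  intros w. split.
  - intros [Hw (f & g & Hf & Nf & Hg & Ng & E)].
    apply (closed_form_ext _ _ _ (dom_open G) E) in Hw.
    apply closed_edge_form in Hw; [|easy|easy].
    destruct (reciprocal_solution f g Hf Hg Nf Ng Hw) as (lambda & c1 & c2 & H1 & H2 & Hp & Hq).
    exists (c1 * c2), (w_form th (sl G) lambda (fun x => / c1 * f x)). split; [|split].
    + now apply Rmult_integral_contrapositive_currified.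
    + exists lambda, (fun x => / c1 * f x). split; [|reflexivity].
      now apply antiderivative_of_Derive.
    + intros l Hl j. rewrite E, edge_form_eq by easy.
      rewrite Hq by now apply dom_len. unfold scale_form, w_form.
      replace (- lambda - 1) with (- (lambda + 1)) by ring. rewrite Rpower_Ropp.
      field. split; [easy|]. apply Rgt_not_eq, exp_pos.
  - intros (c & w0 & Hc & (lambda & F & HF & ->) & E).
    (* Any antiderivative of s^(-lambda - 1) serves as g; the scale factor c is absorbed into f. *)
    destruct (antiderivative_powers_sl (- lambda - 1)) as [g Hg].
    destruct (antiderivative_smooth (Ia G) (ra G) F lambda c (Ia_interval G) Ne
      (smooth_on_powers_ra lambda) HF Hc) as (Sf & Nf & Df).
    destruct (antiderivative_smooth (Il G) (sl G) g (- lambda - 1) 1 (Il_interval G) Il_inhabited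
      (smooth_on_powers_sl _) Hg R1_neq_R0) as (Sg & Ng & Dg).
    assert (E' : form_eq (dom G) w (edge_form th (fun x => c * F x) (fun x => 1 * g x))).
    { intros l Hl j. rewrite E, edge_form_eq by easy. rewrite Dg by now apply dom_len.
      unfold scale_form, w_form.
      replace (- lambda - 1) with (- (lambda + 1)) by ring. rewrite Rpower_Ropp.
      field. apply Rgt_not_eq, exp_pos. }
    split.
    + apply (closed_form_ext _ (edge_form th (fun x => c * F x) (fun x => 1 * g x)) _ (dom_open G)).
      { intros l Hl j. symmetry. now apply E'. }
      apply closed_edge_form; [easy|easy|].
      now apply (reciprocal_powers _ _ lambda c 1).
    + eexists; eexists; repeat split; eauto.
Qed.

Lemma angle_form_scal (f g : R -> R) (a b : R) (l : R3) (j : ix) :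
  angle_form th (fun x => a * f x) (fun x => b * g x) l j
  = a * b * angle_form th f g l j.
Proof.
  assert (E : forall i, partial j (fun l => a * f (th i l)) l = a * partial j (fun l => f (th i l)) l).
  { intros i. apply Derive_scal. }
  unfold angle_form, sum_form, sum3. rewrite !E. ring.
Qed.

Theorem complete_angle_forms (Ne : exists x, Ia G x) :
  complete_list (dom G) (angle_form th) (Ia G) (Il G)
    (legendre_list th (Ia G) (Il G) (ra G) (sl G)).
Proof.
  intros w. split.
  - intros [Hw (f & g & Hf & Nf & Hg & Ng & E)].
    apply (closed_form_ext _ _ _ (dom_open G) E) in Hw.
    apply closed_angle_form in Hw; [|easy|easy].
    destruct (reciprocal_solution f g Hf Hg Nf Ng Hw) as (lambda & c1 & c2 & H1 & H2 & Hp & Hq).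
    exists (c1 * c2), (angle_form th (fun x => / c1 * f x) (fun x => / c2 * g x)). split; [|split].
    + now apply Rmult_integral_contrapositive_currified.
    + exists lambda, (fun x => / c1 * f x), (fun x => / c2 * g x). split; [|split; [|reflexivity]].
      * now apply antiderivative_of_Derive.
      * now apply antiderivative_of_Derive.
    + intros l Hl j. rewrite E by easy. unfold scale_form. rewrite angle_form_scal.
      field. split; easy.
  - intros (c & w0 & Hc & (lambda & F & g & HF & Hg & ->) & E).
    destruct (antiderivative_smooth (Ia G) (ra G) F lambda c (Ia_interval G) Ne
      (smooth_on_powers_ra lambda) HF Hc) as (Sf & Nf & Df).
    destruct (antiderivative_smooth (Il G) (sl G) g (- lambda - 1) 1 (Il_interval G) Il_inhabited
      (smooth_on_powers_sl _) Hg R1_neq_R0) as (Sg & Ng & Dg).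
    assert (E' : form_eq (dom G) w (angle_form th (fun x => c * F x) (fun x => 1 * g x))).
    { intros l Hl j. rewrite E by easy. rewrite angle_form_scal. unfold scale_form. ring. }
    split.
    + apply (closed_form_ext _ (angle_form th (fun x => c * F x) (fun x => 1 * g x)) _ (dom_open G)).
      { intros l Hl j. symmetry. now apply E'. }
      apply closed_angle_form; [easy|easy|].
      now apply (reciprocal_powers _ _ lambda c 1).
    + eexists; eexists; repeat split; eauto.
Qed.

End ClosedForms.

(** * Cosine laws *)

(** Multiplied by s_i^2 s_n s_p, the dual cosine law involves the cosines only through the products
    c s s, which the cosine laws make explicit, and the r only through A^2. *)
Lemma dual_cosine_of_products (ci cn cp rn rp si sn sp Ci A : R) :
  0 < si -> 0 < sn -> 0 < sp ->
  rn * sp * si = A -> rp * si * sn = A ->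
  (ci * sn * sp) * si ^ 2 + (cn * sp * si) * (cp * si * sn) = A ^ 2 * Ci ->
  ci + cn * cp = rn * rp * Ci.
Proof.
  intros Hi Hn Hp H1 H2 E.
  apply (Rmult_eq_reg_r (si ^ 2 * sn * sp)).
  - transitivity ((ci * sn * sp) * si ^ 2 + (cn * sp * si) * (cp * si * sn)); [ring|].
    rewrite E. transitivity ((rn * sp * si) * (rp * si * sn) * Ci); [|ring].
    rewrite H1, H2. ring.
  - apply Rgt_not_eq, Rmult_lt_0_compat; [apply Rmult_lt_0_compat|]; try easy. now apply pow_lt.
Qed.

(** Positive numbers with equal squares are equal, so the sine law follows once the square is
    written symmetrically in the lengths. *)
Lemma area_of_square (ang : ix -> R3 -> R) (r s : R -> R) (D : R) (l : R3) :
  (forall i, 0 < s (co i l)) -> (forall i, 0 < r (ang i l)) ->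
  (forall i, (r (ang i l) * s (co (nxt i) l) * s (co (prv i) l)) ^ 2 = D) ->
  forall i, r (ang i l) * s (co (nxt i) l) * s (co (prv i) l) = area ang r s l.
Proof.
  intros Hs Hr HD i.
  assert (P : forall i, 0 <= r (ang i l) * s (co (nxt i) l) * s (co (prv i) l)).
  { intros j. apply Rlt_le. repeat apply Rmult_lt_0_compat; easy. }
  assert (S : forall i, r (ang i l) * s (co (nxt i) l) * s (co (prv i) l) = sqrt D).
  { intros j. rewrite <- (HD j). now rewrite sqrt_pow2. }
  rewrite S. symmetry. exact (S i1).
Qed.

(* The cosine laws of the sphere (e = k = 1), of the hyperbolic plane (e = 1, k = -1)
   and of the right-angled hexagon (e = k = -1) are
   c(theta_i) s_j s_k = e k C_i - k C_j C_k. *)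
Section CosineLaw.

Variables (ang : ix -> R3 -> R) (arc r c s C : R -> R) (e k : R) (l : R3).
Hypothesis e2 : e ^ 2 = 1.
Hypothesis k2 : k ^ 2 = 1.
Hypothesis Hang : forall i x, ang i x = arc
  ((e * k * C (co i x) - k * C (co (nxt i) x) * C (co (prv i) x))
   / (s (co (nxt i) x) * s (co (prv i) x))).
Hypothesis Hc : forall x, c x ^ 2 + e * r x ^ 2 = 1.
Hypothesis HC : forall x, C x ^ 2 + k * s x ^ 2 = 1.
Hypothesis Hs' : forall x, is_derive s x (C x).
Hypothesis HC' : forall x, is_derive C x (- k * s x).
Hypothesis Hs : forall i, 0 < s (co i l).
Hypothesis Hr : forall i, 0 < r (ang i l).
Hypothesis Harc : forall i, c (ang i l) =
  (e * k * C (co i l) - k * C (co (nxt i) l) * C (co (prv i) l))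
   / (s (co (nxt i) l) * s (co (prv i) l)).
Hypothesis Harc' : forall i, is_derive arc
  ((e * k * C (co i l) - k * C (co (nxt i) l) * C (co (prv i) l))
   / (s (co (nxt i) l) * s (co (prv i) l))) (- 1 / (e * r (ang i l))).

(** Up to the sign e, the Gram determinant of the matrix with 1 on the diagonal and e C(l_i) off it;
    it is visibly symmetric in the three lengths. *)
Let D := e * (1 - C (co i1 l) ^ 2 - C (co i2 l) ^ 2 - C (co i3 l) ^ 2
              + 2 * e * C (co i1 l) * C (co i2 l) * C (co i3 l)).

Lemma cosine_law (i : ix) :
  c (ang i l) * s (co (nxt i) l) * s (co (prv i) l)
  = e * k * C (co i l) - k * C (co (nxt i) l) * C (co (prv i) l).
Proof.
  rewrite Harc. field. split; apply Rgt_not_eq, Hs.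
Qed.

Lemma cosine_law_area_square (i : ix) :
  (r (ang i l) * s (co (nxt i) l) * s (co (prv i) l)) ^ 2 = D.
Proof.
  assert (R2 : r (ang i l) ^ 2 = e * (1 - c (ang i l) ^ 2)).
  { transitivity (e ^ 2 * r (ang i l) ^ 2); [rewrite e2; ring|].
    rewrite <- (Hc (ang i l)). ring. }
  assert (S2 : forall j, s (co j l) ^ 2 = k * (1 - C (co j l) ^ 2)).
  { intros j. transitivity (k ^ 2 * s (co j l) ^ 2); [rewrite k2; ring|].
    rewrite <- (HC (co j l)). ring. }
  transitivity (e * (s (co (nxt i) l) ^ 2 * s (co (prv i) l) ^ 2
     - (c (ang i l) * s (co (nxt i) l) * s (co (prv i) l)) ^ 2)).
  { rewrite !Rpow_mult_distr, R2. ring. }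
  rewrite cosine_law, !S2.
  transitivity (e * (k ^ 2 * (1 - C (co (nxt i) l) ^ 2) * (1 - C (co (prv i) l) ^ 2)
     - k ^ 2 * (e ^ 2 * C (co i l) ^ 2 - 2 * e * C (co i l) * C (co (nxt i) l) * C (co (prv i) l)
                + C (co (nxt i) l) ^ 2 * C (co (prv i) l) ^ 2))); [ring|].
  rewrite k2, e2. unfold D. destruct i; simpl nxt; simpl prv; ring.
Qed.

Lemma cosine_law_sine_law (i : ix) :
  r (ang i l) * s (co (nxt i) l) * s (co (prv i) l) = area ang r s l.
Proof. apply (area_of_square ang r s D); auto. apply cosine_law_area_square. Qed.

Lemma cosine_law_dual (i : ix) :
  c (ang i l) + c (ang (nxt i) l) * c (ang (prv i) l)
  = r (ang (nxt i) l) * r (ang (prv i) l) * C (co i l).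
Proof.
  pose proof (cosine_law_sine_law (nxt i)) as A2.
  pose proof (cosine_law_sine_law (prv i)) as A3.
  pose proof (cosine_law i) as L1. pose proof (cosine_law (nxt i)) as L2.
  pose proof (cosine_law (prv i)) as L3.
  assert (N1 : nxt (nxt i) = prv i) by now destruct i.
  assert (N2 : prv (nxt i) = i) by now destruct i.
  assert (N3 : nxt (prv i) = i) by now destruct i.
  assert (N4 : prv (prv i) = nxt i) by now destruct i.
  rewrite N1, N2 in *. rewrite N3, N4 in *.
  apply (dual_cosine_of_products _ _ _ _ _ (s (co i l)) (s (co (nxt i) l)) (s (co (prv i) l))
    _ (area ang r s l)); try easy.
  rewrite L1, L2, L3.
  assert (S2 : s (co i l) ^ 2 = k * (1 - C (co i l) ^ 2)).
  { transitivity (k ^ 2 * s (co i l) ^ 2); [rewrite k2; ring|].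
    rewrite <- (HC (co i l)). ring. }
  rewrite <- (cosine_law_sine_law i), cosine_law_area_square, S2.
  transitivity (k ^ 2 * ((e * C (co i l) - C (co (nxt i) l) * C (co (prv i) l)) * (1 - C (co i l) ^ 2)
    + (e ^ 2 * C (co (nxt i) l) * C (co (prv i) l) - e * C (co i l) * C (co (nxt i) l) ^ 2
       - e * C (co i l) * C (co (prv i) l) ^ 2 + C (co i l) ^ 2 * C (co (nxt i) l) * C (co (prv i) l)))).
  { ring. }
  rewrite k2, e2. unfold D.
  transitivity (e * (1 - C (co i1 l) ^ 2 - C (co i2 l) ^ 2 - C (co i3 l) ^ 2) * C (co i l)
              + 2 * e ^ 2 * C (co i1 l) * C (co i2 l) * C (co i3 l) * C (co i l)); [|ring].
  rewrite e2. destruct i; simpl nxt; simpl prv; ring.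
Qed.

Lemma cosine_law_diff3 (i : ix) : diff3 (ang i) l (dang ang r c s i l).
Proof.
  pose proof (Hs i) as s1. pose proof (Hs (nxt i)) as s2. pose proof (Hs (prv i)) as s3.
  pose proof (Hr i) as r1.
  assert (He : e <> 0) by (intros E; rewrite E in e2; lra).
  assert (DC : forall j, diff3 (fun x => C (co j x)) l (fun m => - k * s (co j l) * kron j m)).
  { intros j. apply diff3_comp_co, HC'. }
  assert (DS : forall j, diff3 (fun x => s (co j x)) l (fun m => C (co j l) * kron j m)).
  { intros j. apply diff3_comp_co, Hs'. }
  apply (diff3_ext (fun x => arc ((e * k * C (co i x) - k * C (co (nxt i) x) * C (co (prv i) x))
   / (s (co (nxt i) x) * s (co (prv i) x))))); [intros x; now rewrite Hang|].
  eapply diff3_ext_d; [|apply diff3_comp; [apply diff3_div|apply Harc']].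
  2: { apply diff3_minus.
       - apply diff3_mult; [apply diff3_const|apply DC].
       - apply diff3_mult; [apply diff3_mult; [apply diff3_const|apply DC]|apply DC]. }
  2: { apply diff3_mult; apply DS. }
  2: { apply Rmult_integral_contrapositive_currified; lra. }
  intros m. cbv beta. unfold dang.
  rewrite <- (cosine_law_sine_law i).
  pose proof (cosine_law (nxt i)) as L2. pose proof (cosine_law (prv i)) as L3.
  assert (N1 : nxt (nxt i) = prv i) by now destruct i.
  assert (N2 : prv (nxt i) = i) by now destruct i.
  assert (N3 : nxt (prv i) = i) by now destruct i.
  assert (N4 : prv (prv i) = nxt i) by now destruct i.
  rewrite N1, N2 in *. rewrite N3, N4 in *.
  assert (S2 : forall j, s (co j l) ^ 2 = k * (1 - C (co j l) ^ 2)).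
  { intros j. transitivity (k ^ 2 * s (co j l) ^ 2); [rewrite k2; ring|].
    rewrite <- (HC (co j l)). ring. }
  pose proof (S2 (nxt i)) as Sn. pose proof (S2 (prv i)) as Sp.
  set (ci := C (co i l)) in *. set (cn := C (co (nxt i) l)) in *. set (cp := C (co (prv i) l)) in *.
  set (si := s (co i l)) in *. set (sn := s (co (nxt i) l)) in *. set (sp := s (co (prv i) l)) in *.
  set (ri := r (ang i l)) in *. set (xn := c (ang (nxt i) l)) in *. set (xp := c (ang (prv i) l)) in *.
  assert (Ep : e * xp * si * sn = k * (cp - e * ci * cn)).
  { transitivity (e * (xp * si * sn)); [ring|]. rewrite L3.
    transitivity (k * (e ^ 2 * cp - e * ci * cn)); [ring|]. rewrite e2. ring. }
  assert (En : e * xn * si * sp = k * (cn - e * ci * cp)).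
  { transitivity (e * (xn * sp * si)); [ring|]. rewrite L2.
    transitivity (k * (e ^ 2 * cn - e * ci * cp)); [ring|]. rewrite e2. ring. }
  (* The quotient rule. After s^2 = k (1 - C^2), the coefficients in the two adjacent lengths
     contain C_p - e C_i C_n and C_n - e C_i C_p, which [Ep] and [En] recognise as the cosine laws
     of the other two angles. *)
  transitivity (
    - 1 / (e * ri) * ((- e * k ^ 2 * si * sn * sp) / (sn * sp) ^ 2 * kron i m
     + (k ^ 2 * sn ^ 2 * cp * sp - k * (e * ci - cn * cp) * cn * sp) / (sn * sp) ^ 2 * kron (nxt i) m
     + (k ^ 2 * sp ^ 2 * cn * sn - k * (e * ci - cn * cp) * cp * sn) / (sn * sp) ^ 2 * kron (prv i) m)).
  { field. repeat split; lra. }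
  rewrite k2, Sn, Sp.
  replace (1 * (k * (1 - cn ^ 2)) * cp * sp - k * (e * ci - cn * cp) * cn * sp)
    with (k * (cp - e * ci * cn) * sp) by ring.
  replace (1 * (k * (1 - cp ^ 2)) * cn * sn - k * (e * ci - cn * cp) * cp * sn)
    with (k * (cn - e * ci * cp) * sn) by ring.
  rewrite <- Ep, <- En. field. repeat split; lra.
Qed.

End CosineLaw.

(** * Inverse functions, hyperbolic identities and tools for the length domains *)

Lemma is_derive_acos (x : R) : -1 < x < 1 -> is_derive acos x (- 1 / sqrt (1 - x ^ 2)).
Proof.
  intros Hx. apply is_derive_Reals.
  rewrite <- Rsqr_pow2, <- (derive_pt_acos x Hx).
  apply (derive_pt_eq_1 acos x _ (derivable_pt_acos x Hx)). reflexivity.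
Qed.

(** The factor 1 is the sign e of the hypothesis [Harc'] in section [CosineLaw]; [is_derive_arcosh]
    has -1 in the same place. *)
Lemma is_derive_acos_sin (x : R) : -1 < x < 1 -> is_derive acos x (- 1 / (1 * sin (acos x))).
Proof.
  intros H. eapply is_derive_eq; [now apply is_derive_acos|].
  rewrite sin_acos, Rsqr_pow2 by lra. now rewrite Rmult_1_l.
Qed.

Lemma cosh_plus (x y : R) : cosh (x + y) = cosh x * cosh y + sinh x * sinh y.
Proof.
  unfold cosh, sinh. rewrite Ropp_plus_distr, !exp_plus, !exp_Ropp.
  pose proof (exp_pos x). pose proof (exp_pos y). field. lra.
Qed.

Lemma cosh_minus (x y : R) : cosh (x - y) = cosh x * cosh y - sinh x * sinh y.
Proof.
  unfold Rminus. rewrite cosh_plus. unfold cosh, sinh. rewrite Ropp_involutive. field.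
Qed.

Lemma cosh_sinh_1 (x : R) : cosh x ^ 2 - sinh x ^ 2 = 1.
Proof.
  pose proof (cosh_minus x x) as E. rewrite Rminus_diag_eq, cosh_0 in E by easy. lra.
Qed.

Lemma sinh_pos (x : R) : 0 < x -> 0 < sinh x.
Proof. intros H. rewrite <- sinh_0. now apply sinh_lt. Qed.

Lemma cosh_ge_1 (x : R) : 1 <= cosh x.
Proof.
  pose proof (cosh_sinh_1 x). pose proof (pow2_ge_0 (sinh x)).
  assert (0 < cosh x) by (unfold cosh; pose proof (exp_pos x); pose proof (exp_pos (- x)); lra).
  nra.
Qed.

Lemma cosh_increasing (x y : R) : 0 <= x -> x < y -> cosh x < cosh y.
Proof.
  intros Hx Hxy.
  assert (sinh x < sinh y) by now apply sinh_lt.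
  assert (0 <= sinh x).
  { destruct (Rle_lt_or_eq_dec 0 x Hx) as [H0|<-]; [|rewrite sinh_0; lra].
    apply Rlt_le. now apply sinh_pos. }
  pose proof (cosh_sinh_1 x). pose proof (cosh_sinh_1 y).
  pose proof (cosh_ge_1 x). pose proof (cosh_ge_1 y). nra.
Qed.

Lemma cosh_opp (x : R) : cosh (- x) = cosh x.
Proof. unfold cosh. rewrite Ropp_involutive. field. Qed.

Lemma is_derive_sinh (x : R) : is_derive sinh x (cosh x).
Proof. apply is_derive_Reals, derivable_pt_lim_sinh. Qed.

Lemma is_derive_cosh (x : R) : is_derive cosh x (sinh x).
Proof. apply is_derive_Reals, derivable_pt_lim_cosh. Qed.

Lemma exp_arcosh (x : R) : 1 < x ->
  exp (arcosh x) = x + sqrt (x ^ 2 - 1) /\ exp (- arcosh x) = x - sqrt (x ^ 2 - 1).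
Proof.
  intros Hx. assert (H0 : 0 <= x ^ 2 - 1) by nra.
  pose proof (sqrt_pos (x ^ 2 - 1)) as Hs.
  pose proof (sqrt_sqrt _ H0) as Hss.
  assert (E : exp (arcosh x) = x + sqrt (x ^ 2 - 1)) by (apply exp_ln; lra).
  split; [exact E|]. rewrite exp_Ropp, E.
  apply (Rmult_eq_reg_r (x + sqrt (x ^ 2 - 1))); [|lra].
  rewrite Rinv_l by lra. nra.
Qed.

Lemma cosh_arcosh (x : R) : 1 < x -> cosh (arcosh x) = x.
Proof. intros H. unfold cosh. destruct (exp_arcosh x H) as [-> ->]. field. Qed.

Lemma sinh_arcosh (x : R) : 1 < x -> sinh (arcosh x) = sqrt (x ^ 2 - 1).
Proof. intros H. unfold sinh. destruct (exp_arcosh x H) as [-> ->]. field. Qed.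

Lemma arcosh_pos (x : R) : 1 < x -> 0 < arcosh x.
Proof.
  intros H. unfold arcosh. rewrite <- ln_1. apply ln_increasing; [lra|].
  pose proof (sqrt_pos (x ^ 2 - 1)). lra.
Qed.

Lemma cosh_gt_1 (x : R) : 0 < x -> 1 < cosh x.
Proof. intros H. rewrite <- cosh_0. apply cosh_increasing; lra. Qed.

Lemma arcosh_cosh (x : R) : 0 < x -> arcosh (cosh x) = x.
Proof.
  intros H. unfold arcosh.
  replace (cosh x ^ 2 - 1) with (sinh x ^ 2) by (pose proof (cosh_sinh_1 x); lra).
  rewrite sqrt_pow2 by (apply Rlt_le; now apply sinh_pos).
  replace (cosh x + sinh x) with (exp x) by (unfold cosh, sinh; field).
  apply ln_exp.
Qed.

Lemma is_derive_arcosh (x : R) : 1 < x -> is_derive arcosh x (- 1 / (-1 * sinh (arcosh x))).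
Proof.
  intros H. rewrite sinh_arcosh by easy.
  assert (H0 : 0 < x ^ 2 - 1) by nra.
  pose proof (sqrt_lt_R0 _ H0) as Hs.
  unfold arcosh. auto_derive.
  - pose proof (sqrt_pos (x * (x * 1) + - (1))). simpl in H0. repeat split; lra.
  - replace (x * (x * 1) + - (1)) with (x ^ 2 - 1) by ring. field. split; lra.
Qed.

Lemma IVT_open (h : R -> R) (a b : R) :
  (forall x, ex_derive h x) -> a < b -> h a < 0 -> 0 < h b ->
  exists x, a < x < b /\ h x = 0.
Proof.
  intros Hc Hab Ha Hb.
  destruct (IVT h a b) as [x [Hx E]]; try easy.
  - intros x. apply continuity_pt_filterlim. now apply (ex_derive_continuous h).
  - exists x. split; [|exact E].
    destruct Hx as [[Hx1|Hx1] [Hx2|Hx2]]; subst; lra.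
Qed.

Lemma locally_forall_ix (P : ix -> R3 -> Prop) (l : R3) :
  (forall i, locally l (P i)) -> locally l (fun x => forall i, P i x).
Proof.
  intros H. generalize (filter_and _ _ (H i1) (filter_and _ _ (H i2) (H i3))).
  apply filter_imp. intros x (H1 & H2 & H3) i. destruct i; easy.
Qed.

Lemma co_continuous (i : ix) (l : R3) : continuous (co i) l.
Proof. exact (diff3_continuous _ _ _ (diff3_co i l)). Qed.

Lemma locally_triangle (l : R3) :
  (forall i, 0 < co i l /\ co i l < co (nxt i) l + co (prv i) l) ->
  locally l (fun x => forall i, 0 < co i x /\ co i x < co (nxt i) x + co (prv i) x).
Proof.
  intros H. apply locally_forall_ix. intros i. destruct (H i) as [H1 H2].
  apply filter_and; [exact (continuous_gt _ _ (co_continuous i l) H1)|].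
  apply (filter_imp (fun x => 0 < (co (nxt i) x + co (prv i) x) - co i x)); [intros x Hx; lra|].
  apply continuous_gt; [|lra].
  eapply diff3_continuous. apply diff3_minus; [apply diff3_plus|]; apply diff3_co.
Qed.

Lemma triangle_intro (a b c : R) :
  0 < a -> 0 < b -> 0 < c -> a < b + c -> b < c + a -> c < a + b ->
  forall i, 0 < co i (a, b, c) /\
    co i (a, b, c) < co (nxt i) (a, b, c) + co (prv i) (a, b, c).
Proof. intros. destruct i; simpl; lra. Qed.

Lemma cos_ra_1 (x : R) : cos x ^ 2 + 1 * sin x ^ 2 = 1.
Proof. pose proof (sin2_cos2 x) as E. rewrite !Rsqr_pow2 in E. lra. Qed.

Lemma is_derive_cos_eps (x : R) : is_derive cos x (- (1) * sin x).
Proof. eapply is_derive_eq; [apply is_derive_cos|]. ring. Qed.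

Lemma is_derive_cosh_eps (x : R) : is_derive cosh x (- (-1) * sinh x).
Proof. eapply is_derive_eq; [apply is_derive_cosh|]. ring. Qed.

Lemma cosh_ra_1 (x : R) : cosh x ^ 2 + (-1) * sinh x ^ 2 = 1.
Proof. pose proof (cosh_sinh_1 x). lra. Qed.

(** * Spherical triangles *)

Lemma S2_zero_pi (l : R3) (i : ix) : S2_lengths l -> zero_pi (co i l).
Proof.
  intros [H Hp]. pose proof (H i1). pose proof (H i2). pose proof (H i3).
  unfold zero_pi. destruct i; simpl in *; lra.
Qed.

(** Equivalent to cos(b + c) < cos a < cos(b - c), which holds by the triangle inequalities. If b +
    c exceeds PI, the perimeter bound enters through cos(b + c) = cos(2 PI - b - c). *)
Lemma S2_ratio (l : R3) (i : ix) : S2_lengths l ->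
  -1 < (cos (co i l) - cos (co (nxt i) l) * cos (co (prv i) l))
       / (sin (co (nxt i) l) * sin (co (prv i) l)) < 1.
Proof.
  intros Hl. pose proof (S2_zero_pi l i Hl) as Ha. pose proof (S2_zero_pi l (nxt i) Hl) as Hb.
  pose proof (S2_zero_pi l (prv i) Hl) as Hc. destruct Hl as [H Hp].
  assert (Hs : co i l + co (nxt i) l + co (prv i) l < 2 * PI) by (destruct i; simpl in *; lra).
  pose proof (proj2 (H i)) as T1. pose proof (proj2 (H (nxt i))) as T2.
  pose proof (proj2 (H (prv i))) as T3.
  replace (nxt (nxt i)) with (prv i) in * by now destruct i.
  replace (nxt (prv i)) with i in * by now destruct i.
  replace (prv (prv i)) with (nxt i) in * by now destruct i.
  replace (prv (nxt i)) with i in * by now destruct i.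
  set (a := co i l) in *. set (b := co (nxt i) l) in *. set (c := co (prv i) l) in *.
  unfold zero_pi in *.
  assert (P : 0 < sin b * sin c) by (apply Rmult_lt_0_compat; apply sin_gt_0; lra).
  assert (L1 : cos a < cos (b - c)).
  { destruct (Rle_dec c b).
    - apply cos_decreasing_1; lra.
    - rewrite <- (cos_neg (b - c)), Ropp_minus_distr. apply cos_decreasing_1; lra. }
  assert (L2 : cos (b + c) < cos a).
  { destruct (Rle_dec (b + c) PI).
    - apply cos_decreasing_1; lra.
    - replace (cos (b + c)) with (cos (2 * PI - (b + c))).
      + apply cos_decreasing_1; lra.
      + rewrite cos_minus, cos_2PI, sin_2PI. ring. }
  rewrite cos_minus in L1. rewrite cos_plus in L2.
  split; [apply Rlt_div_r|apply Rlt_div_l]; try easy; lra.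
Qed.

Lemma S2_ang (l : R3) (i : ix) : S2_lengths l -> zero_pi (S2_angle i l).
Proof. intros H. now apply acos_bound_lt, S2_ratio. Qed.

Lemma S2_angle_intro (a b c alpha : R) :
  zero_pi alpha -> zero_pi b -> zero_pi c ->
  cos b * cos c + cos alpha * (sin b * sin c) - cos a = 0 ->
  S2_angle i1 (a, b, c) = alpha.
Proof.
  intros Ha [Hb1 Hb2] [Hc1 Hc2] E. unfold S2_angle; simpl.
  pose proof (sin_gt_0 b Hb1 Hb2). pose proof (sin_gt_0 c Hc1 Hc2).
  replace ((cos a - cos b * cos c) / (sin b * sin c)) with (cos alpha).
  - apply acos_cos. unfold zero_pi in Ha. lra.
  - replace (cos a) with (cos b * cos c + cos alpha * (sin b * sin c)) by lra. field. lra.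
Qed.

Lemma cos_between (alpha : R) : zero_pi alpha -> -1 < cos alpha < 1.
Proof.
  intros [H1 H2]. split.
  - rewrite <- cos_PI. apply cos_decreasing_1; lra.
  - rewrite <- cos_0. apply cos_decreasing_1; lra.
Qed.

(** For a short second side x, let the third side run from a - x to a + x: the triangle degenerates
    at both ends, where the angle opposite to a is PI and 0, so every alpha occurs in between. The
    triangle with angle beta is isosceles with small legs. *)
Lemma S2_linked (a alpha beta : R) : zero_pi a -> zero_pi alpha -> zero_pi beta ->
  exists l, S2_lengths l /\ S2_angle i1 l = beta /\
    forall j, j = i1 \/ j = i2 ->
      exists m, S2_lengths m /\ co i1 m = a /\ S2_angle i1 m = alpha /\ co i2 m = co j l.
Proof.
  intros Ha Halpha Hbeta.
  pose proof (cos_between _ Halpha) as Ca. pose proof (cos_between _ Hbeta) as Cb.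
  assert (K : forall x, 0 < x -> x < a -> x < PI - a -> exists m, S2_lengths m /\
      co i1 m = a /\ S2_angle i1 m = alpha /\ co i2 m = x).
  { intros x Hx1 Hx2 Hx3. unfold zero_pi in Ha.
    assert (Sx : 0 < sin x) by (apply sin_gt_0; lra).
    destruct (IVT_open (fun y => - (cos x * cos y + cos alpha * (sin x * sin y) - cos a)) (a - x) (a + x))
      as [y [Hy E]].
    - intros y. auto_derive. easy.
    - lra.
    - assert (0 < sin (a - x)) by (apply sin_gt_0; lra).
      replace (cos a) with (cos (x + (a - x))) by (f_equal; ring). rewrite (cos_plus x).
      assert (0 < sin x * sin (a - x)) by now apply Rmult_lt_0_compat.
      nra.
    - assert (0 < sin (a + x)) by (apply sin_gt_0; lra).
      replace (cos a) with (cos ((a + x) - x)) by (f_equal; ring). rewrite (cos_minus (a + x)).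
      assert (0 < sin x * sin (a + x)) by now apply Rmult_lt_0_compat.
      nra.
    - exists (a, x, y). repeat split; try (simpl; lra).
      + destruct i; simpl; lra.
      + destruct i; simpl; lra.
      + apply S2_angle_intro; unfold zero_pi; try easy; lra. }
  (* Half the bound that [K] needs, so that both the legs d and the base, which is shorter than 2 d,
     satisfy it. *)
  set (d := Rmin a (PI - a) / 2).
  assert (Hd : 0 < d /\ 2 * d <= a /\ 2 * d <= PI - a).
  { unfold zero_pi in Ha. unfold d, Rmin. destruct Rle_dec; lra. }
  assert (Sd : 0 < sin d) by (apply sin_gt_0; unfold zero_pi in Ha; lra).
  assert (Sdd : 0 < sin d * sin d) by now apply Rmult_lt_0_compat.
  destruct (IVT_open (fun y => cos d * cos d + cos beta * (sin d * sin d) - cos y) 0 (2 * d))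
    as [y [Hy E]].
  - intros y. auto_derive. easy.
  - lra.
  - rewrite cos_0. pose proof (cos_ra_1 d). nra.
  - replace (2 * d) with (d + d) by ring. rewrite cos_plus. nra.
  - unfold zero_pi in Ha. exists (y, d, d). split; [|split].
    + split; [apply triangle_intro; lra|simpl; lra].
    + apply S2_angle_intro; unfold zero_pi; try easy; lra.
    + intros j [->| ->]; simpl; apply K; lra.
Qed.

Lemma S2_two_lengths (x y : R) : zero_pi x -> zero_pi y ->
  exists l, S2_lengths l /\ co i1 l = x /\ co i2 l = y.
Proof.
  intros [Hx1 Hx2] [Hy1 Hy2].
  (* The third length is the midpoint of the admissible interval from |x - y| to min(x + y, 2 PI - x
     - y). *)
  exists (x, y, (Rmax (x - y) (y - x) + Rmin (x + y) (2 * PI - x - y)) / 2).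
  split; [|easy]. split.
  - apply triangle_intro; unfold Rmax, Rmin; destruct (Rle_dec (x - y) (y - x)), (Rle_dec (x + y) (2 * PI - x - y)); lra.
  - simpl. unfold Rmax, Rmin; destruct (Rle_dec (x - y) (y - x)), (Rle_dec (x + y) (2 * PI - x - y)); lra.
Qed.

Lemma S2_open (l : R3) : S2_lengths l -> locally l S2_lengths.
Proof.
  intros [H Hp]. apply filter_and; [now apply locally_triangle|].
  apply (filter_imp (fun x => 0 < 2 * PI - (co i1 x + co i2 x + co i3 x))); [intros x Hx; lra|].
  apply (continuous_gt (fun x => 2 * PI - (co i1 x + co i2 x + co i3 x))); [|lra].
  eapply diff3_continuous. apply diff3_minus; [apply diff3_const|].
  apply diff3_plus; [apply diff3_plus|]; apply diff3_co.
Qed.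

(** The factors 1 spell out e k and k, so that the angle has literally the shape required by section
    [CosineLaw]. *)
Lemma S2_angle_eq (i : ix) (x : R3) : S2_angle i x = acos
  ((1 * 1 * cos (co i x) - 1 * cos (co (nxt i) x) * cos (co (prv i) x))
   / (sin (co (nxt i) x) * sin (co (prv i) x))).
Proof. unfold S2_angle. apply f_equal. apply (f_equal2 Rdiv); ring. Qed.

Lemma S2_ratio_eq (l : R3) (i : ix) : S2_lengths l ->
  -1 < (1 * 1 * cos (co i l) - 1 * cos (co (nxt i) l) * cos (co (prv i) l))
       / (sin (co (nxt i) l) * sin (co (prv i) l)) < 1.
Proof. intros H. rewrite !Rmult_1_l. now apply S2_ratio. Qed.

Lemma sin_zero_pi (x : R) : zero_pi x -> 0 < sin x.
Proof. intros [H1 H2]. now apply sin_gt_0. Qed.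

Definition S2_geometry : geometry.
Proof.
  assert (c1 : (1 : R) ^ 2 = 1) by ring.
  assert (Hs : forall l, S2_lengths l -> forall i, 0 < sin (co i l))
    by (intros; now apply sin_zero_pi, S2_zero_pi).
  assert (Hr : forall l, S2_lengths l -> forall i, 0 < sin (S2_angle i l))
    by (intros; now apply sin_zero_pi, S2_ang).
  assert (Harc : forall l, S2_lengths l -> forall i, cos (S2_angle i l) =
     (1 * 1 * cos (co i l) - 1 * cos (co (nxt i) l) * cos (co (prv i) l))
       / (sin (co (nxt i) l) * sin (co (prv i) l))).
  { intros l Hl i. rewrite S2_angle_eq, cos_acos; [easy|].
    pose proof (S2_ratio_eq l i Hl). lra. }
  assert (Harc' : forall l, S2_lengths l -> forall i, is_derive acos
     ((1 * 1 * cos (co i l) - 1 * cos (co (nxt i) l) * cos (co (prv i) l))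
       / (sin (co (nxt i) l) * sin (co (prv i) l))) (- 1 / (1 * sin (S2_angle i l)))).
  { intros l Hl i. rewrite S2_angle_eq. now apply is_derive_acos_sin, S2_ratio_eq. }
  refine {| dom := S2_lengths; ang := S2_angle; Ia := zero_pi; Il := zero_pi;
    ra := sin; ca := cos; sl := sin; cl := cos; eps := 1; kap := 1;
    eps_neq0 := R1_neq_R0; dom_open := S2_open;
    Ia_interval := is_open_interval_zero_pi; Il_interval := is_open_interval_zero_pi;
    dom_len := S2_zero_pi; dom_ang := S2_ang;
    ra_pos := sin_zero_pi; sl_pos := sin_zero_pi;
    ra_derive := is_derive_sin; ca_derive := is_derive_cos_eps;
    sl_derive := is_derive_sin; cl_derive := is_derive_cos_eps;
    ca_ra_1 := cos_ra_1; two_lengths := S2_two_lengths; linked := S2_linked |}.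
  - intros l i Hl. exact (cosine_law_sine_law S2_angle sin cos sin cos 1 1 l c1 c1
      cos_ra_1 cos_ra_1 (Hs l Hl) (Hr l Hl) (Harc l Hl) i).
  - intros l i Hl. exact (cosine_law_dual S2_angle sin cos sin cos 1 1 l c1 c1
      cos_ra_1 cos_ra_1 (Hs l Hl) (Hr l Hl) (Harc l Hl) i).
  - intros l i Hl. exact (cosine_law_diff3 S2_angle acos sin cos sin cos 1 1 l c1 c1
      S2_angle_eq cos_ra_1 cos_ra_1 is_derive_sin is_derive_cos_eps
      (Hs l Hl) (Hr l Hl) (Harc l Hl) (Harc' l Hl) i).
  - exists (PI / 4). pose proof PI_RGT_0. split; [unfold zero_pi; lra|].
    apply Rgt_not_eq, cos_gt_0; lra.
Defined.

(** * Hyperbolic triangles *)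

Lemma H2_ratio (l : R3) (i : ix) : H2_lengths l ->
  -1 < (1 * -1 * cosh (co i l) - -1 * cosh (co (nxt i) l) * cosh (co (prv i) l))
       / (sinh (co (nxt i) l) * sinh (co (prv i) l)) < 1.
Proof.
  intros H. pose proof (H i) as [Ha T1]. pose proof (H (nxt i)) as [Hb T2].
  pose proof (H (prv i)) as [Hc T3].
  replace (nxt (nxt i)) with (prv i) in * by now destruct i.
  replace (nxt (prv i)) with i in * by now destruct i.
  replace (prv (prv i)) with (nxt i) in * by now destruct i.
  replace (prv (nxt i)) with i in * by now destruct i.
  set (a := co i l) in *. set (b := co (nxt i) l) in *. set (c := co (prv i) l) in *.
  assert (P : 0 < sinh b * sinh c) by (apply Rmult_lt_0_compat; now apply sinh_pos).
  assert (L1 : cosh (b - c) < cosh a).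
  { destruct (Rle_dec c b).
    - apply cosh_increasing; lra.
    - rewrite <- (cosh_opp (b - c)), Ropp_minus_distr. apply cosh_increasing; lra. }
  assert (L2 : cosh a < cosh (b + c)) by (apply cosh_increasing; lra).
  rewrite cosh_minus in L1. rewrite cosh_plus in L2.
  split; [apply Rlt_div_r|apply Rlt_div_l]; try easy; lra.
Qed.

Lemma H2_angle_eq (i : ix) (x : R3) : H2_angle i x = acos
  ((1 * -1 * cosh (co i x) - -1 * cosh (co (nxt i) x) * cosh (co (prv i) x))
   / (sinh (co (nxt i) x) * sinh (co (prv i) x))).
Proof. unfold H2_angle. apply f_equal. apply (f_equal2 Rdiv); ring. Qed.

Lemma H2_ang (l : R3) (i : ix) : H2_lengths l -> zero_pi (H2_angle i l).
Proof. intros H. rewrite H2_angle_eq. now apply acos_bound_lt, H2_ratio. Qed.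

Lemma H2_angle_intro (a b c alpha : R) :
  zero_pi alpha -> 0 < b -> 0 < c ->
  cosh a - cosh b * cosh c + cos alpha * (sinh b * sinh c) = 0 ->
  H2_angle i1 (a, b, c) = alpha.
Proof.
  intros Ha Hb Hc E. unfold H2_angle; simpl.
  pose proof (sinh_pos b Hb). pose proof (sinh_pos c Hc).
  replace ((cosh b * cosh c - cosh a) / (sinh b * sinh c)) with (cos alpha).
  - apply acos_cos. unfold zero_pi in Ha. lra.
  - replace (cosh a) with (cosh b * cosh c - cos alpha * (sinh b * sinh c)) by lra. field. lra.
Qed.

Lemma H2_linked (a alpha beta : R) : pos_real a -> zero_pi alpha -> zero_pi beta ->
  exists l, H2_lengths l /\ H2_angle i1 l = beta /\
    forall j, j = i1 \/ j = i2 ->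
      exists m, H2_lengths m /\ co i1 m = a /\ H2_angle i1 m = alpha /\ co i2 m = co j l.
Proof.
  unfold pos_real. intros Ha Halpha Hbeta.
  pose proof (cos_between _ Halpha) as Ca. pose proof (cos_between _ Hbeta) as Cb.
  assert (Dc : forall x u v, ex_derive (fun y => u - v * cosh y) x).
  { intros x u v. eexists. apply (is_derive_minus (V := R_NormedModule)).
    - apply is_derive_const.
    - apply is_derive_scal, is_derive_cosh. }
  assert (K : forall x, 0 < x -> x < a -> exists m, H2_lengths m /\
      co i1 m = a /\ H2_angle i1 m = alpha /\ co i2 m = x).
  { intros x Hx1 Hx2.
    pose proof (sinh_pos x Hx1) as Sx.
    destruct (IVT_open (fun y => - (cosh a - cosh x * cosh y + (cos alpha * sinh x) * sinh y)) (a - x) (a + x))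
      as [y [Hy E]].
    - intros y. eexists. apply (is_derive_opp (V := R_NormedModule)).
      apply (is_derive_plus (V := R_NormedModule)).
      + apply Derive_correct, Dc.
      + apply is_derive_scal, is_derive_sinh.
    - lra.
    - pose proof (sinh_pos (a - x)) as S.
      replace (cosh a) with (cosh (x + (a - x))) by (f_equal; ring). rewrite (cosh_plus x).
      assert (0 < sinh x * sinh (a - x)) by (apply Rmult_lt_0_compat; lra).
      nra.
    - pose proof (sinh_pos (a + x)) as S.
      replace (cosh a) with (cosh ((a + x) - x)) by (f_equal; ring). rewrite (cosh_minus (a + x)).
      assert (0 < sinh x * sinh (a + x)) by (apply Rmult_lt_0_compat; lra).
      nra.
    - exists (a, x, y). repeat split; try (simpl; lra).
      + destruct i; simpl; lra.
      + destruct i; simpl; lra.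
      + apply H2_angle_intro; try easy; lra. }
  (* [K] now asks only for x < a, and the base of the isosceles triangle is shorter than 2 d = a. *)
  set (d := a / 2). assert (Hd : 0 < d) by (unfold d; lra).
  pose proof (sinh_pos d Hd) as Sd.
  assert (Sdd : 0 < sinh d * sinh d) by now apply Rmult_lt_0_compat.
  destruct (IVT_open (fun y => - (cosh d * cosh d - cos beta * (sinh d * sinh d)) - - 1 * cosh y) 0 (2 * d))
    as [y [Hy E]].
  - intros y. apply Dc.
  - lra.
  - rewrite cosh_0. pose proof (cosh_sinh_1 d). nra.
  - replace (2 * d) with (d + d) by ring. rewrite cosh_plus. nra.
  - exists (y, d, d). split; [|split].
    + intros i. apply triangle_intro; lra.
    + apply H2_angle_intro; try easy; lra.
    + unfold d in *. intros j [->| ->]; simpl; apply K; lra.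
Qed.

Lemma triangle_two_lengths (x y : R) : pos_real x -> pos_real y ->
  exists l, H2_lengths l /\ co i1 l = x /\ co i2 l = y.
Proof.
  unfold pos_real. intros Hx Hy. exists (x, y, Rmax x y). split; [|easy].
  intros i. apply triangle_intro; unfold Rmax; destruct (Rle_dec x y); lra.
Qed.

Definition H2_geometry : geometry.
Proof.
  assert (c1 : (1 : R) ^ 2 = 1) by ring.
  assert (c2 : (-1 : R) ^ 2 = 1) by ring.
  assert (Hl0 : forall l i, H2_lengths l -> pos_real (co i l)) by (intros l i H; apply H).
  assert (Hs : forall l, H2_lengths l -> forall i, 0 < sinh (co i l))
    by (intros l Hl i; apply sinh_pos; now apply Hl0).
  assert (Hr : forall l, H2_lengths l -> forall i, 0 < sin (H2_angle i l))
    by (intros; now apply sin_zero_pi, H2_ang).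
  assert (Harc : forall l, H2_lengths l -> forall i, cos (H2_angle i l) =
     (1 * -1 * cosh (co i l) - -1 * cosh (co (nxt i) l) * cosh (co (prv i) l))
       / (sinh (co (nxt i) l) * sinh (co (prv i) l))).
  { intros l Hl i. rewrite H2_angle_eq, cos_acos; [easy|].
    pose proof (H2_ratio l i Hl). lra. }
  assert (Harc' : forall l, H2_lengths l -> forall i, is_derive acos
     ((1 * -1 * cosh (co i l) - -1 * cosh (co (nxt i) l) * cosh (co (prv i) l))
       / (sinh (co (nxt i) l) * sinh (co (prv i) l))) (- 1 / (1 * sin (H2_angle i l)))).
  { intros l Hl i. rewrite H2_angle_eq. now apply is_derive_acos_sin, H2_ratio. }
  refine {| dom := H2_lengths; ang := H2_angle; Ia := zero_pi; Il := pos_real;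
    ra := sin; ca := cos; sl := sinh; cl := cosh; eps := 1; kap := -1;
    eps_neq0 := R1_neq_R0; dom_open := locally_triangle;
    Ia_interval := is_open_interval_zero_pi; Il_interval := is_open_interval_pos_real;
    dom_len := Hl0; dom_ang := H2_ang;
    ra_pos := sin_zero_pi; sl_pos := sinh_pos;
    ra_derive := is_derive_sin; ca_derive := is_derive_cos_eps;
    sl_derive := is_derive_sinh; cl_derive := is_derive_cosh_eps;
    ca_ra_1 := cos_ra_1; two_lengths := triangle_two_lengths; linked := H2_linked |}.
  - intros l i Hl. exact (cosine_law_sine_law H2_angle sin cos sinh cosh 1 (-1) l c1 c2
      cos_ra_1 cosh_ra_1 (Hs l Hl) (Hr l Hl) (Harc l Hl) i).
  - intros l i Hl. exact (cosine_law_dual H2_angle sin cos sinh cosh 1 (-1) l c1 c2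
      cos_ra_1 cosh_ra_1 (Hs l Hl) (Hr l Hl) (Harc l Hl) i).
  - intros l i Hl. exact (cosine_law_diff3 H2_angle acos sin cos sinh cosh 1 (-1) l c1 c2
      H2_angle_eq cos_ra_1 cosh_ra_1 is_derive_sinh is_derive_cosh_eps
      (Hs l Hl) (Hr l Hl) (Harc l Hl) (Harc' l Hl) i).
  - exists 1. split; [unfold pos_real; lra|]. pose proof (cosh_ge_1 1). lra.
Defined.

(** * Right-angled hexagons *)

(** Numerator minus denominator is cosh a + cosh(b - c), which is positive. *)
Lemma hexagon_ratio (l : R3) (i : ix) : hexagon_lengths l ->
  1 < (-1 * -1 * cosh (co i l) - -1 * cosh (co (nxt i) l) * cosh (co (prv i) l))
       / (sinh (co (nxt i) l) * sinh (co (prv i) l)).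
Proof.
  intros H. pose proof (sinh_pos _ (H (nxt i))) as Sb. pose proof (sinh_pos _ (H (prv i))) as Sc.
  pose proof (cosh_ge_1 (co i l)) as Ca.
  assert (P : 0 < sinh (co (nxt i) l) * sinh (co (prv i) l)) by now apply Rmult_lt_0_compat.
  pose proof (cosh_ge_1 (co (nxt i) l - co (prv i) l)) as M. rewrite cosh_minus in M.
  apply Rlt_div_r; [easy|]. lra.
Qed.

Lemma hexagon_angle_eq (i : ix) (x : R3) : hexagon_angle i x = arcosh
  ((-1 * -1 * cosh (co i x) - -1 * cosh (co (nxt i) x) * cosh (co (prv i) x))
   / (sinh (co (nxt i) x) * sinh (co (prv i) x))).
Proof. unfold hexagon_angle. apply f_equal. apply (f_equal2 Rdiv); ring. Qed.

Lemma hexagon_ang (l : R3) (i : ix) : hexagon_lengths l -> pos_real (hexagon_angle i l).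
Proof. intros H. rewrite hexagon_angle_eq. now apply arcosh_pos, hexagon_ratio. Qed.

Lemma hexagon_angle_intro (a b c alpha : R) :
  0 < alpha -> 0 < b -> 0 < c ->
  cosh alpha * (sinh b * sinh c) = cosh a + cosh b * cosh c ->
  hexagon_angle i1 (a, b, c) = alpha.
Proof.
  intros Ha Hb Hc E. unfold hexagon_angle; simpl.
  pose proof (sinh_pos b Hb). pose proof (sinh_pos c Hc).
  rewrite <- E. replace (_ / _) with (cosh alpha) by (field; lra).
  now apply arcosh_cosh.
Qed.

Lemma sinh_ge_id (x : R) : 0 <= x -> x <= sinh x.
Proof.
  intros Hx. destruct (MVT_gen sinh 0 x cosh) as [y [_ E]].
  - intros; apply is_derive_sinh.
  - intros; apply derivable_continuous_pt, derivable_pt_sinh.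
  - rewrite sinh_0 in E. pose proof (cosh_ge_1 y). nra.
Qed.

Lemma cosh_le_sinh_1 (x : R) : 0 <= x -> cosh x <= sinh x + 1.
Proof.
  intros Hx. assert (exp (- x) <= 1).
  { rewrite <- exp_0. destruct Hx as [Hx|<-]; [|rewrite Ropp_0; lra].
    apply Rlt_le, exp_increasing. lra. }
  unfold cosh, sinh. lra.
Qed.

Lemma cosh_surjective (y : R) : 1 < y -> exists x, 0 < x /\ cosh x = y.
Proof. intros H. exists (arcosh y). split; [now apply arcosh_pos|now apply cosh_arcosh]. Qed.

(** Here the linking lengths are taken large instead of small: a given a and alpha can be completed
    by every second length beyond a bound M, and an isosceles hexagon with large legs has all its
    lengths beyond M. *)
Lemma hexagon_linked (a alpha beta : R) : pos_real a -> pos_real alpha -> pos_real beta ->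
  exists l, hexagon_lengths l /\ hexagon_angle i1 l = beta /\
    forall j, j = i1 \/ j = i2 ->
      exists m, hexagon_lengths m /\ co i1 m = a /\ hexagon_angle i1 m = alpha /\ co i2 m = co j l.
Proof.
  unfold pos_real. intros Ha Halpha Hbeta.
  pose proof (cosh_gt_1 _ Halpha) as Ca. pose proof (cosh_gt_1 _ Hbeta) as Cb.
  (* From sinh x >= x > M and cosh x <= sinh x + 1 follows cosh alpha sinh x - cosh x >= (cosh alpha
     - 1) sinh x - 1 > 0, the growth rate needed in [K]. *)
  set (M := 1 / (cosh alpha - 1)).
  assert (HM : 0 < M) by (apply Rdiv_lt_0_compat; lra).
  assert (EM : M * (cosh alpha - 1) = 1) by (unfold M; field; lra).
  assert (K : forall x, M < x -> exists m, hexagon_lengths m /\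
      co i1 m = a /\ hexagon_angle i1 m = alpha /\ co i2 m = x).
  { intros x Hx. assert (Hx0 : 0 < x) by lra.
    pose proof (sinh_pos x Hx0) as Sx. pose proof (cosh_ge_1 x) as Cx.
    assert (Kx : 0 < cosh alpha * sinh x - cosh x).
    { pose proof (sinh_ge_id x). pose proof (cosh_le_sinh_1 x). nra. }
    pose proof (cosh_ge_1 a) as Ca1.
    (* Chosen so that the lower bound sinh b >= b already makes the function at least 1 at b. *)
    set (b := (cosh a + cosh x + 1) / (cosh alpha * sinh x - cosh x)).
    assert (Hb : 0 < b) by (apply Rdiv_lt_0_compat; lra).
    destruct (IVT_open (fun y => (cosh alpha * sinh x) * sinh y + (- cosh a - cosh x * cosh y)) 0 b)
      as [y [Hy E]].
    - intros y. eexists. apply (is_derive_plus (V := R_NormedModule)).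
      + apply is_derive_scal, is_derive_sinh.
      + apply (is_derive_minus (V := R_NormedModule)).
        * apply is_derive_const.
        * apply is_derive_scal, is_derive_cosh.
    - easy.
    - rewrite sinh_0, cosh_0. lra.
    - pose proof (sinh_ge_id b). pose proof (cosh_le_sinh_1 b).
      assert (Eb : b * (cosh alpha * sinh x - cosh x) = cosh a + cosh x + 1) by (unfold b; field; lra).
      assert (b * (cosh alpha * sinh x - cosh x) <= sinh b * (cosh alpha * sinh x - cosh x))
        by (apply Rmult_le_compat_r; lra).
      assert (cosh x * cosh b <= cosh x * (sinh b + 1)) by (apply Rmult_le_compat_l; lra).
      lra.
    - exists (a, x, y). split; [|split; [easy|split; [|easy]]].
      + intros i. destruct i; simpl; lra.
      + apply hexagon_angle_intro; try easy; lra. }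
  (* The base must satisfy cosh y = (cosh beta - 1) sinh(d)^2 - 1 > cosh(M + 1), which gives y > M.
     It suffices that d >= N and (cosh beta - 1) d >= N; the two summands of d ensure one each. *)
  set (N := M + cosh (M + 1) + 2).
  set (d := N + N / (cosh beta - 1)).
  pose proof (cosh_ge_1 (M + 1)) as CM.
  assert (HN : 0 < N) by (unfold N; lra).
  assert (0 < N / (cosh beta - 1)) by (apply Rdiv_lt_0_compat; lra).
  assert (Hd : 0 < d) by (unfold d; lra).
  assert (Hd1 : N <= (cosh beta - 1) * d).
  { unfold d. rewrite Rmult_plus_distr_l.
    replace ((cosh beta - 1) * (N / (cosh beta - 1))) with N by (field; lra).
    assert (0 < (cosh beta - 1) * N) by (apply Rmult_lt_0_compat; lra). lra. }
  pose proof (sinh_ge_id d) as Sd. pose proof (cosh_sinh_1 d) as Cd.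
  assert (Hbig : cosh (M + 1) < cosh beta * (sinh d * sinh d) - cosh d * cosh d).
  { assert (N <= (cosh beta - 1) * sinh d) by
      (apply Rle_trans with (1 := Hd1), Rmult_le_compat_l; lra).
    assert (N <= d) by (unfold d; lra). assert (2 <= N) by (unfold N; lra).
    assert (1 <= sinh d) by lra.
    assert (N <= (cosh beta - 1) * sinh d * sinh d).
    { apply Rle_trans with ((cosh beta - 1) * sinh d * 1); [lra|].
      apply Rmult_le_compat_l; lra. }
    unfold N in *. lra. }
  destruct (cosh_surjective (cosh beta * (sinh d * sinh d) - cosh d * cosh d)) as [y [Hy E]]; [lra|].
  assert (My : M < y).
  { destruct (Rlt_dec M y) as [|Hn]; [easy|]. exfalso.
    assert (cosh y < cosh (M + 1)) by (apply cosh_increasing; lra). lra. }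
  exists (y, d, d). split; [|split].
  - intros i. destruct i; simpl; lra.
  - apply hexagon_angle_intro; try easy; lra.
  - intros j [->| ->]; simpl; apply K; [easy|].
    assert (N <= d) by (unfold d; lra). assert (M < N) by (unfold N; lra). lra.
Qed.

Lemma hexagon_two_lengths (x y : R) : pos_real x -> pos_real y ->
  exists l, hexagon_lengths l /\ co i1 l = x /\ co i2 l = y.
Proof.
  intros Hx Hy. exists (x, y, 1). split; [|easy].
  intros i. destruct i; simpl; unfold pos_real in *; lra.
Qed.

Lemma hexagon_open (l : R3) : hexagon_lengths l -> locally l hexagon_lengths.
Proof.
  intros H. apply locally_forall_ix. intros i.
  exact (continuous_gt _ _ (co_continuous i l) (H i)).
Qed.

Definition hexagon_geometry : geometry.
Proof.
  assert (c2 : (-1 : R) ^ 2 = 1) by ring.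
  assert (n1 : (-1 : R) <> 0) by lra.
  assert (Hl0 : forall l i, hexagon_lengths l -> pos_real (co i l)) by (intros l i H; apply H).
  assert (Hs : forall l, hexagon_lengths l -> forall i, 0 < sinh (co i l))
    by (intros l Hl i; apply sinh_pos; now apply Hl0).
  assert (Hr : forall l, hexagon_lengths l -> forall i, 0 < sinh (hexagon_angle i l))
    by (intros; now apply sinh_pos, hexagon_ang).
  assert (Harc : forall l, hexagon_lengths l -> forall i, cosh (hexagon_angle i l) =
     (-1 * -1 * cosh (co i l) - -1 * cosh (co (nxt i) l) * cosh (co (prv i) l))
       / (sinh (co (nxt i) l) * sinh (co (prv i) l))).
  { intros l Hl i. rewrite hexagon_angle_eq, cosh_arcosh; [easy|].
    now apply hexagon_ratio. }
  assert (Harc' : forall l, hexagon_lengths l -> forall i, is_derive arcosh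
     ((-1 * -1 * cosh (co i l) - -1 * cosh (co (nxt i) l) * cosh (co (prv i) l))
       / (sinh (co (nxt i) l) * sinh (co (prv i) l))) (- 1 / (-1 * sinh (hexagon_angle i l)))).
  { intros l Hl i. rewrite hexagon_angle_eq. now apply is_derive_arcosh, hexagon_ratio. }
  refine {| dom := hexagon_lengths; ang := hexagon_angle; Ia := pos_real; Il := pos_real;
    ra := sinh; ca := cosh; sl := sinh; cl := cosh; eps := -1; kap := -1;
    eps_neq0 := n1; dom_open := hexagon_open;
    Ia_interval := is_open_interval_pos_real; Il_interval := is_open_interval_pos_real;
    dom_len := Hl0; dom_ang := hexagon_ang;
    ra_pos := sinh_pos; sl_pos := sinh_pos;
    ra_derive := is_derive_sinh; ca_derive := is_derive_cosh_eps;
    sl_derive := is_derive_sinh; cl_derive := is_derive_cosh_eps;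
    ca_ra_1 := cosh_ra_1; two_lengths := hexagon_two_lengths; linked := hexagon_linked |}.
  - intros l i Hl. exact (cosine_law_sine_law hexagon_angle sinh cosh sinh cosh (-1) (-1) l c2 c2
      cosh_ra_1 cosh_ra_1 (Hs l Hl) (Hr l Hl) (Harc l Hl) i).
  - intros l i Hl. exact (cosine_law_dual hexagon_angle sinh cosh sinh cosh (-1) (-1) l c2 c2
      cosh_ra_1 cosh_ra_1 (Hs l Hl) (Hr l Hl) (Harc l Hl) i).
  - intros l i Hl. exact (cosine_law_diff3 hexagon_angle arcosh sinh cosh sinh cosh (-1) (-1) l c2 c2
      hexagon_angle_eq cosh_ra_1 cosh_ra_1 is_derive_sinh is_derive_cosh_eps
      (Hs l Hl) (Hr l Hl) (Harc l Hl) (Harc' l Hl) i).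
  - exists 1. split; [unfold pos_real; lra|]. pose proof (cosh_ge_1 1). lra.
Defined.

(** * Euclidean triangles *)

Lemma E2_ratio (l : R3) (i : ix) : E2_lengths l ->
  -1 < (co (nxt i) l ^ 2 + co (prv i) l ^ 2 - co i l ^ 2)
       / (2 * co (nxt i) l * co (prv i) l) < 1.
Proof.
  intros H. pose proof (H i) as [Ha T1]. pose proof (H (nxt i)) as [Hb T2].
  pose proof (H (prv i)) as [Hc T3].
  replace (nxt (nxt i)) with (prv i) in * by now destruct i.
  replace (nxt (prv i)) with i in * by now destruct i.
  replace (prv (prv i)) with (nxt i) in * by now destruct i.
  replace (prv (nxt i)) with i in * by now destruct i.
  set (a := co i l) in *. set (b := co (nxt i) l) in *. set (c := co (prv i) l) in *.
  assert (P : 0 < 2 * b * c) by nra.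
  split; [apply Rlt_div_r|apply Rlt_div_l]; try easy; nra.
Qed.

Lemma E2_ang (l : R3) (i : ix) : E2_lengths l -> zero_pi (E2_angle i l).
Proof. intros H. now apply acos_bound_lt, E2_ratio. Qed.

Lemma E2_cosine_law (l : R3) (i : ix) : E2_lengths l ->
  cos (E2_angle i l) * co (nxt i) l * co (prv i) l
  = (co (nxt i) l ^ 2 + co (prv i) l ^ 2 - co i l ^ 2) / 2.
Proof.
  intros H. unfold E2_angle. rewrite cos_acos by (pose proof (E2_ratio l i H); lra).
  field. split; apply Rgt_not_eq, H.
Qed.

(** Heron's formula: the right-hand side is four times the squared area of the triangle. *)
Lemma E2_area_square (l : R3) (i : ix) : E2_lengths l ->
  (sin (E2_angle i l) * co (nxt i) l * co (prv i) l) ^ 2 =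
  (2 * (co i1 l ^ 2 * co i2 l ^ 2 + co i2 l ^ 2 * co i3 l ^ 2 + co i3 l ^ 2 * co i1 l ^ 2)
   - co i1 l ^ 4 - co i2 l ^ 4 - co i3 l ^ 4) / 4.
Proof.
  intros H. pose proof (cos_ra_1 (E2_angle i l)) as E.
  transitivity ((co (nxt i) l * co (prv i) l) ^ 2
     - (cos (E2_angle i l) * co (nxt i) l * co (prv i) l) ^ 2).
  - replace ((sin (E2_angle i l) * co (nxt i) l * co (prv i) l) ^ 2)
      with ((1 * sin (E2_angle i l) ^ 2) * (co (nxt i) l * co (prv i) l) ^ 2) by ring.
    replace (1 * sin (E2_angle i l) ^ 2) with (1 - cos (E2_angle i l) ^ 2) by lra. ring.
  - rewrite E2_cosine_law by easy. destruct i; simpl nxt; simpl prv; field.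
Qed.

Lemma E2_sine_law (l : R3) (i : ix) : E2_lengths l ->
  sin (E2_angle i l) * co (nxt i) l * co (prv i) l = area E2_angle sin (fun x => x) l.
Proof.
  intros H. eapply (area_of_square E2_angle sin (fun x => x)).
  - intros j. apply H.
  - intros j. now apply sin_zero_pi, E2_ang.
  - intros j. now apply E2_area_square.
Qed.

(** With C = 1 the dual cosine law is cos(theta_i) = - cos(theta_j + theta_k), the trace of the
    angle sum PI. It is derived from the cosine laws, as in the curved cases. *)
Lemma E2_dual (l : R3) (i : ix) : E2_lengths l ->
  cos (E2_angle i l) + cos (E2_angle (nxt i) l) * cos (E2_angle (prv i) l)
  = sin (E2_angle (nxt i) l) * sin (E2_angle (prv i) l) * 1.
Proof.
  intros H.
  pose proof (E2_sine_law l (nxt i) H) as A2.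
  pose proof (E2_sine_law l (prv i) H) as A3.
  pose proof (E2_cosine_law l i H) as L1. pose proof (E2_cosine_law l (nxt i) H) as L2.
  pose proof (E2_cosine_law l (prv i) H) as L3.
  pose proof (E2_area_square l i H) as A1. rewrite E2_sine_law in A1 by easy.
  replace (nxt (nxt i)) with (prv i) in * by now destruct i.
  replace (nxt (prv i)) with i in * by now destruct i.
  replace (prv (prv i)) with (nxt i) in * by now destruct i.
  replace (prv (nxt i)) with i in * by now destruct i.
  apply (dual_cosine_of_products _ _ _ _ _ (co i l) (co (nxt i) l) (co (prv i) l) _ _
    (proj1 (H i)) (proj1 (H (nxt i))) (proj1 (H (prv i))) A2 A3).
  rewrite L1, L2, L3, A1. destruct i; simpl nxt; simpl prv; field.
Qed.

Lemma E2_diff3 (l : R3) (i : ix) : E2_lengths l ->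
  diff3 (E2_angle i) l (dang E2_angle sin cos (fun x => x) i l).
Proof.
  intros H.
  pose proof (proj1 (H i)) as s1. pose proof (proj1 (H (nxt i))) as s2.
  pose proof (proj1 (H (prv i))) as s3.
  assert (r1 : 0 < sin (E2_angle i l)) by now apply sin_zero_pi, E2_ang.
  assert (D2 : forall j, diff3 (fun x => co j x ^ 2) l (fun m => 2 * co j l * kron j m)).
  { intros j. apply (diff3_comp_co (fun y => y ^ 2)). auto_derive; [easy|]. ring. }
  assert (Ha : is_derive acos ((co (nxt i) l ^ 2 + co (prv i) l ^ 2 - co i l ^ 2)
       / (2 * co (nxt i) l * co (prv i) l)) (- 1 / (1 * sin (E2_angle i l))))
    by exact (is_derive_acos_sin _ (E2_ratio l i H)).
  eapply diff3_ext_d; [|apply (diff3_comp acos); [apply diff3_div|exact Ha]].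
  2: { apply diff3_minus; [apply diff3_plus|]; apply D2. }
  2: { apply diff3_mult; [apply diff3_mult; [apply diff3_const|]|]; apply diff3_co. }
  2: { nra. }
  intros m. cbv beta. unfold dang.
  rewrite <- (E2_sine_law l i H).
  pose proof (E2_cosine_law l (nxt i) H) as L2. pose proof (E2_cosine_law l (prv i) H) as L3.
  replace (nxt (nxt i)) with (prv i) in * by now destruct i.
  replace (nxt (prv i)) with i in * by now destruct i.
  replace (prv (prv i)) with (nxt i) in * by now destruct i.
  replace (prv (nxt i)) with i in * by now destruct i.
  set (a := co i l) in *. set (b := co (nxt i) l) in *. set (c := co (prv i) l) in *.
  set (r := sin (E2_angle i l)) in *.
  set (xn := cos (E2_angle (nxt i) l)) in *. set (xp := cos (E2_angle (prv i) l)) in *.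
  (* The quotient rule leaves the fractions that the Euclidean cosine law gives for the other two
     cosines. *)
  transitivity (a / (r * b * c) * (kron i m
     - (a ^ 2 + b ^ 2 - c ^ 2) / 2 / (a * b) * kron (nxt i) m
     - (c ^ 2 + a ^ 2 - b ^ 2) / 2 / (c * a) * kron (prv i) m)).
  - field. repeat split; lra.
  - rewrite <- L2, <- L3. field. repeat split; lra.
Qed.

Lemma E2_angle_intro (a b c alpha : R) :
  zero_pi alpha -> 0 < b -> 0 < c ->
  b ^ 2 + c ^ 2 - a ^ 2 - 2 * b * c * cos alpha = 0 ->
  E2_angle i1 (a, b, c) = alpha.
Proof.
  intros Ha Hb Hc E. unfold E2_angle; simpl co; simpl nxt; simpl prv.
  replace (b ^ 2 + c ^ 2 - a ^ 2) with (2 * b * c * cos alpha) by lra.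
  replace (_ / _) with (cos alpha) by (field; lra).
  apply acos_cos. unfold zero_pi in Ha. lra.
Qed.

Lemma E2_linked (a alpha beta : R) : pos_real a -> zero_pi alpha -> zero_pi beta ->
  exists l, E2_lengths l /\ E2_angle i1 l = beta /\
    forall j, j = i1 \/ j = i2 ->
      exists m, E2_lengths m /\ co i1 m = a /\ E2_angle i1 m = alpha /\ co i2 m = co j l.
Proof.
  unfold pos_real. intros Ha Halpha Hbeta.
  pose proof (cos_between _ Halpha) as Ca. pose proof (cos_between _ Hbeta) as Cb.
  assert (K : forall x, 0 < x -> x < a -> exists m, E2_lengths m /\
      co i1 m = a /\ E2_angle i1 m = alpha /\ co i2 m = x).
  { intros x Hx1 Hx2.
    destruct (IVT_open (fun y => x ^ 2 + y ^ 2 - a ^ 2 - 2 * x * y * cos alpha) (a - x) (a + x))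
      as [y [Hy E]].
    - intros y. auto_derive. easy.
    - lra.
    - assert (0 < x * (a - x)) by nra. nra.
    - assert (0 < x * (a + x)) by nra. nra.
    - exists (a, x, y). repeat split; try (simpl; lra).
      + destruct i; simpl; lra.
      + destruct i; simpl; lra.
      + apply E2_angle_intro; try easy; lra. }
  set (d := a / 2). assert (Hd : 0 < d) by (unfold d; lra).
  destruct (IVT_open (fun y => - (d ^ 2 + d ^ 2 - y ^ 2 - 2 * d * d * cos beta)) 0 (2 * d))
    as [y [Hy E]].
  - intros y. auto_derive. easy.
  - lra.
  - assert (0 < d * d) by nra. nra.
  - assert (0 < d * d) by nra. nra.
  - exists (y, d, d). split; [|split].
    + intros i. apply triangle_intro; lra.
    + apply E2_angle_intro; try easy; lra.
    + unfold d in *. intros j [->| ->]; simpl; apply K; lra.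
Qed.

Definition E2_geometry : geometry.
Proof.
  assert (Hl0 : forall l i, E2_lengths l -> pos_real (co i l)) by (intros l i H; apply H).
  refine {| dom := E2_lengths; ang := E2_angle; Ia := zero_pi; Il := pos_real;
    ra := sin; ca := cos; sl := (fun x => x); cl := (fun _ => 1); eps := 1; kap := 0;
    eps_neq0 := R1_neq_R0; dom_open := locally_triangle;
    Ia_interval := is_open_interval_zero_pi; Il_interval := is_open_interval_pos_real;
    dom_len := Hl0; dom_ang := E2_ang;
    ra_pos := sin_zero_pi; sl_pos := (fun _ H => H);
    ra_derive := is_derive_sin; ca_derive := is_derive_cos_eps;
    ca_ra_1 := cos_ra_1; sine_law := E2_sine_law; dual_cosine_law := E2_dual;
    ang_diff3 := E2_diff3; two_lengths := triangle_two_lengths; linked := E2_linked |}.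
  - intros x. exact (is_derive_id (K := R_AbsRing) x).
  - intros x. eapply is_derive_eq; [exact (is_derive_const (K := R_AbsRing) (V := R_NormedModule) 1 x)|].
    unfold zero; simpl. ring.
  - exists 1. split; [unfold pos_real; lra|lra].
Defined.

(** * Primitives of closed 1-forms *)

Notation NR3 := (prod_NormedModule R_AbsRing
  (prod_NormedModule R_AbsRing R_NormedModule R_NormedModule) R_NormedModule).

Definition shift (x : R3) (t : R) (h : R3) : R3 :=
  (co i1 x + t * co i1 h, co i2 x + t * co i2 h, co i3 x + t * co i3 h).

Lemma co_shift (i : ix) (x h : R3) (t : R) : co i (shift x t h) = co i x + t * co i h.
Proof. now destruct i. Qed.

Definition convex3 (T : R3 -> Prop) : Prop :=
  forall x y t, T x -> T y -> 0 <= t <= 1 ->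
    T (shift x t (co i1 y - co i1 x, co i2 y - co i2 x, co i3 y - co i3 x)).

Lemma is_derive_shift (x h : R3) (i : ix) (t : R) :
  is_derive (fun s => co i (shift x s h)) t (co i h).
Proof.
  apply (is_derive_ext (fun s => co i x + s * co i h)); [intros s; now rewrite co_shift|].
  auto_derive; [easy|]. ring.
Qed.

Lemma diff3_shift (f : R3 -> R) (x h : R3) (t : R) (d : ix -> R) :
  diff3 f (shift x t h) d ->
  is_derive (fun s => f (shift x s h)) t (sum3 (fun i => d i * co i h)).
Proof.
  intros H. apply (diff3_curve f (fun s => shift x s h) t d (fun i => co i h)); [exact H|].
  intros i. apply is_derive_shift.
Qed.

Lemma continuous_R3 {U : UniformSpace} (F : U -> R3) (z : U) :
  (forall i, continuous (fun y => co i (F y)) z) -> continuous F z.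
Proof.
  intros H P [e He].
  assert (B : forall i, locally z (fun y => ball (co i (F z)) e (co i (F y)))).
  { intros i. apply (H i (fun y => ball (co i (F z)) e y)). now exists e. }
  change (locally z (fun y => P (F y))).
  generalize (filter_and _ _ (B i1) (filter_and _ _ (B i2) (B i3))).
  apply filter_imp. intros y (H1 & H2 & H3). apply He.
  repeat split; assumption.
Qed.

Lemma abs_co_le_norm (h : R3) (i : ix) :
  Rabs (co i h) <= norm (h : NR3).
Proof.
  destruct h as [[a b] c].
  pose proof (proj1 (norm_prod (K := R_AbsRing) (U := prod_NormedModule R_AbsRing R_NormedModule R_NormedModule)
     (V := R_NormedModule) (a, b) c)) as N1.
  pose proof (proj1 (norm_prod (K := R_AbsRing) (U := R_NormedModule) (V := R_NormedModule) a b)) as N2.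
  destruct i; simpl co.
  - eapply Rle_trans; [|exact N1]. eapply Rle_trans; [|apply Rmax_l].
    eapply Rle_trans; [|exact N2]. apply (Rmax_l (Rabs a)).
  - eapply Rle_trans; [|exact N1]. eapply Rle_trans; [|apply Rmax_l].
    eapply Rle_trans; [|exact N2]. apply (Rmax_r _ (Rabs b)).
  - eapply Rle_trans; [|exact N1]. apply (Rmax_r _ (Rabs c)).
Qed.

Lemma is_linear_sum3 (d : ix -> R) : is_linear (fun h : R3 => sum3 (fun i => d i * co i h)).
Proof.
  assert (D : forall i, diff3 (fun x => d i * co i x) (0, 0, 0) (fun j => d i * kron i j)).
  { intros i. eapply diff3_ext_d; [|apply diff3_mult; [apply diff3_const|apply diff3_co]].
    intros j. cbv beta. ring. }
  assert (D' : diff3 (fun x => sum3 (fun i => d i * co i x)) (0, 0, 0) d).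
  { eapply diff3_ext_d; [|exact (diff3_sum3 _ _ _ D)].
    intros j. cbv beta. destruct j; unfold sum3, kron; ring. }
  exact (proj1 D').
Qed.

(** The mean value theorem on the segment from l to y writes V(y) - V(l) with the coefficients of w
    at an intermediate point; by continuity these are within eps / 3 of those at l, one third for
    each coordinate. *)
Lemma diff3_of_directional (T : R3 -> Prop) (V : R3 -> R) (w : form) (l : R3) :
  locally l T -> (forall j, continuous (fun x => w x j) l) ->
  (forall x h t, T (shift x t h) ->
     is_derive (fun s => V (shift x s h)) t (sum3 (fun i => w (shift x t h) i * co i h))) ->
  diff3 V l (w l).
Proof.
  intros HT Hw HV. split; [apply is_linear_sum3|].
  intros x Hx. apply (is_filter_lim_locally_unique (V := NR3)) in Hx. subst x.
  intros eps.
  assert (He : 0 < eps / 3) by (pose proof (cond_pos eps); lra).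
  assert (B : forall j, locally l (fun x => Rabs (w x j - w l j) <= eps / 3)).
  { intros j. pose proof (Hw j (fun y => ball (w l j) (mkposreal _ He) y)
      (ex_intro _ (mkposreal _ He) (fun _ H => H))) as C.
    unfold filtermap in C. revert C. apply filter_imp. intros x Hx. left. exact Hx. }
  destruct (filter_and _ _ HT (filter_and _ _ (B i1) (filter_and _ _ (B i2) (B i3)))) as [e Hball].
  exists e. intros y Hy.
  set (h := (co i1 y - co i1 l, co i2 y - co i2 l, co i3 y - co i3 l) : R3).
  assert (Hb : forall t, 0 <= t <= 1 -> ball l e (shift l t h)).
  { intros t Ht. destruct l as [[l1 l2] l3], y as [[y1 y2] y3].
    destruct Hy as [[H1 H2] H3]. simpl in H1, H2, H3.
    assert (K : forall a b, ball a e b -> ball a e (a + t * (b - a))).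
    { intros a b Hab. unfold ball in *; simpl in *.
      unfold AbsRing_ball, abs, minus, plus, opp in *; simpl in *.
      replace (a + t * (b - a) + - a) with (t * (b + - a)) by ring.
      rewrite Rabs_mult, (Rabs_right t) by lra.
      pose proof (Rabs_pos (b + - a)). nra. }
    repeat split; simpl; now apply K. }
  destruct (MVT_gen (fun t => V (shift l t h)) 0 1
    (fun t => sum3 (fun i => w (shift l t h) i * co i h))) as [c [Hc E]].
  { intros t Ht. rewrite Rmin_left, Rmax_right in Ht by lra.
    apply HV. apply Hball, Hb. lra. }
  { intros t Ht. rewrite Rmin_left, Rmax_right in Ht by lra.
    apply derivable_continuous_pt. eexists. apply is_derive_Reals.
    apply HV. apply Hball, Hb. lra. }
  rewrite Rmin_left, Rmax_right in Hc by lra.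
  assert (E0 : shift l 0 h = l) by (apply R3_ext; intros i; rewrite co_shift; ring).
  assert (E1 : shift l 1 h = y)
    by (apply R3_ext; intros i; rewrite co_shift; destruct i; unfold h; simpl; ring).
  cbv beta in E. rewrite E0, E1 in E.
  destruct (Hball _ (Hb c Hc)) as (_ & B1 & B2 & B3).
  assert (Hh : minus y l = h).
  { destruct l as [[l1 l2] l3], y as [[y1 y2] y3]. reflexivity. }
  change (Rabs (V y - V l - sum3 (fun i => w l i * co i (minus y l))) <= eps * norm (minus y l)).
  rewrite Hh, E.
  pose proof (abs_co_le_norm h i1) as N1. pose proof (abs_co_le_norm h i2) as N2.
  pose proof (abs_co_le_norm h i3) as N3.
  set (N := norm _) in *.
  replace (sum3 (fun i => w (shift l c h) i * co i h) * (1 - 0) - sum3 (fun i => w l i * co i h))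
    with ((w (shift l c h) i1 - w l i1) * co i1 h + (w (shift l c h) i2 - w l i2) * co i2 h
      + (w (shift l c h) i3 - w l i3) * co i3 h) by (unfold sum3; ring).
  eapply Rle_trans; [apply Rabs_triang|].
  eapply Rle_trans; [apply Rplus_le_compat_r, Rabs_triang|].
  rewrite !Rabs_mult.
  assert (M : forall a b, 0 <= a <= eps / 3 -> 0 <= b <= N -> a * b <= eps / 3 * N).
  { intros a b Ha Hb'. apply Rmult_le_compat; lra. }
  pose proof (M _ _ (conj (Rabs_pos _) B1) (conj (Rabs_pos _) N1)).
  pose proof (M _ _ (conj (Rabs_pos _) B2) (conj (Rabs_pos _) N2)).
  pose proof (M _ _ (conj (Rabs_pos _) B3) (conj (Rabs_pos _) N3)).
  lra.
Qed.

(* Differentiating the line integral from l0 under the integral sign gives, by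
   closedness, the integral of the derivative of t w(l0 + t (y - l0)) . h. *)
Lemma poincare (T : R3 -> Prop) (w : form) (W : R3 -> ix -> ix -> R) (l0 : R3) :
  T l0 -> convex3 T -> (forall l, T l -> locally l T) ->
  (forall l j, T l -> diff3 (fun x => w x j) l (W l j)) ->
  (forall l i j, T l -> W l j i = W l i j) ->
  (forall l i j, T l -> continuous (fun x => W x j i) l) ->
  exists V, is_primitive T w V.
Proof.
  intros H0 HT HTo HW HS HC.
  set (dif := fun y : R3 => (co i1 y - co i1 l0, co i2 y - co i2 l0, co i3 y - co i3 l0) : R3).
  set (f := fun y t => sum3 (fun j => w (shift l0 t (dif y)) j * co j (dif y))).
  exists (fun y => RInt (f y) 0 1).
  intros l Hl.
  apply (diff3_of_directional T (fun y => RInt (f y) 0 1) w l (HTo l Hl)).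
  { intros j. exact (diff3_continuous _ _ _ (HW l j Hl)). }
  intros x h s Hs.
  set (y := fun u => shift x u h).
  assert (Cdif : forall i z, co i (dif z) = co i z - co i l0) by (intros [] z; reflexivity).
  (* The point with parameter t on the segment from l0 to y(u); [g] below is the derivative in u of
     the integrand on that segment. *)
  set (p := fun u t => shift l0 t (dif (y u))).
  assert (Cp : forall i u t, co i (p u t) = co i l0 + t * (co i x + u * co i h - co i l0)).
  { intros i u t. unfold p, y. now rewrite co_shift, Cdif, co_shift. }
  assert (Hp : forall u t, T (y u) -> 0 <= t <= 1 -> T (p u t)).
  { intros u t Hu Ht. now apply HT. }
  set (g := fun u t => sum3 (fun j => sum3 (fun k => W (p u t) j k * (t * co k h)) * co j (dif (y u))
                             + w (p u t) j * co j h)).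
  assert (Dp : forall u t k, is_derive (fun v => co k (p v t)) u (t * co k h)).
  { intros u t k. apply (is_derive_ext (fun v => co k l0 + t * (co k x + v * co k h - co k l0))).
    { intros v. now rewrite Cp. }
    auto_derive; [easy|]. ring. }
  assert (Df : forall u t, T (p u t) -> is_derive (fun v => f (y v) t) u (g u t)).
  { intros u t Hu. unfold f, g.
    assert (Dj : forall j, is_derive (fun v => w (p v t) j * co j (dif (y v))) u
       (sum3 (fun k => W (p u t) j k * (t * co k h)) * co j (dif (y u)) + w (p u t) j * co j h)).
    { intros j. apply (is_derive_mult (fun v => w (p v t) j) (fun v => co j (dif (y v)))).
      - apply (diff3_curve (fun z => w z j) (fun v => p v t) u (W (p u t) j) (fun k => t * co k h)).
        + now apply HW.
        + intros k. apply Dp.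
      - apply (is_derive_ext (fun v => co j x + v * co j h - co j l0)).
        { intros v. unfold y. now rewrite Cdif, co_shift. }
        auto_derive; [easy|]. ring.
      - intros; apply Rmult_comm. }
    unfold sum3 at 1 3.
    apply (is_derive_plus (V := R_NormedModule) (fun v => w (p v t) i1 * co i1 (dif (y v))
        + w (p v t) i2 * co i2 (dif (y v)))); [|apply Dj].
    apply (is_derive_plus (V := R_NormedModule)); apply Dj. }
  assert (Cpc : forall z : R * R, continuous (fun z => p (fst z) (snd z)) z).
  { intros z. apply continuous_R3. intros i.
    apply (continuous_ext (fun z => co i l0 + snd z * (co i x + fst z * co i h - co i l0))).
    { intros z'. now rewrite Cp. }
    destruct z as [u t].
    assert (C1 : continuous (fun z : R * R => fst z) (u, t)) by apply continuous_fst.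
    assert (C2 : continuous (fun z : R * R => snd z) (u, t)) by apply continuous_snd.
    apply (continuous_plus (V := R_NormedModule)); [apply continuous_const|].
    apply (continuous_mult (K := R_AbsRing)); [exact C2|].
    apply (continuous_minus (V := R_NormedModule)); [|apply continuous_const].
    apply (continuous_plus (V := R_NormedModule)); [apply continuous_const|].
    apply (continuous_mult (K := R_AbsRing)); [exact C1|apply continuous_const]. }
  assert (Cg : forall u t, T (p u t) -> continuous (fun z : R * R => g (fst z) (snd z)) (u, t)).
  { intros u t Hu.
    assert (C1 : continuous (fun z : R * R => fst z) (u, t)) by apply continuous_fst.
    assert (C2 : continuous (fun z : R * R => snd z) (u, t)) by apply continuous_snd.
    assert (Cw : forall j, continuous (fun z : R * R => w (p (fst z) (snd z)) j) (u, t)).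
    { intros j. apply (continuous_comp (fun z : R * R => p (fst z) (snd z)) (fun q => w q j)); [apply Cpc|].
      exact (diff3_continuous _ _ _ (HW _ j Hu)). }
    assert (CW : forall j k, continuous (fun z : R * R => W (p (fst z) (snd z)) j k) (u, t)).
    { intros j k. apply (continuous_comp (fun z : R * R => p (fst z) (snd z)) (fun q => W q j k)); [apply Cpc|].
      now apply HC. }
    assert (Cy : forall j, continuous (fun z : R * R => co j (dif (y (fst z)))) (u, t)).
    { intros j. apply (continuous_ext (fun z : R * R => co j x + fst z * co j h - co j l0)).
      { intros z. unfold y. now rewrite Cdif, co_shift. }
      apply (continuous_minus (V := R_NormedModule)); [|apply continuous_const].
      apply (continuous_plus (V := R_NormedModule)); [apply continuous_const|].
      apply (continuous_mult (K := R_AbsRing)); [exact C1|apply continuous_const]. }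
    assert (Cs : forall F : ix -> R * R -> R, (forall i, continuous (F i) (u, t)) ->
       continuous (fun z => sum3 (fun i => F i z)) (u, t)).
    { intros F HF. unfold sum3. apply (continuous_plus (V := R_NormedModule)); [|apply HF].
      apply (continuous_plus (V := R_NormedModule)); apply HF. }
    unfold g. apply Cs. intros j.
    apply (continuous_plus (V := R_NormedModule)).
    - apply (continuous_mult (K := R_AbsRing)); [|apply Cy]. apply Cs. intros k.
      apply (continuous_mult (K := R_AbsRing)); [apply CW|].
      apply (continuous_mult (K := R_AbsRing)); [exact C2|apply continuous_const].
    - apply (continuous_mult (K := R_AbsRing)); [apply Cw|apply continuous_const]. }
  assert (Cyc : forall u, continuous y u).
  { intros u. apply continuous_R3. intros i.
    apply (ex_derive_continuous (fun v => co i (y v))). eexists. apply is_derive_shift. }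
  assert (Hys : locally s (fun u => T (y u))) by (apply (Cyc s); now apply HTo).
  assert (Ht01 : forall t, Rmin 0 1 <= t <= Rmax 0 1 -> 0 <= t <= 1)
    by (intros t Ht; rewrite Rmin_left, Rmax_right in Ht; lra).
  eapply is_derive_eq.
  { apply (is_derive_RInt_param (fun u t => f (y u) t) 0 1 s).
    - revert Hys. apply filter_imp. intros u Hu t Ht. eexists. apply Df. now apply Hp, Ht01.
    - intros t Ht%Ht01. apply (continuity_2d_pt_ext_loc g).
      + assert (L : locally (s, t) (fun z : R * R => T (p (fst z) (snd z)))).
        { apply (Cpc (s, t)). now apply HTo, Hp. }
        destruct L as [e He]. exists e. intros u v Hu Hv.
        symmetry. apply is_derive_unique. apply Df. apply (He (u, v)). split; assumption.
      + apply continuity_2d_pt_filterlim. now apply (Cg s t), Hp.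
    - revert Hys. apply filter_imp. intros u Hu.
      apply (ex_RInt_continuous (V := R_CompleteNormedModule)). intros t Ht%Ht01.
      unfold f, sum3.
      assert (Cw : forall j, continuous (fun t => w (shift l0 t (dif (y u))) j * co j (dif (y u))) t).
      { intros j. apply (continuous_mult (K := R_AbsRing)); [|apply continuous_const].
        apply (ex_derive_continuous (fun t => w (shift l0 t (dif (y u))) j)). eexists.
        apply (diff3_shift (fun z => w z j)). apply HW. now apply (Hp u). }
      apply (continuous_plus (V := R_NormedModule)); [|apply Cw].
      apply (continuous_plus (V := R_NormedModule)); apply Cw. }
  apply is_RInt_unique.
  apply (is_RInt_ext (g s)).
  { intros t Ht. symmetry. apply is_derive_unique, Df, Hp; [easy|].
    rewrite Rmin_left, Rmax_right in Ht by lra. lra. }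
  assert (Ep1 : p s 1 = y s) by (apply R3_ext; intros i; rewrite Cp; unfold y; rewrite co_shift; ring).
  (* The boundary terms of the function t w(p s t) . h: the factor t kills the end at l0, and the
     other end is the point y(s). *)
  replace (sum3 (fun i => w (shift x s h) i * co i h))
    with (minus (1 * sum3 (fun j => w (p s 1) j * co j h)) (0 * sum3 (fun j => w (p s 0) j * co j h))).
  2: { rewrite Ep1. unfold minus, plus, opp, y; simpl. ring. }
  apply (is_RInt_derive (fun t => t * sum3 (fun j => w (p s t) j * co j h)) (g s)).
  - intros t Ht%Ht01. assert (Tp : T (p s t)) by now apply Hp.
    eapply is_derive_eq.
    + apply (is_derive_mult (fun t => t) (fun t => sum3 (fun j => w (p s t) j * co j h)) t 1
        (sum3 (fun j => sum3 (fun k => W (p s t) j k * co k (dif (y s))) * co j h))).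
      * exact (is_derive_id (K := R_AbsRing) t).
      * assert (Dj : forall j, is_derive (fun t => w (p s t) j * co j h) t
           (sum3 (fun k => W (p s t) j k * co k (dif (y s))) * co j h)).
        { intros j. apply (is_derive_ext (fun t => co j h * w (p s t) j)); [intros; apply Rmult_comm|].
          rewrite Rmult_comm. apply is_derive_scal.
          now apply (diff3_shift (fun z => w z j)), HW. }
        unfold sum3 at 1 2.
        apply (is_derive_plus (V := R_NormedModule) (fun t => w (p s t) i1 * co i1 h
           + w (p s t) i2 * co i2 h)); [|apply Dj].
        apply (is_derive_plus (V := R_NormedModule)); apply Dj.
      * intros; apply Rmult_comm.
    + unfold g, plus, mult, sum3; simpl.
      rewrite (HS _ i1 i2 Tp), (HS _ i1 i3 Tp), (HS _ i2 i3 Tp). ring.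
  - intros t Ht%Ht01.
    apply (continuous_comp (fun t => (s, t)) (fun z : R * R => g (fst z) (snd z))).
    + apply (continuous_comp_2 (fun _ : R => s) (fun t : R => t) (fun a b => (a, b))).
      * apply continuous_const.
      * apply continuous_id.
      * apply (continuous_ext (fun z => z)); [now intros []|]. apply continuous_id.
    + apply Cg. now apply Hp.
Qed.

(** * Hessians *)

(** Strict monotonicity makes the chosen preimage a left inverse of U on I. The image of I is a
    neighbourhood of each U x by [locally_image], so near U x it is a right inverse as well and can
    be differentiated there. *)
Lemma interval_inverse (I : R -> Prop) (U U' : R -> R) :
  is_open_interval I -> (forall x, I x -> is_derive U x (U' x)) -> (forall x, I x -> 0 < U' x) ->
  exists k : R -> R, forall x, I x ->
    k (U x) = x /\ locally (U x) (fun y => U (k y) = y) /\ is_derive k (U x) (/ U' x).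
Proof.
  intros HI HU HU'.
  assert (Inc : forall x y, I x -> I y -> x < y -> U x < U y).
  { intros x y Hx Hy Hxy. destruct (MVT_gen U x y U') as [c [Hc E]].
    - intros z Hz. apply HU, (interval_between I x y); auto; lra.
    - intros z Hz. apply derivable_continuous_pt. eexists. apply is_derive_Reals.
      now apply HU, (interval_between I x y).
    - assert (0 < U' c) by now apply HU', (interval_between I x y).
      nra. }
  set (k := fun y => epsilon (inhabits 0) (fun x => I x /\ U x = y)).
  assert (Kx : forall x, I x -> k (U x) = x).
  { intros x Hx. destruct (epsilon_spec (inhabits 0) (fun z => I z /\ U z = U x)) as [H1 H2].
    { now exists x. }
    fold (k (U x)) in H1, H2.
    destruct (Rtotal_order (k (U x)) x) as [H|[H|H]]; [|easy|].
    - pose proof (Inc _ _ H1 Hx H). lra.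
    - pose proof (Inc _ _ Hx H1 H). lra. }
  exists k. intros x Hx. split; [now apply Kx|].
  assert (Loc : forall e, 0 < e -> locally (U x) (fun y => exists u, Rabs (u - x) < e /\ I u /\ U u = y)).
  { intros e He. destruct (proj1 HI x Hx) as [e' He'].
    assert (He2 : 0 < Rmin e e') by (apply Rmin_pos; [easy|apply cond_pos]).
    assert (HIu : forall u, Rabs (u - x) < Rmin e e' -> I u).
    { intros u Hu. apply He'. apply Rlt_le_trans with (1 := Hu), Rmin_r. }
    generalize (locally_image U x (U' x) _ He2
      (fun u Hu => ex_derive_continuous U u (ex_intro _ _ (HU u (HIu u Hu)))) (HU x Hx) (HU' x Hx)).
    apply filter_imp. intros y [u [Hu Ey]]. exists u. repeat split; auto.
    apply Rlt_le_trans with (1 := Hu), Rmin_l. }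
  split.
  { generalize (Loc 1 Rlt_0_1). apply filter_imp.
    intros y [u [_ [Hu <-]]]. now rewrite Kx. }
  pose proof (HU x Hx) as [_ Hd]. specialize (Hd x (fun P H => H)).
  pose proof (HU' x Hx) as Hp. set (d := U' x) in *.
  split; [exact (is_linear_scal_l (K := R_AbsRing) (V := R_NormedModule) (/ d))|].
  intros y0 Hy0. apply (is_filter_lim_locally_unique (V := R_NormedModule)) in Hy0. subst y0.
  intros eps. pose proof (cond_pos eps) as He.
  (* The bound d / 2 gives |D| >= (d / 2) |v|; the bound eps d^2 / 2 then turns the error eta |v|
     into at most eps d |D|. *)
  set (eta := Rmin (d / 2) (eps * d * d / 2)).
  assert (Heta : 0 < eta).
  { apply Rmin_pos; [lra|]. apply Rdiv_lt_0_compat; [|lra].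
    now repeat apply Rmult_lt_0_compat. }
  assert (Heta1 : eta <= d / 2) by apply Rmin_l.
  assert (Heta2 : eta <= eps * d * d / 2) by apply Rmin_r.
  destruct (Hd (mkposreal eta Heta)) as [e Hball].
  generalize (Loc e (cond_pos e)). apply filter_imp.
  intros y [u [Hu [Iu <-]]]. specialize (Hball u Hu).
  change (Rabs ((k (U u) - k (U x)) - (U u - U x) * / d) <= eps * Rabs (U u - U x)).
  change (Rabs ((U u - U x) - (u - x) * d) <= eta * Rabs (u - x)) in Hball.
  rewrite !Kx by easy.
  set (D := U u - U x) in *. set (v := u - x) in *.
  assert (Hv : d / 2 * Rabs v <= Rabs D).
  { assert (Rabs (v * d) <= Rabs D + Rabs (D - v * d)).
    { replace (v * d) with (D - (D - v * d)) at 1 by ring.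
      eapply Rle_trans; [apply Rabs_triang|]. rewrite Rabs_Ropp. lra. }
    rewrite Rabs_mult, (Rabs_right d) in H by lra.
    assert (eta * Rabs v <= d / 2 * Rabs v) by (apply Rmult_le_compat_r; [apply Rabs_pos|easy]).
    lra. }
  replace (v - D * / d) with (- (D - v * d) * / d) by (field; lra).
  rewrite Rabs_mult, Rabs_Ropp, (Rabs_right (/ d)) by (apply Rle_ge, Rlt_le; now apply Rinv_0_lt_compat).
  apply (Rmult_le_reg_r d); [easy|]. rewrite Rmult_assoc, Rinv_l, Rmult_1_r by lra.
  apply Rle_trans with (1 := Hball).
  apply Rle_trans with (eps * d * (d / 2 * Rabs v)).
  - replace (eps * d * (d / 2 * Rabs v)) with (eps * d * d / 2 * Rabs v) by field.
    apply Rmult_le_compat_r; [apply Rabs_pos|easy].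
  - replace (eps * Rabs D * d) with (eps * d * Rabs D) by ring.
    apply Rmult_le_compat_l; [|easy]. apply Rlt_le. now apply Rmult_lt_0_compat.
Qed.

Lemma map3_upd (U : R -> R) (l : R3) (i : ix) (t : R) :
  map3 U (upd l i t) = upd (map3 U l) i (U t).
Proof. now destruct i. Qed.

Lemma co_map3 (U : R -> R) (l : R3) (i : ix) : co i (map3 U l) = U (co i l).
Proof. now destruct i. Qed.

Lemma partial_eq (i : ix) (f : R3 -> R) (u : R3) (d : R) :
  is_derive (fun t => f (upd u i t)) (co i u) d -> ex_partial i f u /\ partial i f u = d.
Proof. intros H. split; [now exists d|now apply is_derive_unique]. Qed.

Lemma diff3_Rpower_co (s C : R -> R) (a : R) (j : ix) (l : R3) :
  0 < s (co j l) -> is_derive s (co j l) (C (co j l)) ->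
  diff3 (fun x => Rpower (s (co j x)) a) l
    (fun k => a * Rpower (s (co j l)) (a - 1) * C (co j l) * kron j k).
Proof.
  intros H Hs. apply (diff3_comp_co (fun y => Rpower (s y) a)). now apply is_derive_Rpower_comp.
Qed.

Section Convexity.

Variable G : geometry.
Variables (lambda : R) (F U : R -> R).

Notation A := (area (ang G) (ra G) (sl G)).
Notation dth := (dang (ang G) (ra G) (ca G) (sl G)).
Notation th := (ang G).

Hypothesis HF : antiderivative_on (Ia G) (fun t => Rpower (ra G t) lambda) F.
Hypothesis HU : antiderivative_on (Il G) (fun t => Rpower (sl G t) (- lambda - 1)) U.

Lemma w_form_eq (l : R3) (j : ix) :
  w_form th (sl G) lambda F l j = F (th j l) * Rpower (sl G (co j l)) (- lambda - 1).
Proof.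
  unfold w_form. replace (- lambda - 1) with (- (lambda + 1)) by ring.
  now rewrite Rpower_Ropp.
Qed.

Definition dw_form (l : R3) (j k : ix) : R :=
  Rpower (ra G (th j l)) lambda * dth j l k * Rpower (sl G (co j l)) (- lambda - 1)
  + F (th j l) * ((- lambda - 1) * Rpower (sl G (co j l)) (- lambda - 1 - 1)
                  * cl G (co j l) * kron j k).

Lemma F_ang_diff3 (l : R3) (j : ix) : dom G l ->
  diff3 (fun x => F (th j x)) l (fun k => Rpower (ra G (th j l)) lambda * dth j l k).
Proof. intros Hl. apply diff3_comp; [now apply ang_diff3|]. now apply HF, dom_ang. Qed.

Lemma sl_power_diff3 (l : R3) (j : ix) (a : R) : dom G l ->
  diff3 (fun x => Rpower (sl G (co j x)) a) l
    (fun k => a * Rpower (sl G (co j l)) (a - 1) * cl G (co j l) * kron j k).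
Proof. intros Hl. apply diff3_Rpower_co; [now apply sl_co_pos|apply sl_derive]. Qed.

Lemma w_form_diff3 (l : R3) (j : ix) : dom G l ->
  diff3 (fun x => w_form th (sl G) lambda F x j) l (dw_form l j).
Proof.
  intros Hl. apply (diff3_ext (fun x => F (th j x) * Rpower (sl G (co j x)) (- lambda - 1))).
  { intros x. symmetry. apply w_form_eq. }
  apply diff3_mult; [now apply F_ang_diff3|now apply sl_power_diff3].
Qed.

Lemma dw_form_sym (l : R3) (i j : ix) : dom G l -> dw_form l j i = dw_form l i j.
Proof.
  intros Hl. unfold dw_form.
  assert (R := reciprocal_powers G (fun x => 1 * Rpower (ra G x) lambda)
     (fun x => 1 * Rpower (sl G x) (- lambda - 1)) lambda 1 1
     (fun _ _ => eq_refl) (fun _ _ => eq_refl) l i j Hl).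
  cbv beta in R. rewrite !Rmult_1_l in R.
  destruct i, j; try reflexivity; unfold kron; lra.
Qed.

Lemma dw_form_continuous (l : R3) (j k : ix) : dom G l -> continuous (fun x => dw_form x j k) l.
Proof.
  intros Hl.
  assert (Cth : continuous (fun x => Rpower (ra G (th j x)) lambda) l).
  { eapply diff3_continuous. apply (diff3_comp (fun y => Rpower (ra G y) lambda)).
    - now apply ang_diff3.
    - apply is_derive_Rpower_comp; [now apply ra_ang_pos|apply ra_derive]. }
  unfold dw_form. apply (continuous_plus (V := R_NormedModule)).
  - apply (continuous_mult (K := R_AbsRing)).
    + apply (continuous_mult (K := R_AbsRing)); [exact Cth|].
      exact (diff3_continuous _ _ _ (dang_diff3 G j k l Hl)).
    + exact (diff3_continuous _ _ _ (sl_power_diff3 l j _ Hl)).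
  - apply (continuous_mult (K := R_AbsRing)); [exact (diff3_continuous _ _ _ (F_ang_diff3 l j Hl))|].
    apply (continuous_mult (K := R_AbsRing)); [|apply continuous_const].
    apply (continuous_mult (K := R_AbsRing)).
    + apply (continuous_mult (K := R_AbsRing)); [apply continuous_const|].
      exact (diff3_continuous _ _ _ (sl_power_diff3 l j _ Hl)).
    + exact (diff3_continuous _ _ _ (diff3_comp_co _ j l _ (cl_derive G (co j l)))).
Qed.

Lemma U_inverse : exists k : R -> R, forall x, Il G x ->
    k (U x) = x /\ locally (U x) (fun y => U (k y) = y) /\
    is_derive k (U x) (/ Rpower (sl G x) (- lambda - 1)).
Proof.
  apply (interval_inverse (Il G)); [apply Il_interval|exact HU|].
  intros x _. apply exp_pos.
Qed.

(** [poincare] yields a primitive V in the lengths; composing it with the coordinatewise inverse of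
    U expresses it in u, and on the image the pull-back is V again. *)
Lemma integral_exists (l0 : R3) :
  dom G l0 -> convex3 (dom G) ->
  exists W, integral_in (map3 U) (dom G) (w_form th (sl G) lambda F) W.
Proof.
  intros H0 HT.
  destruct (poincare (dom G) (w_form th (sl G) lambda F) dw_form l0 H0 HT (dom_open G)) as [V HV].
  - intros l j Hl. now apply w_form_diff3.
  - intros l i j Hl. now apply dw_form_sym.
  - intros l i j Hl. now apply dw_form_continuous.
  - destruct U_inverse as [k Hk]. exists (fun u => V (map3 k u)).
    intros l Hl. apply (diff3_ext_dom (dom G) V _ _ _ (dom_open G) Hl); [|now apply HV].
    intros x Hx. f_equal. apply R3_ext. intros i. rewrite !co_map3.
    symmetry. now apply Hk, dom_len.
Qed.

(** In the variable u the form is sum F(theta_j) du_j, so the gradient of its integral is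
    F(theta_j). The entry is the derivative of F(theta_j) in l_i divided by du_i / dl_i. *)
Definition u_hessian (l : R3) (i j : ix) : R :=
  Rpower (ra G (th j l)) lambda * dth j l i / Rpower (sl G (co i l)) (- lambda - 1).

Lemma hessian_eq (W : R3 -> R) (l : R3) :
  integral_in (map3 U) (dom G) (w_form th (sl G) lambda F) W -> dom G l ->
  hessian_exists W (map3 U l) /\ forall i j, hessian W (map3 U l) i j = u_hessian l i j.
Proof.
  intros HW Hl. destruct U_inverse as [k Hk].
  (* Varying u_i alone is varying l_i = k(u_i) alone, so each derivative in u is the one in l
     divided by the derivative of U. *)
  assert (Slice : forall (f : R3 -> R) (x : R3) (i : ix) (d : R), dom G x ->
     is_derive (fun t => f (map3 U (upd x i t))) (co i x) d ->
     is_derive (fun t => f (upd (map3 U x) i t)) (co i (map3 U x))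
       (d / Rpower (sl G (co i x)) (- lambda - 1))).
  { intros f x i d Hx Hd. rewrite co_map3.
    destruct (Hk (co i x) (dom_len G x i Hx)) as (K1 & K2 & K3).
    apply (is_derive_ext_loc (fun t => f (map3 U (upd x i (k t))))).
    { revert K2. apply filter_imp. intros t Ht. now rewrite map3_upd, Ht. }
    eapply is_derive_eq.
    - apply (is_derive_comp (fun s => f (map3 U (upd x i s))) k); [|exact K3].
      rewrite K1. exact Hd.
    - unfold scal; simpl; unfold mult; simpl. unfold Rdiv. ring. }
  assert (P1 : forall j x, dom G x ->
     ex_partial j W (map3 U x) /\ partial j W (map3 U x) = F (th j x)).
  { intros j x Hx. apply partial_eq.
    eapply is_derive_eq.
    - apply Slice; [exact Hx|]. exact (diff3_upd _ _ _ j (HW x Hx)).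
    - rewrite w_form_eq. field. apply Rgt_not_eq, exp_pos. }
  assert (P2 : forall i j, ex_partial i (partial j W) (map3 U l) /\
     partial i (partial j W) (map3 U l) = u_hessian l i j).
  { intros i j. apply partial_eq. apply Slice; [exact Hl|].
    apply (is_derive_ext_loc (fun t => F (th j (upd l i t)))).
    - apply (filter_imp (fun t => dom G (upd l i t))).
      + intros t Ht. symmetry. now apply P1.
      + now apply locally_upd, dom_open.
    - exact (diff3_upd _ _ _ i (F_ang_diff3 l j Hl)). }
  split; [split|].
  - intros j. now apply P1.
  - intros i j. now apply P2.
  - intros i j. now apply P2.
Qed.

(* The first square eliminates y_1; the dual cosine law turns the mixed term of
   the remaining form into - 2 C_1 (r_3 y_2) (r_2 y_3). *)
Lemma quad_u_hessian (l : R3) (v : ix -> R) : eps G = 1 -> dom G l ->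
  let y i := Rpower (sl G (co i l)) (lambda + 1) * v i in
  quad (u_hessian l) v =
    Rpower (A l / (sl G (co i1 l) * sl G (co i2 l) * sl G (co i3 l))) lambda / A l *
    ((y i1 - ca G (th i3 l) * y i2 - ca G (th i2 l) * y i3) ^ 2
     + (ra G (th i3 l) * y i2) ^ 2 + (ra G (th i2 l) * y i3) ^ 2
     - 2 * cl G (co i1 l) * (ra G (th i3 l) * y i2) * (ra G (th i2 l) * y i3)).
Proof.
  intros He Hl y. pose proof (area_pos G l Hl) as HA.
  set (K := Rpower (A l / (sl G (co i1 l) * sl G (co i2 l) * sl G (co i3 l))) lambda).
  (* The sine rule turns r(theta_j)^lambda into a common factor times s(l_j)^lambda. With the s(l_j)
     of [dang] this gives s(l_j)^(lambda + 1), matching the power of s(l_i) from du_i / dl_i; both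
     are absorbed into y. *)
  assert (E : forall i j, u_hessian l i j * v i * v j =
    K / A l * ((kron j i - ca G (th (prv j) l) * kron (nxt j) i - ca G (th (nxt j) l) * kron (prv j) i)
       * (y i * y j))).
  { intros i j. unfold u_hessian, y, dang.
    pose proof (sl_co_pos G l j Hl) as Hs.
    rewrite (sine_rule G l j Hl), <- Rpower_mult_distr; [fold K| |easy].
    - replace (- lambda - 1) with (- (lambda + 1)) by ring.
      rewrite Rpower_Ropp. rewrite (Rpower_plus lambda 1 (sl G (co j l))), Rpower_1 by easy.
      field. split; [lra|apply Rgt_not_eq, exp_pos].
    - apply Rdiv_lt_0_compat; [easy|]. repeat apply Rmult_lt_0_compat; now apply sl_co_pos. }
  unfold quad, sum3. rewrite !E.
  pose proof (dual_cosine_law G l i1 Hl) as D. simpl nxt in *; simpl prv in *.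
  pose proof (ca_ra_1 G (th i2 l)) as P2. pose proof (ca_ra_1 G (th i3 l)) as P3.
  rewrite He in P2, P3.
  unfold kron. rewrite <- !Rmult_plus_distr_l. f_equal.
  replace (2 * cl G (co i1 l) * (ra G (th i3 l) * y i2) * (ra G (th i2 l) * y i3))
    with (2 * (ra G (th i2 l) * ra G (th i3 l) * cl G (co i1 l)) * y i2 * y i3) by ring.
  rewrite <- D.
  replace ((ra G (th i3 l) * y i2) ^ 2) with ((1 - ca G (th i3 l) ^ 2) * y i2 ^ 2)
    by (rewrite <- P3; ring).
  replace ((ra G (th i2 l) * y i3) ^ 2) with ((1 - ca G (th i2 l) ^ 2) * y i3 ^ 2)
    by (rewrite <- P2; ring).
  ring.
Qed.

Lemma u_hessian_factor_pos (l : R3) : dom G l ->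
  0 < Rpower (A l / (sl G (co i1 l) * sl G (co i2 l) * sl G (co i3 l))) lambda / A l.
Proof. intros Hl. apply Rdiv_lt_0_compat; [apply exp_pos|now apply area_pos]. Qed.

Lemma integral_locally_convex (W : R3 -> R) :
  eps G = 1 -> (forall x, Il G x -> -1 <= cl G x <= 1) ->
  integral_in (map3 U) (dom G) (w_form th (sl G) lambda F) W ->
  locally_convex (image (map3 U) (dom G)) W.
Proof.
  intros He HC HW u [l [Hl ->]]. destruct (hessian_eq W l HW Hl) as [H1 H2].
  split; [exact H1|]. intros v.
  replace (quad (hessian W (map3 U l)) v) with (quad (u_hessian l) v)
    by (unfold quad, sum3; now rewrite !H2).
  rewrite quad_u_hessian by easy.
  apply Rmult_le_pos; [apply Rlt_le; now apply u_hessian_factor_pos|].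
  pose proof (HC _ (dom_len G l i1 Hl)) as Hc.
  set (a := _ - _ - _) at 1. set (b := ra G (th i3 l) * _). set (c := ra G (th i2 l) * _).
  (* The binary form is (1 + C)/2 (b - c)^2 + (1 - C)/2 (b + c)^2, with nonnegative weights when |C|
     <= 1. *)
  pose proof (pow2_ge_0 a). pose proof (pow2_ge_0 (b - c)). pose proof (pow2_ge_0 (b + c)).
  nra.
Qed.

(** With |C_1| < 1 the binary form is definite, so it can vanish only if y_2 = y_3 = 0. In that case
    the first square is y_1^2, which is then nonzero. *)
Lemma integral_locally_strictly_convex (W : R3 -> R) :
  eps G = 1 -> (forall x, Il G x -> -1 < cl G x < 1) ->
  integral_in (map3 U) (dom G) (w_form th (sl G) lambda F) W ->
  locally_strictly_convex (image (map3 U) (dom G)) W.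
Proof.
  intros He HC HW u [l [Hl ->]]. destruct (hessian_eq W l HW Hl) as [H1 H2].
  split; [exact H1|]. intros v [m Hm].
  replace (quad (hessian W (map3 U l)) v) with (quad (u_hessian l) v)
    by (unfold quad, sum3; now rewrite !H2).
  rewrite quad_u_hessian by easy.
  apply Rmult_lt_0_compat; [now apply u_hessian_factor_pos|].
  pose proof (HC _ (dom_len G l i1 Hl)) as Hc.
  pose proof (ra_ang_pos G l i2 Hl) as r2. pose proof (ra_ang_pos G l i3 Hl) as r3.
  set (y1 := Rpower (sl G (co i1 l)) (lambda + 1) * v i1).
  set (y2 := Rpower (sl G (co i2 l)) (lambda + 1) * v i2).
  set (y3 := Rpower (sl G (co i3 l)) (lambda + 1) * v i3).
  assert (Hy : y1 <> 0 \/ y2 <> 0 \/ y3 <> 0).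
  { assert (N : forall i, v i <> 0 -> Rpower (sl G (co i l)) (lambda + 1) * v i <> 0).
    { intros i Hi. apply Rmult_integral_contrapositive_currified; [apply Rgt_not_eq, exp_pos|easy]. }
    destruct m; [left|right; left|right; right]; now apply N. }
  set (x := cl G (co i1 l)) in *.
  set (b := ra G (th i3 l) * y2). set (c := ra G (th i2 l) * y3).
  set (a := y1 - ca G (th i3 l) * y2 - ca G (th i2 l) * y3).
  assert (Q : 0 <= b ^ 2 + c ^ 2 - 2 * x * b * c /\
     (b <> 0 \/ c <> 0 -> 0 < b ^ 2 + c ^ 2 - 2 * x * b * c)).
  { replace (b ^ 2 + c ^ 2 - 2 * x * b * c) with ((b - x * c) ^ 2 + (1 - x) * (1 + x) * c ^ 2) by ring.
    assert (P : 0 < (1 - x) * (1 + x)) by (apply Rmult_lt_0_compat; lra).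
    pose proof (pow2_ge_0 (b - x * c)). pose proof (pow2_ge_0 c).
    split; [nra|]. intros Hbc. destruct (Req_dec c 0) as [Hc0|Hc0].
    - rewrite Hc0. destruct Hbc as [Hb|]; [|easy].
      pose proof (pow2_gt_0 b Hb). nra.
    - pose proof (pow2_gt_0 c Hc0). nra. }
  destruct Q as [Q1 Q2]. pose proof (pow2_ge_0 a) as Ha.
  destruct (Req_dec y2 0) as [E2|E2]; [destruct (Req_dec y3 0) as [E3|E3]|].
  - assert (Ey : a = y1) by (unfold a; rewrite E2, E3; ring).
    assert (0 < a ^ 2) by (apply pow2_gt_0; rewrite Ey; tauto). lra.
  - assert (c <> 0) by (apply Rmult_integral_contrapositive_currified; lra).
    assert (0 < b ^ 2 + c ^ 2 - 2 * x * b * c) by tauto. lra.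
  - assert (b <> 0) by (apply Rmult_integral_contrapositive_currified; lra).
    assert (0 < b ^ 2 + c ^ 2 - 2 * x * b * c) by tauto. lra.
Qed.

End Convexity.

(** * Convexity of the length domains, and the conclusion *)

Lemma convex3_triangle :
  convex3 (fun l => forall i, 0 < co i l /\ co i l < co (nxt i) l + co (prv i) l).
Proof.
  intros x y t Hx Hy Ht i. destruct (Hx i) as [Hx1 Hx2]. destruct (Hy i) as [Hy1 Hy2].
  assert (K : forall p q, 0 < p -> 0 < q -> 0 < p + t * (q - p)).
  { intros p q Hp Hq. destruct (Req_dec t 1) as [->|Ht1]; [lra|].
    assert (0 < (1 - t) * p) by (apply Rmult_lt_0_compat; lra).
    assert (0 <= t * q) by (apply Rmult_le_pos; lra). lra. }
  pose proof (K _ _ Hx1 Hy1) as K1.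
  assert (K2 : 0 < (co (nxt i) x + co (prv i) x - co i x)
     + t * ((co (nxt i) y + co (prv i) y - co i y) - (co (nxt i) x + co (prv i) x - co i x)))
    by (apply K; lra).
  rewrite !co_shift. destruct i; simpl in *; lra.
Qed.

Lemma convex3_S2 : convex3 S2_lengths.
Proof.
  intros x y t [Hx Sx] [Hy Sy] Ht. split; [now apply convex3_triangle|].
  rewrite !co_shift. simpl.
  set (a := co i1 x + co i2 x + co i3 x) in *. set (b := co i1 y + co i2 y + co i3 y) in *.
  assert (a + t * (b - a) < 2 * PI).
  { destruct (Req_dec t 1) as [->|Ht1]; [lra|].
    assert ((1 - t) * a < (1 - t) * (2 * PI)) by (apply Rmult_lt_compat_l; lra).
    assert (t * b <= t * (2 * PI)) by (apply Rmult_le_compat_l; lra). lra. }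
  unfold a, b in *. simpl in *. lra.
Qed.

Lemma zero_pi_inhabited : exists x, zero_pi x.
Proof. exists (PI / 2). pose proof PI_RGT_0. unfold zero_pi. lra. Qed.

Lemma pos_real_inhabited : exists x, pos_real x.
Proof. exists 1. unfold pos_real. lra. Qed.

Theorem theorem3p2 :
  (* (a) Euclidean triangles *)
  (complete_list E2_lengths (edge_form E2_angle) zero_pi pos_real
     (w_list E2_angle zero_pi sin (fun x => x)) /\
   forall (lambda : R) (F : R -> R),
     antiderivative_on zero_pi (fun t => Rpower (sin t) lambda) F ->
     (exists W : R3 -> R,
        integral_in (E2_u lambda) E2_lengths
          (w_form E2_angle (fun x => x) lambda F) W) /\
     (forall W : R3 -> R,
        integral_in (E2_u lambda) E2_lengths
          (w_form E2_angle (fun x => x) lambda F) W ->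
        locally_convex (image (E2_u lambda) E2_lengths) W)) /\
  (* (b) spherical triangles *)
  (complete_list S2_lengths (edge_form S2_angle) zero_pi zero_pi
     (w_list S2_angle zero_pi sin sin) /\
   forall (lambda : R) (F : R -> R),
     antiderivative_on zero_pi (fun t => Rpower (sin t) lambda) F ->
     (exists W : R3 -> R,
        integral_in (S2_u lambda) S2_lengths
          (w_form S2_angle sin lambda F) W) /\
     (forall W : R3 -> R,
        integral_in (S2_u lambda) S2_lengths
          (w_form S2_angle sin lambda F) W ->
        locally_strictly_convex (image (S2_u lambda) S2_lengths) W)) /\
  (* (c) hyperbolic triangles *)
  complete_list H2_lengths (edge_form H2_angle) zero_pi pos_real
    (w_list H2_angle zero_pi sin sinh) /\
  (* (d) hyperbolic right-angled hexagons *)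
  complete_list hexagon_lengths (edge_form hexagon_angle) pos_real pos_real
    (w_list hexagon_angle pos_real sinh sinh) /\
  (* Legendre transforms in the cases (b), (c), (d) *)
  complete_list S2_lengths (angle_form S2_angle) zero_pi zero_pi
    (legendre_list S2_angle zero_pi zero_pi sin sin) /\
  complete_list H2_lengths (angle_form H2_angle) zero_pi pos_real
    (legendre_list H2_angle zero_pi pos_real sin sinh) /\
  complete_list hexagon_lengths (angle_form hexagon_angle) pos_real pos_real
    (legendre_list hexagon_angle pos_real pos_real sinh sinh).
Proof.
  assert (UE : forall lambda, antiderivative_on pos_real (fun t => Rpower t (- lambda - 1))
     (fun x => RInt (fun t => Rpower t (- lambda - 1)) 1 x)).
  { intros lambda. apply antiderivative_RInt; [apply is_open_interval_pos_real|unfold pos_real; lra|].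
    intros x Hx. exact (smooth_on_continuous _ _ x (smooth_on_powers_sl E2_geometry (- lambda - 1)) Hx). }
  assert (US : forall lambda, antiderivative_on zero_pi (fun t => Rpower (sin t) (- lambda - 1))
     (fun x => RInt (fun t => Rpower (sin t) (- lambda - 1)) (PI / 2) x)).
  { intros lambda. pose proof PI_RGT_0.
    apply antiderivative_RInt; [apply is_open_interval_zero_pi|unfold zero_pi; lra|].
    intros x Hx. exact (smooth_on_continuous _ _ x (smooth_on_powers_sl S2_geometry (- lambda - 1)) Hx). }
  split; [split|split; [split|]].
  - exact (complete_edge_forms E2_geometry zero_pi_inhabited).
  - intros lambda F HF. split.
    + apply (integral_exists E2_geometry lambda F _ HF (UE lambda) (1, 1, 1)).
      * intros i. apply triangle_intro; lra.
      * exact convex3_triangle.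
    + intros W. apply (integral_locally_convex E2_geometry lambda F _ HF (UE lambda)); [reflexivity|].
      intros x _. simpl. lra.
  - exact (complete_edge_forms S2_geometry zero_pi_inhabited).
  - intros lambda F HF. split.
    + apply (integral_exists S2_geometry lambda F _ HF (US lambda) (1, 1, 1)).
      * split; [apply triangle_intro; lra|]. simpl. pose proof PI2_3_2. lra.
      * exact convex3_S2.
    + intros W. apply (integral_locally_strictly_convex S2_geometry lambda F _ HF (US lambda)); [reflexivity|].
      exact cos_between.
  - split; [|split; [|split; [|split]]].
    + exact (complete_edge_forms H2_geometry zero_pi_inhabited).
    + exact (complete_edge_forms hexagon_geometry pos_real_inhabited).
    + exact (complete_angle_forms S2_geometry zero_pi_inhabited).
    + exact (complete_angle_forms H2_geometry zero_pi_inhabited).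
    + exact (complete_angle_forms hexagon_geometry pos_real_inhabited).
Qed.
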